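(* Let $\Gamma$ be a cofinite discrete subgroup of $\mathrm{SL}_2(\mathbb{R})$ with cusps, let $r\in\mathbb{C}$ and let $v$ be a multiplier system for the weight $r$. For $F\in A_r(\Gamma,v)$ the following are equivalent: (a) the image of the cohomology class $[\psi^{z_0}_F]\in H^1(\Gamma;\mathcal{D}^\omega_{v,2-r})$ under the natural map $H^1(\Gamma;\mathcal{D}^\omega_{v,2-r})\to H^1(\Gamma;\mathcal{D}^{-\omega}_{v,2-r})$ vanishes; (b) there exists $H\in\mathcal{H}_{2-\bar r}(\Gamma,\bar v)$ with $2i\,y^{2-r}\,\overline{\partial_{\bar z}H}=F$.
   Context: $\mathbb{H}$ upper, $\mathbb{H}^-$ lower half-plane; $\Gamma\ni -I$ discrete with $\Gamma\backslash\mathbb{H}$ of finite volume, noncompact. Argument convention: $\arg(cz+d)\in(-\pi,\pi]$ for $z\in\mathbb{H}$, $\in[-\pi,\pi)$ for $z\in\mathbb{H}^-$. A multiplier system for weight $r$ is $v:\Gamma\to\mathbb{C}^*$ such that $j(\gamma,z)=v(\gamma)(cz+d)^r$ satisfies $j(\gamma\delta,z)=j(\gamma,\delta z)j(\delta,z)$ and $j(-\gamma,z)=j(\gamma,z)$. $A_r(\Gamma,v)$: holomorphic $F$ on $\mathbb{H}$ with $v(\gamma)^{-1}(cz+d)^{-r}F(\gamma z)=F(z)$ for all $\gamma=\begin{pmatrix}*&*\\c&d\end{pmatrix}\in\Gamma$. Action on functions on $\mathbb{H}^-$: $(\varphi|_{v,2-r}\gamma)(t)=v(\gamma)^{-1}(ct+d)^{r-2}\varphi(\gamma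 t)$. $\mathcal{D}^{-\omega}_{v,2-r}$: all holomorphic functions on $\mathbb{H}^-$ with this action. $\mathcal{D}^\omega_{v,2-r}$: the subspace of those $\varphi$ for which $(i-t)^{2-r}\varphi(t)$ ($\arg(i-t)\in(-\pi/2,3\pi/2)$) extends holomorphically to an open neighbourhood of $\mathbb{H}^-\cup\mathbb{P}^1(\mathbb{R})$ in $\mathbb{P}^1(\mathbb{C})$. $\psi^{z_0}_{F,\gamma}(t)=\int_{\gamma^{-1}z_0}^{z_0}(z-t)^{r-2}F(z)dz$ ($z_0\in\mathbb{H}$ fixed, $-\pi/2<\arg(z-t)<3\pi/2$); $\gamma\mapsto\psi^{z_0}_{F,\gamma}$ is a cocycle with values in $\mathcal{D}^\omega_{v,2-r}$. For $p\in\mathbb{C}$, $\Delta_p=-4y^2\partial_z\partial_{\bar z}+2ipy\partial_{\bar z}$. $\mathcal{H}_{2-\bar r}(\Gamma,\bar v)$ is the space of $C^2$ functions $H$ on $\mathbb{H}$ with $\Delta_{2-\bar r}H=0$ and $\overline{v(\gamma)}^{-1}(cz+d)^{\bar r-2}H(\gamma z)=H(z)$ for all $\gamma\in\Gamma$. *)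

(* Defs.v *)
From Stdlib Require Import Reals.

From mathcomp Require all_boot all_algebra all_classical all_reals all_analysis.
From mathcomp Require Rstruct Rstruct_topology.
Module HypArea.
Import all_boot all_algebra all_classical all_reals all_analysis.
Import Rstruct Rstruct_topology.
Import GRing.Theory Num.Theory.
Local Open Scope classical_set_scope.
Local Open Scope ring_scope.

Definition fha (R : realType) (D : set (R * R)) : Prop :=
  measurable D /\
  (\int[(@lebesgue_measure R) \x (@lebesgue_measure R)]_(p in D)
     ((p.2 ^-2)%:E) < +oo)%E.
Definition finite_hyp_area (D : Rdefinitions.R * Rdefinitions.R -> Prop) : Prop :=
  @fha Rdefinitions.R D.
End HypArea.
Notation finite_hyp_area := HypArea.finite_hyp_area.

From Coquelicot Require Import Coquelicot.

Open Scope R_scope.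

Record mat := Mat { ma : R; mb : R; mc : R; md : R }.

Definition mmul (g h : mat) : mat :=
  Mat (ma g * ma h + mb g * mc h) (ma g * mb h + mb g * md h)
      (mc g * ma h + md g * mc h) (mc g * mb h + md g * md h).
Definition mdet (g : mat) : R := ma g * md g - mb g * mc g.
Definition mI : mat := Mat 1 0 0 1.
Definition mneg (g : mat) : mat := Mat (- ma g) (- mb g) (- mc g) (- md g).
(* inverse of a determinant-one matrix *)
Definition minv (g : mat) : mat := Mat (md g) (- mb g) (- mc g) (ma g).

Definition is_SL2_subgroup (G : mat -> Prop) : Prop :=
  (forall g, G g -> mdet g = 1) /\ G mI /\
  (forall g h, G g -> G h -> G (mmul g h)) /\
  (forall g, G g -> G (minv g)).

Definition is_discrete (G : mat -> Prop) : Prop :=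
  forall g, G g -> exists eps, 0 < eps /\
    forall h, G h ->
      Rabs (ma h - ma g) < eps -> Rabs (mb h - mb g) < eps ->
      Rabs (mc h - mc g) < eps -> Rabs (md h - md g) < eps -> h = g.

Open Scope C_scope.

Definition upper (z : C) : Prop := (0 < Im z)%R.
Definition lower (z : C) : Prop := (Im z < 0)%R.

Definition mob (g : mat) (z : C) : C :=
  (RtoC (ma g) * z + RtoC (mb g)) / (RtoC (mc g) * z + RtoC (md g)).

Definition finite_covolume (G : mat -> Prop) : Prop :=
  exists D : R * R -> Prop,
    (forall w, D w -> upper w) /\ finite_hyp_area D /\
    forall z, upper z -> exists g w, G g /\ D w /\ z = mob g w.

Definition compact_in_H (K : C -> Prop) : Prop :=
  (forall w, K w -> upper w) /\
  (exists M, forall w, K w -> (Cmod w <= M)%R) /\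
  (forall z, ~ K z -> exists eps, (0 < eps)%R /\
       forall w, (Cmod (w - z) < eps)%R -> ~ K w).

(* Γ\H is noncompact (Γ has cusps) *)
Definition noncompact_quotient (G : mat -> Prop) : Prop :=
  ~ exists K, compact_in_H K /\
      forall z, upper z -> exists g w, G g /\ K w /\ z = mob g w.

Definition cexp (z : C) : C :=
  (exp (Re z) * cos (Im z), exp (Re z) * sin (Im z))%R.

(* argument in (-pi, pi]  (convention on H) *)
Definition Arg_up (z : C) : R :=
  if Rle_dec 0 (Im z) then acos (Re z / Cmod z) else (- acos (Re z / Cmod z))%R.
(* argument in [-pi, pi)  (convention on the lower half-plane) *)
Definition Arg_lo (z : C) : R :=
  if Rlt_dec 0 (Im z) then acos (Re z / Cmod z) else (- acos (Re z / Cmod z))%R.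

Definition cpow_up (z s : C) : C :=
  if Req_EM_T (Cmod z) 0 then 0 else cexp (s * (ln (Cmod z), Arg_up z)).
Definition cpow_lo (z s : C) : C :=
  if Req_EM_T (Cmod z) 0 then 0 else cexp (s * (ln (Cmod z), Arg_lo z)).

Definition cz_d (g : mat) (z : C) : C := RtoC (mc g) * z + RtoC (md g).

Definition jfac (v : mat -> C) (r : C) (g : mat) (z : C) : C :=
  v g * cpow_up (cz_d g z) r.

Definition multiplier_system (G : mat -> Prop) (v : mat -> C) (r : C) : Prop :=
  (forall g, G g -> v g <> 0) /\
  (forall g h z, G g -> G h -> upper z ->
     jfac v r (mmul g h) z = jfac v r g (mob h z) * jfac v r h z) /\
  (forall g z, G g -> upper z -> jfac v r (mneg g) z = jfac v r g z).

Definition holo_on (U : C -> Prop) (f : C -> C) : Prop :=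
  forall z, U z -> ex_derive (K := C_AbsRing) (V := C_NormedModule) f z.

Definition in_A (G : mat -> Prop) (v : mat -> C) (r : C) (F : C -> C) : Prop :=
  holo_on upper F /\
  forall g z, G g -> upper z ->
    / v g * cpow_up (cz_d g z) (- r) * F (mob g z) = F z.

Definition slash_lo (v : mat -> C) (r : C) (phi : C -> C) (g : mat) (t : C) : C :=
  / v g * cpow_lo (cz_d g t) (r - 2) * phi (mob g t).

Definition cint01 (h : R -> C) : C :=
  (RInt (fun s => Re (h s)) 0 1, RInt (fun s => Im (h s)) 0 1).

(* ψ^{z0}_{F,γ}(t) = ∫_{γ^{-1} z0}^{z0} (z-t)^{r-2} F(z) dz, integrated along
   the straight segment in H (the integrand is holomorphic in z ∈ H). *)
Definition psi (F : C -> C) (r z0 : C) (g : mat) (t : C) : C :=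
  let a := mob (minv g) z0 in
  cint01 (fun s => let z := a + RtoC s * (z0 - a) in
                   cpow_up (z - t) (r - 2) * F z * (z0 - a)).

(* (a): the image of [ψ] in H^1(Γ; D^{-ω}_{v,2-r}) vanishes, i.e. ψ is a
   coboundary with values in holomorphic functions on the lower half-plane *)
Definition psi_coboundary_minus_omega (G : mat -> Prop) (v : mat -> C) (r : C)
    (F : C -> C) (z0 : C) : Prop :=
  exists phi : C -> C, holo_on lower phi /\
    forall g t, G g -> lower t ->
      psi F r z0 g t = slash_lo v r phi g t - phi t.

Definition dX (f : C -> C) (z : C) : C :=
  (Derive (fun x => Re (f (x, Im z))) (Re z), Derive (fun x => Im (f (x, Im z))) (Re z)).
Definition dY (f : C -> C) (z : C) : C :=
  (Derive (fun y => Re (f (Re z, y))) (Im z), Derive (fun y => Im (f (Re z, y))) (Im z)).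

Definition C1_on (U : C -> Prop) (f : C -> C) : Prop :=
  forall z, U z ->
    continuous f z /\
    ex_derive (fun x => Re (f (x, Im z))) (Re z) /\
    ex_derive (fun x => Im (f (x, Im z))) (Re z) /\
    ex_derive (fun y => Re (f (Re z, y))) (Im z) /\
    ex_derive (fun y => Im (f (Re z, y))) (Im z) /\
    continuous (dX f) z /\ continuous (dY f) z.

Definition C2_on (U : C -> Prop) (f : C -> C) : Prop :=
  C1_on U f /\ C1_on U (dX f) /\ C1_on U (dY f).

Definition d_z (f : C -> C) (z : C) : C := (dX f z - Ci * dY f z) / 2.
Definition d_zbar (f : C -> C) (z : C) : C := (dX f z + Ci * dY f z) / 2.

Definition Delta (p : C) (f : C -> C) (z : C) : C :=
  - 4 * RtoC (Im z) ^ 2 * d_z (d_zbar f) z + 2 * Ci * p * RtoC (Im z) * d_zbar f z.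

Definition in_harm (G : mat -> Prop) (v : mat -> C) (r : C) (H : C -> C) : Prop :=
  C2_on upper H /\
  (forall z, upper z -> Delta (2 - Cconj r) H z = 0) /\
  (forall g z, G g -> upper z ->
     / Cconj (v g) * cpow_up (cz_d g z) (Cconj r - 2) * H (mob g z) = H z).

(* Main.v *)
(* Write s = r - 2 and, for t in the lower half-plane, let
   Theta(t) = int_{z0}^{conj t} (z - t)^s F(z) dz.  The upper limit is antiholomorphic in t, so
   d Theta / d(conj t) = (2iy)^s F(conj t) with y = Im (conj t), while the argument conventions
   make Theta|gamma - Theta = psi_gamma.  For H on the upper half-plane put k(t) = conj (H (conj t)).
   Then the differential equation of (b) says that k - (2i)^(1-r) Theta is holomorphic, and the
   automorphy of H says that k is invariant; hence H <-> phi = Theta - (2i)^(r-1) k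
   exchanges the solutions of (b) with the holomorphic phi such that phi|gamma - phi = psi_gamma.
   The regularity of H, and Delta H = 0, come from the fact that the derivative of Theta in t is
   again of the same shape, with s replaced by s - 1. *)
Require Import Defs.
From Stdlib Require Import Reals Lra Classical ClassicalEpsilon.
From Coquelicot Require Import Coquelicot.
Open Scope C_scope.

(** * Wirtinger derivatives *)

(** Differentiability is expressed by expansions [f w = f z + A (w - z) + B conj (w - z) + o(|w -
    z|)], so that holomorphic, antiholomorphic and mixed functions share one calculus; [Theta] is of
    mixed type, since [t] occurs in the kernel and [conj t] in the upper limit. Two facts about
    holomorphic functions carry the proof. One is path independence in the half-plane: [Theta] and
    [psi] are integrals over straight segments, which neither a change of the upper limit nor a
    Moebius map respects. It comes from Goursat's lemma for triangles. The other is smoothness: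
    [phi] in (a) is only known to be complex differentiable, whereas [H] has to be of class C2, so
    the derivative of a holomorphic function must be shown to be holomorphic. Means over circles
    give this. The remaining difficulty lies in the branches of the powers. Identities between them
    are proved for logarithms: two logarithms with the same exponential are equal as soon as their
    imaginary parts differ by less than [2 pi], and this is where the opposite argument conventions
    on the two half-planes are used. *)

Definition is_small (z : C) (e : C -> C) : Prop :=
  forall eps, (0 < eps)%R -> exists delta, (0 < delta)%R /\
    forall w, (Cmod (w - z) < delta)%R -> (Cmod (e w) <= eps * Cmod (w - z))%R.

(** [A] and [B] are the values at [z] of the derivatives in [z] and [conj z]; the existence of such
    a pair is real differentiability. *)
Definition wirtinger (f : C -> C) (z A B : C) : Prop :=
  is_small z (fun w => f w - f z - A * (w - z) - B * Cconj (w - z)).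

Definition cont_at (f : C -> C) (z : C) : Prop :=
  forall eps, (0 < eps)%R -> exists delta, (0 < delta)%R /\
    forall w, (Cmod (w - z) < delta)%R -> (Cmod (f w - f z) < eps)%R.

Lemma Cmod_minus_sym (a b : C) : Cmod (a - b) = Cmod (b - a).
Proof. rewrite <- Cmod_opp; f_equal; ring. Qed.

Lemma Cmod_minus_diag (z : C) : Cmod (z - z) = 0%R.
Proof. replace (z - z) with (RtoC 0) by ring; apply Cmod_0. Qed.

Lemma RtoC_neq_0 (x : R) : x <> 0%R -> RtoC x <> 0.
Proof. intros Hx H; apply Hx; now apply RtoC_inj. Qed.

Lemma is_small_le (z : C) (e1 e2 : C -> C) (d : R) :
  (0 < d)%R -> (forall w, (Cmod (w - z) < d)%R -> (Cmod (e2 w) <= Cmod (e1 w))%R) ->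
  is_small z e1 -> is_small z e2.
Proof.
intros Hd H He eps Heps; destruct (He eps Heps) as [d' [Hd' He']].
exists (Rmin d d'); split; [now apply Rmin_pos|].
intros w Hw; apply Rle_trans with (Cmod (e1 w)).
- apply H; eapply Rlt_le_trans; [exact Hw | apply Rmin_l].
- apply He'; eapply Rlt_le_trans; [exact Hw | apply Rmin_r].
Qed.

Lemma is_small_plus (z : C) (e1 e2 : C -> C) :
  is_small z e1 -> is_small z e2 -> is_small z (fun w => e1 w + e2 w).
Proof.
intros H1 H2 eps Heps.
destruct (H1 (eps / 2)%R) as [d1 [Hd1 H1']]; [lra|].
destruct (H2 (eps / 2)%R) as [d2 [Hd2 H2']]; [lra|].
exists (Rmin d1 d2); split; [now apply Rmin_pos|].
intros w Hw.
specialize (H1' w (Rlt_le_trans _ _ _ Hw (Rmin_l _ _))).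
specialize (H2' w (Rlt_le_trans _ _ _ Hw (Rmin_r _ _))).
pose proof (Cmod_triangle (e1 w) (e2 w)); lra.
Qed.

Lemma is_small_mult (z : C) (b e : C -> C) (M d : R) :
  (0 < d)%R -> (forall w, (Cmod (w - z) < d)%R -> (Cmod (b w) <= M)%R) ->
  is_small z e -> is_small z (fun w => b w * e w).
Proof.
intros Hd Hb He eps Heps.
assert (HM : (0 <= M)%R).
{ apply Rle_trans with (Cmod (b z)); [apply Cmod_ge_0|].
  apply Hb; rewrite Cmod_minus_diag; exact Hd. }
destruct (He (eps / (M + 1))%R) as [d' [Hd' He']].
{ apply Rdiv_lt_0_compat; lra. }
exists (Rmin d d'); split; [now apply Rmin_pos|].
intros w Hw.
specialize (He' w (Rlt_le_trans _ _ _ Hw (Rmin_r _ _))).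
specialize (Hb w (Rlt_le_trans _ _ _ Hw (Rmin_l _ _))).
rewrite Cmod_mult.
apply Rle_trans with ((M + 1) * (eps / (M + 1) * Cmod (w - z)))%R.
- apply Rmult_le_compat; try apply Cmod_ge_0; lra.
- right; field; lra.
Qed.

Lemma is_small_scal (z c : C) (e : C -> C) : is_small z e -> is_small z (fun w => c * e w).
Proof. intros H; apply is_small_mult with (Cmod c) 1%R; [lra | intros; lra | exact H]. Qed.

Lemma is_small_ext (z : C) (e1 e2 : C -> C) :
  (forall w, e1 w = e2 w) -> is_small z e1 -> is_small z e2.
Proof.
intros H; apply is_small_le with 1%R; [lra|]; intros w _; rewrite H; lra.
Qed.

Lemma is_small_quadratic (z : C) (e : C -> C) (K d : R) :
  (0 < d)%R ->
  (forall w, (Cmod (w - z) < d)%R -> (Cmod (e w) <= K * (Cmod (w - z) * Cmod (w - z)))%R) ->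
  is_small z e.
Proof.
intros Hd H eps Heps.
set (K' := (Rabs K + 1)%R).
assert (HK' : (0 < K')%R) by (unfold K'; pose proof (Rabs_pos K); lra).
exists (Rmin d (eps / K')); split.
{ apply Rmin_pos; [exact Hd | now apply Rdiv_lt_0_compat]. }
intros w Hw.
specialize (H w (Rlt_le_trans _ _ _ Hw (Rmin_l _ _))).
assert (H2 := Rlt_le_trans _ _ _ Hw (Rmin_r _ _)).
pose proof (Cmod_ge_0 (w - z)) as H0.
apply Rle_trans with (1 := H).
apply Rle_trans with (K' * Cmod (w - z) * Cmod (w - z))%R.
- rewrite <- Rmult_assoc; apply Rmult_le_compat_r; [exact H0|].
  apply Rmult_le_compat_r; [exact H0|]. unfold K'; pose proof (Rle_abs K); lra.
- apply Rmult_le_compat_r; [exact H0|].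
  apply Rmult_lt_compat_l with (1 := HK') in H2.
  replace (K' * (eps / K'))%R with eps in H2 by (field; lra). lra.
Qed.

Lemma wirtinger_lipschitz (f : C -> C) (z A B : C) :
  wirtinger f z A B -> exists K d, (0 < K)%R /\ (0 < d)%R /\
    forall w, (Cmod (w - z) < d)%R -> (Cmod (f w - f z) <= K * Cmod (w - z))%R.
Proof.
intros H; destruct (H 1%R Rlt_0_1) as [d [Hd H1]].
exists (1 + Cmod A + Cmod B)%R, d; split; [|split]; [|exact Hd|].
{ pose proof (Cmod_ge_0 A); pose proof (Cmod_ge_0 B); lra. }
intros w Hw; specialize (H1 w Hw).
set (e := f w - f z - A * (w - z) - B * Cconj (w - z)) in H1.
replace (f w - f z) with (e + (A * (w - z) + B * Cconj (w - z))) by (unfold e; ring).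
eapply Rle_trans; [apply Cmod_triangle|].
eapply Rle_trans; [apply Rplus_le_compat_l, Cmod_triangle|].
rewrite !Cmod_mult, Cmod_conj; lra.
Qed.

Lemma wirtinger_cont (f : C -> C) (z A B : C) : wirtinger f z A B -> cont_at f z.
Proof.
intros H eps Heps; destruct (wirtinger_lipschitz f z A B H) as [K [d [HK [Hd HL]]]].
exists (Rmin d (eps / K)); split.
{ apply Rmin_pos; [exact Hd | now apply Rdiv_lt_0_compat]. }
intros w Hw.
apply Rle_lt_trans with (1 := HL w (Rlt_le_trans _ _ _ Hw (Rmin_l _ _))).
assert (H2 := Rlt_le_trans _ _ _ Hw (Rmin_r _ _)).
apply Rmult_lt_compat_l with (1 := HK) in H2.
replace (K * (eps / K))%R with eps in H2 by (field; lra). lra.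
Qed.

Lemma wirtinger_ext_loc (f g : C -> C) (z A B : C) (d : R) :
  (0 < d)%R -> (forall w, (Cmod (w - z) < d)%R -> f w = g w) ->
  wirtinger f z A B -> wirtinger g z A B.
Proof.
intros Hd H; apply is_small_le with d; [exact Hd|].
intros w Hw; rewrite H, (H z); [lra | rewrite Cmod_minus_diag; exact Hd | exact Hw].
Qed.

Lemma wirtinger_ext (f g : C -> C) (z A B : C) :
  (forall w, f w = g w) -> wirtinger f z A B -> wirtinger g z A B.
Proof. intros H; apply wirtinger_ext_loc with 1%R; [lra | auto]. Qed.

Lemma wirtinger_affine (a b c z : C) :
  wirtinger (fun w => a * w + b * Cconj w + c) z a b.
Proof.
intros eps Heps; exists 1%R; split; [lra|]; intros w _.
rewrite Cminus_conj.
match goal with |- (Cmod ?x <= _)%R => replace x with (RtoC 0) by ring end.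
rewrite Cmod_0; apply Rmult_le_pos; [lra | apply Cmod_ge_0].
Qed.

Lemma wirtinger_const (c z : C) : wirtinger (fun _ => c) z 0 0.
Proof.
apply wirtinger_ext with (fun w => 0 * w + 0 * Cconj w + c); [intros; ring | apply wirtinger_affine].
Qed.

Lemma wirtinger_id (z : C) : wirtinger (fun w => w) z 1 0.
Proof.
apply wirtinger_ext with (fun w => 1 * w + 0 * Cconj w + 0); [intros; ring | apply wirtinger_affine].
Qed.

Lemma wirtinger_conj (z : C) : wirtinger Cconj z 0 1.
Proof.
apply wirtinger_ext with (fun w => 0 * w + 1 * Cconj w + 0); [intros; ring | apply wirtinger_affine].
Qed.

Lemma wirtinger_plus (f g : C -> C) (z A B A' B' : C) :
  wirtinger f z A B -> wirtinger g z A' B' ->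
  wirtinger (fun w => f w + g w) z (A + A') (B + B').
Proof.
intros Hf Hg; refine (is_small_ext _ _ _ _ (is_small_plus _ _ _ Hf Hg)); intros w; cbv beta; ring.
Qed.

Lemma wirtinger_mult (f g : C -> C) (z A B A' B' : C) :
  wirtinger f z A B -> wirtinger g z A' B' ->
  wirtinger (fun w => f w * g w) z (A * g z + f z * A') (B * g z + f z * B').
Proof.
intros Hf Hg.
destruct (wirtinger_lipschitz g z A' B' Hg) as [K [d [HK [Hd HL]]]].
assert (H1 : is_small z (fun w => g w * (f w - f z - A * (w - z) - B * Cconj (w - z)))).
{ apply is_small_mult with (Cmod (g z) + K * d)%R d; [exact Hd| |exact Hf].
  intros w Hw; replace (g w) with (g z + (g w - g z)) by ring.
  eapply Rle_trans; [apply Cmod_triangle|]; apply Rplus_le_compat_l.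
  eapply Rle_trans; [now apply HL|]; apply Rmult_le_compat_l; lra. }
assert (H2 := is_small_scal z (f z) _ Hg).
assert (H3 : is_small z (fun w => (A * (w - z) + B * Cconj (w - z)) * (g w - g z))).
{ apply is_small_quadratic with ((Cmod A + Cmod B) * K)%R d; [exact Hd|].
  intros w Hw; rewrite Cmod_mult.
  replace ((Cmod A + Cmod B) * K * (Cmod (w - z) * Cmod (w - z)))%R
    with (((Cmod A + Cmod B) * Cmod (w - z)) * (K * Cmod (w - z)))%R by ring.
  apply Rmult_le_compat; try apply Cmod_ge_0; [|now apply HL].
  eapply Rle_trans; [apply Cmod_triangle|]; rewrite !Cmod_mult, Cmod_conj; lra. }
refine (is_small_ext _ _ _ _ (is_small_plus _ _ _ (is_small_plus _ _ _ H1 H2) H3)).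
intros w; cbv beta; ring.
Qed.

(** The inner increment has coefficients [A], [B], its conjugate has [conj B], [conj A]; this is the
    origin of the crossed terms. *)
Lemma wirtinger_comp (f g : C -> C) (z A B D E : C) :
  wirtinger f z A B -> wirtinger g (f z) D E ->
  wirtinger (fun w => g (f w)) z (D * A + E * Cconj B) (D * B + E * Cconj A).
Proof.
intros Hf Hg.
destruct (wirtinger_lipschitz f z A B Hf) as [K [d [HK [Hd HL]]]].
assert (H1 : is_small z (fun w =>
   g (f w) - g (f z) - D * (f w - f z) - E * Cconj (f w - f z))).
{ intros eps Heps; destruct (Hg (eps / K)%R) as [d' [Hd' Hg']].
  { now apply Rdiv_lt_0_compat. }
  exists (Rmin d (d' / K)); split.
  { apply Rmin_pos; [exact Hd | now apply Rdiv_lt_0_compat]. }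
  intros w Hw.
  specialize (HL w (Rlt_le_trans _ _ _ Hw (Rmin_l _ _))).
  assert (H2 := Rlt_le_trans _ _ _ Hw (Rmin_r _ _)).
  apply Rmult_lt_compat_l with (1 := HK) in H2.
  replace (K * (d' / K))%R with d' in H2 by (field; lra).
  eapply Rle_trans; [apply Hg'; lra|].
  apply Rle_trans with (eps / K * (K * Cmod (w - z)))%R; [|right; field; lra].
  apply Rmult_le_compat_l; [|exact HL]. left; now apply Rdiv_lt_0_compat. }
assert (H2 := is_small_scal z D _ Hf).
assert (H3 : is_small z (fun w => E * Cconj (f w - f z - A * (w - z) - B * Cconj (w - z)))).
{ apply is_small_scal.
  refine (is_small_le _ _ _ 1%R Rlt_0_1 _ Hf); intros w _; rewrite Cmod_conj; lra. }
refine (is_small_ext _ _ _ _ (is_small_plus _ _ _ (is_small_plus _ _ _ H1 H2) H3)).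
intros w; cbv beta; rewrite !Cminus_conj, !Cmult_conj, !Cminus_conj, !Cconj_conj; ring.
Qed.

Lemma wirtinger_eq (f : C -> C) (z A B A' B' : C) :
  A = A' -> B = B' -> wirtinger f z A B -> wirtinger f z A' B'.
Proof. now intros -> ->. Qed.

Definition cderiv (f : C -> C) (z l : C) : Prop := wirtinger f z l 0.

Lemma cderiv_comp (f g : C -> C) (z D E : C) :
  cderiv f z D -> cderiv g (f z) E -> cderiv (fun w => g (f w)) z (E * D).
Proof.
intros Hf Hg; apply (wirtinger_eq _ _ _ _ _ _) with (3 := wirtinger_comp _ _ _ _ _ _ _ Hf Hg); ring.
Qed.

Lemma cderiv_scal (f : C -> C) (c z D : C) :
  cderiv f z D -> cderiv (fun w => c * f w) z (c * D).
Proof.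
intros Hf; apply (wirtinger_eq _ _ _ _ _ _) with (3 := wirtinger_mult _ _ _ _ _ _ _ (wirtinger_const c z) Hf); ring.
Qed.

Lemma wirtinger_scal (f : C -> C) (c z A B : C) :
  wirtinger f z A B -> wirtinger (fun w => c * f w) z (c * A) (c * B).
Proof.
intros Hf; apply (wirtinger_eq _ _ _ _ _ _) with (3 := wirtinger_mult _ _ _ _ _ _ _ (wirtinger_const c z) Hf); ring.
Qed.

Lemma wirtinger_minus (f g : C -> C) (z A B A' B' : C) :
  wirtinger f z A B -> wirtinger g z A' B' ->
  wirtinger (fun w => f w - g w) z (A - A') (B - B').
Proof.
intros Hf Hg.
refine (is_small_ext _ _ _ _ (is_small_plus _ _ _ Hf (is_small_scal _ (-(1)) _ Hg))); intros w; cbv beta; ring.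
Qed.

Lemma cderiv_plus (f g : C -> C) (z D E : C) :
  cderiv f z D -> cderiv g z E -> cderiv (fun w => f w + g w) z (D + E).
Proof.
intros Hf Hg; apply (wirtinger_eq _ _ _ _ _ _) with (3 := wirtinger_plus _ _ _ _ _ _ _ Hf Hg); ring.
Qed.

Lemma cderiv_minus (f g : C -> C) (z D E : C) :
  cderiv f z D -> cderiv g z E -> cderiv (fun w => f w - g w) z (D - E).
Proof.
intros Hf Hg; apply (wirtinger_eq _ _ _ _ _ _) with (3 := wirtinger_minus _ _ _ _ _ _ _ Hf Hg); ring.
Qed.

Lemma cderiv_mult (f g : C -> C) (z D E : C) :
  cderiv f z D -> cderiv g z E -> cderiv (fun w => f w * g w) z (D * g z + f z * E).
Proof.
intros Hf Hg; apply (wirtinger_eq _ _ _ _ _ _) with (3 := wirtinger_mult _ _ _ _ _ _ _ Hf Hg); ring.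
Qed.

Lemma cderiv_affine (a b z : C) : cderiv (fun w => a + w * b) z b.
Proof.
apply wirtinger_ext with (fun w => b * w + 0 * Cconj w + a); [intros; ring | apply wirtinger_affine].
Qed.

Lemma cont_at_near_nonzero (z : C) : z <> 0 ->
  forall w, (Cmod (w - z) < Cmod z / 2)%R -> (Cmod z / 2 < Cmod w)%R.
Proof.
intros Hz w Hw; pose proof (Cmod_triangle w (z - w)) as H.
replace (w + (z - w)) with z in H by ring; rewrite (Cmod_minus_sym z w) in H; lra.
Qed.

Lemma cderiv_inv (z : C) : z <> 0 -> cderiv Cinv z (- / (z * z)).
Proof.
intros Hz; assert (Hz' := proj1 (Cmod_gt_0 z) Hz).
apply is_small_quadratic with (/ (Cmod z / 2 * Cmod z * Cmod z))%R (Cmod z / 2)%R; [lra|].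
intros w Hw.
assert (Hw' := cont_at_near_nonzero z Hz w Hw).
assert (Hw0 : w <> 0) by (apply Cmod_gt_0; lra).
replace (/ w - / z - - / (z * z) * (w - z) - 0 * Cconj (w - z))
  with (/ (w * z * z) * ((w - z) * (w - z))) by (field; auto).
rewrite !Cmod_mult, Cmod_inv, !Cmod_mult by (repeat apply Cmult_neq_0; auto).
apply Rmult_le_compat_r; [apply Rmult_le_pos; apply Cmod_ge_0|].
apply Rinv_le_contravar.
- repeat apply Rmult_lt_0_compat; lra.
- apply Rmult_le_compat_r; [lra|]; apply Rmult_le_compat_r; lra.
Qed.

Lemma is_derive_cderiv (f : C -> C) (z l : C) :
  is_derive (K := C_AbsRing) (V := C_NormedModule) f z l <-> cderiv f z l.
Proof.
split.
- intros [_ H] eps Heps.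
  specialize (H z (fun P HP => HP) (mkposreal eps Heps)).
  destruct H as [d Hd].
  exists d; split; [apply cond_pos|].
  intros w Hw; specialize (Hd w Hw).
  unfold norm, minus, plus, opp, scal in Hd; simpl in Hd.
  unfold mult in Hd; simpl in Hd.
  unfold abs in Hd; simpl in Hd.
  replace (f w - f z - l * (w - z) - 0 * Cconj (w - z)) with (f w + - f z + - ((w + - z) * l)) by ring.
  exact Hd.
- intros H; split; [apply is_linear_scal_l|].
  intros x Hx eps.
  assert (Hxz : z = x) by (apply (is_filter_lim_locally_unique (K := C_AbsRing) (V := AbsRing_NormedModule C_AbsRing)); exact Hx).
  subst x.
  destruct (H eps (cond_pos eps)) as [d [Hd Hw]].
  exists (mkposreal d Hd); intros w Hb; specialize (Hw w Hb).
  unfold norm, minus, plus, opp, scal; simpl.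
  unfold mult; simpl. unfold abs; simpl.
  replace (f w + - f z + - ((w + - z) * l)) with (f w - f z - l * (w - z) - 0 * Cconj (w - z)) by ring.
  exact Hw.
Qed.

(** * Integrals over the unit interval *)

Lemma C_ext (a b : C) : Re a = Re b -> Im a = Im b -> a = b.
Proof. destruct a, b; simpl; congruence. Qed.

Lemma Re_le_Cmod (z : C) : (Re z <= Cmod z)%R.
Proof. eapply Rle_trans; [apply Rle_abs | apply re_le_Cmod]. Qed.

Lemma Im_le_Cmod (z : C) : (Rabs (Im z) <= Cmod z)%R.
Proof. eapply Rle_trans; [apply Rmax_r | apply Rmax_Cmod]. Qed.

Lemma Re_Cconj_mult_self (z : C) : Re (Cconj z * z) = (Cmod z * Cmod z)%R.
Proof.
pose proof (Cmod2_alt z) as H; rewrite re_mult, re_conj, im_conj.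
simpl in H; rewrite !Rmult_1_r in H; rewrite H; ring.
Qed.

(** Duality: testing a complex number against its own conjugate turns a bound on a real part into a
    bound on the modulus with the same constant. Real mean value and integral inequalities thus
    apply to complex functions without loss. *)
Lemma Cmod_le_of_Re (z : C) (M : R) :
  (0 <= M)%R -> (Re (Cconj z * z) <= Cmod z * M)%R -> (Cmod z <= M)%R.
Proof.
intros HM H; rewrite Re_Cconj_mult_self in H.
destruct (Rle_lt_or_eq_dec 0 (Cmod z) (Cmod_ge_0 z)) as [Hz|Hz]; [|lra].
now apply Rmult_le_reg_l with (Cmod z).
Qed.

Lemma is_derive_eps (f : R -> R) (x l : R) :
  (forall eps, (0 < eps)%R -> exists delta, (0 < delta)%R /\
     forall y, (Rabs (y - x) < delta)%R ->
       (Rabs (f y - f x - l * (y - x)) <= eps * Rabs (y - x))%R) ->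
  is_derive f x l.
Proof.
intros H; split; [apply is_linear_scal_l|].
intros x' Hx eps.
assert (Hxx : x = x') by (apply (is_filter_lim_locally_unique (K := R_AbsRing) (V := R_NormedModule)); exact Hx).
subst x'.
destruct (H eps (cond_pos eps)) as [d [Hd Hw]].
exists (mkposreal d Hd); intros w Hb; specialize (Hw w Hb).
unfold norm, minus, plus, opp, scal; simpl.
unfold mult; simpl. unfold abs; simpl.
replace (f w + - f x + - ((w + - x) * l))%R with (f w - f x - l * (w - x))%R by ring.
exact Hw.
Qed.

Lemma Re_line_remainder (p q c A B e : C) (x : R) :
  (Re (c * p) - Re (c * q) - Re (c * (A * e + B * Cconj e)) * x)%R =
  Re (c * (p - q - A * (RtoC x * e) - B * (RtoC x * Cconj e))).
Proof. destruct p, q, c, A, B, e; simpl; ring. Qed.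

(** The free factor [c] stands for all real linear functionals at once: [c = 1] and [c = - Ci]
    recover real and imaginary part, and the conjugate of a remainder is the choice that suits
    [Cmod_le_of_Re]. *)
Lemma wirtinger_line (f : C -> C) (a e c A B : C) (u : R) :
  wirtinger f (a + RtoC u * e) A B ->
  is_derive (fun u => Re (c * f (a + RtoC u * e))) u (Re (c * (A * e + B * Cconj e))).
Proof.
intros Hf; apply is_derive_eps; intros eps Heps.
assert (H0 : (0 <= Cmod c * Cmod e)%R) by (apply Rmult_le_pos; apply Cmod_ge_0).
assert (He := Cmod_ge_0 e).
destruct (Hf (eps / (Cmod c * Cmod e + 1))%R) as [d [Hd H]].
{ apply Rdiv_lt_0_compat; lra. }
exists (d / (Cmod e + 1))%R; split; [apply Rdiv_lt_0_compat; lra|].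
intros y Hy.
assert (E : (a + RtoC y * e) - (a + RtoC u * e) = RtoC (y - u) * e) by (rewrite RtoC_minus; ring).
assert (Em : Cmod ((a + RtoC y * e) - (a + RtoC u * e)) = (Rabs (y - u) * Cmod e)%R)
  by (rewrite E, Cmod_mult, Cmod_R; reflexivity).
specialize (H (a + RtoC y * e)).
rewrite Em, E in H.
assert (Hlt : (Rabs (y - u) * Cmod e < d)%R).
{ apply Rle_lt_trans with (Rabs (y - u) * (Cmod e + 1))%R.
  - apply Rmult_le_compat_l; [apply Rabs_pos | lra].
  - apply Rmult_lt_compat_r with (r := (Cmod e + 1)%R) in Hy; [|lra].
    replace (d / (Cmod e + 1) * (Cmod e + 1))%R with d in Hy by (field; lra). exact Hy. }
specialize (H Hlt).
set (X := f (a + RtoC y * e) - f (a + RtoC u * e) - A * (RtoC (y - u) * e)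
          - B * Cconj (RtoC (y - u) * e)) in H.
assert (EX : (Re (c * f (a + RtoC y * e)%C) - Re (c * f (a + RtoC u * e)%C) -
   Re (c * (A * e + B * Cconj e)) * (y - u))%R = Re (c * X)).
{ unfold X; rewrite Cmult_conj.
  replace (Cconj (RtoC (y - u))) with (RtoC (y - u)) by (apply C_ext; simpl; ring).
  apply Re_line_remainder. }
rewrite EX.
eapply Rle_trans; [apply re_le_Cmod|]; rewrite Cmod_mult.
eapply Rle_trans; [apply Rmult_le_compat_l; [apply Cmod_ge_0 | exact H]|].
replace (Cmod c * (eps / (Cmod c * Cmod e + 1) * (Rabs (y - u) * Cmod e)))%R
  with ((Cmod c * Cmod e) / (Cmod c * Cmod e + 1) * (eps * Rabs (y - u)))%R by (field; lra).
rewrite <- (Rmult_1_l (eps * Rabs (y - u))) at 2.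
apply Rmult_le_compat_r; [apply Rmult_le_pos; [lra | apply Rabs_pos]|].
apply Rle_div_l; lra.
Qed.

Lemma cderiv_line (f : C -> C) (a e c D : C) (u : R) :
  cderiv f (a + RtoC u * e) D ->
  is_derive (fun u => Re (c * f (a + RtoC u * e))) u (Re (c * (D * e))).
Proof.
intros H; replace (D * e) with (D * e + 0 * Cconj e) by ring; now apply wirtinger_line.
Qed.

(** The real mean value theorem is applied to [u |-> Re (c * f (z + u h))] on the unit interval,
    with [c] the conjugate of the remainder [X]: the increment of this function minus
    [Re (c * (D * h))] is the squared modulus of [X]. *)
Lemma cderiv_mean_value (f f' : C -> C) (z h D : C) (M : R) :
  (forall u, (0 <= u <= 1)%R -> cderiv f (z + RtoC u * h) (f' (z + RtoC u * h))) ->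
  (forall u, (0 <= u <= 1)%R -> (Cmod (f' (z + RtoC u * h)%C - D) <= M)%R) ->
  (Cmod (f (z + h)%C - f z - D * h) <= M * Cmod h)%R.
Proof.
intros Hd HM.
set (X := f (z + h) - f z - D * h).
apply Cmod_le_of_Re.
{ apply Rmult_le_pos; [|apply Cmod_ge_0].
  eapply Rle_trans; [apply Cmod_ge_0 | apply (HM 0%R); lra]. }
set (c := Cconj X).
destruct (MVT_gen (fun u => Re (c * f (z + RtoC u * h))) 0 1
  (fun u => Re (c * (f' (z + RtoC u * h) * h)))) as [u [Hu E]].
- intros u Hu; rewrite Rmin_left, Rmax_right in Hu by lra. apply cderiv_line, Hd; lra.
- intros u Hu; rewrite Rmin_left, Rmax_right in Hu by lra.
  apply continuity_pt_filterlim, (ex_derive_continuous (V := R_NormedModule)).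
  eexists; apply cderiv_line, Hd; lra.
- rewrite Rmin_left, Rmax_right in Hu by lra.
  replace (z + RtoC 1 * h) with (z + h) in E by ring.
  replace (z + RtoC 0 * h) with z in E by ring.
  assert (E2 : Re (c * X) = Re (c * ((f' (z + RtoC u * h)%C - D) * h))).
  { unfold X.
    assert (E3 : (Re (c * f (z + h)%C) - Re (c * f z) = Re (c * (f' (z + RtoC u * h)%C * h)))%R)
      by (rewrite E; ring).
    replace (c * (f (z + h) - f z - D * h)) with (c * f (z + h) - c * f z - c * (D * h)) by ring.
    replace (c * ((f' (z + RtoC u * h)%C - D) * h)) with (c * (f' (z + RtoC u * h) * h) - c * (D * h)) by ring.
    unfold Cminus; rewrite !re_plus, !re_opp; lra. }
  fold X; rewrite E2; eapply Rle_trans; [apply Re_le_Cmod|].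
  rewrite !Cmod_mult; unfold c; rewrite Cmod_conj.
  apply Rmult_le_compat_l; [apply Cmod_ge_0|].
  apply Rmult_le_compat_r; [apply Cmod_ge_0 | now apply HM].
Qed.

Definition rcont (h : R -> C) (s : R) : Prop :=
  forall eps, (0 < eps)%R -> exists delta, (0 < delta)%R /\
    forall u, (Rabs (u - s) < delta)%R -> (Cmod (h u - h s) < eps)%R.

Definition rcont01 (h : R -> C) : Prop := forall s, (0 <= s <= 1)%R -> rcont h s.

Lemma rcont_Re (h : R -> C) (c : C) (s : R) :
  rcont h s -> continuous (fun u => Re (c * h u)) s.
Proof.
intros H; apply continuity_pt_filterlim; intros eps Heps.
destruct (H (eps / (Cmod c + 1))%R) as [d [Hd Hu]].
{ apply Rdiv_lt_0_compat; [lra|]; pose proof (Cmod_ge_0 c); lra. }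
exists d; split; [exact Hd|].
intros u [_ Hus]; change (Rabs (Re (c * h u) - Re (c * h s)) < eps)%R.
specialize (Hu u Hus).
replace (Re (c * h u) - Re (c * h s))%R with (Re (c * (h u - h s)))
  by (destruct c, (h u), (h s); simpl; ring).
eapply Rle_lt_trans; [apply re_le_Cmod|]; rewrite Cmod_mult.
pose proof (Cmod_ge_0 c) as Hc.
eapply Rle_lt_trans; [apply Rmult_le_compat_r; [apply Cmod_ge_0|]; apply Rle_trans with (Cmod c + 1)%R; [lra | apply Rle_refl]|].
apply Rmult_lt_compat_l with (r := (Cmod c + 1)%R) in Hu; [|lra].
replace ((Cmod c + 1) * (eps / (Cmod c + 1)))%R with eps in Hu by (field; lra). exact Hu.
Qed.

Lemma rcont_ext (h k : R -> C) (s : R) : (forall u, h u = k u) -> rcont h s -> rcont k s.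
Proof.
intros E H eps Heps; destruct (H eps Heps) as [d [Hd Hu]]; exists d; split; [exact Hd|].
intros u Hus; rewrite <- !E; auto.
Qed.

Lemma rcont_plus (h k : R -> C) (s : R) : rcont h s -> rcont k s -> rcont (fun u => h u + k u) s.
Proof.
intros H K eps Heps.
destruct (H (eps / 2)%R) as [d [Hd Hu]]; [lra|].
destruct (K (eps / 2)%R) as [d' [Hd' Ku]]; [lra|].
exists (Rmin d d'); split; [now apply Rmin_pos|].
intros u Hus.
specialize (Hu u (Rlt_le_trans _ _ _ Hus (Rmin_l _ _))).
specialize (Ku u (Rlt_le_trans _ _ _ Hus (Rmin_r _ _))).
replace (h u + k u - (h s + k s)) with ((h u - h s) + (k u - k s)) by ring.
eapply Rle_lt_trans; [apply Cmod_triangle|]; lra.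
Qed.

Lemma rcont_comp (f : C -> C) (h : R -> C) (s : R) :
  rcont h s -> cont_at f (h s) -> rcont (fun u => f (h u)) s.
Proof.
intros H Hf eps Heps; destruct (Hf eps Heps) as [d [Hd Hw]].
destruct (H d Hd) as [d' [Hd' Hu]].
exists d'; split; [exact Hd'|]; auto.
Qed.

Lemma rcont_line (a e : C) (s : R) : rcont (fun u => a + RtoC u * e) s.
Proof.
intros eps Heps; exists (eps / (Cmod e + 1))%R; pose proof (Cmod_ge_0 e).
split; [apply Rdiv_lt_0_compat; lra|].
intros u Hu.
replace (a + RtoC u * e - (a + RtoC s * e)) with (RtoC (u - s) * e) by (rewrite RtoC_minus; ring).
rewrite Cmod_mult, Cmod_R.
apply Rle_lt_trans with (Rabs (u - s) * (Cmod e + 1))%R.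
- apply Rmult_le_compat_l; [apply Rabs_pos | lra].
- apply Rmult_lt_compat_r with (r := (Cmod e + 1)%R) in Hu; [|lra].
  replace (eps / (Cmod e + 1) * (Cmod e + 1))%R with eps in Hu by (field; lra). exact Hu.
Qed.

Lemma cont_at_scal (f : C -> C) (c z : C) : cont_at f z -> cont_at (fun w => c * f w) z.
Proof.
intros H eps Heps; pose proof (Cmod_ge_0 c) as Hc.
destruct (H (eps / (Cmod c + 1))%R) as [d [Hd Hw]]; [apply Rdiv_lt_0_compat; lra|].
exists d; split; [exact Hd|]; intros w Hwz; specialize (Hw w Hwz).
replace (c * f w - c * f z) with (c * (f w - f z)) by ring; rewrite Cmod_mult.
eapply Rle_lt_trans; [apply Rmult_le_compat_r; [apply Cmod_ge_0|]; apply Rle_trans with (Cmod c + 1)%R; [lra | apply Rle_refl]|].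
apply Rmult_lt_compat_l with (r := (Cmod c + 1)%R) in Hw; [|lra].
replace ((Cmod c + 1) * (eps / (Cmod c + 1)))%R with eps in Hw by (field; lra). exact Hw.
Qed.

Lemma rcont_scal (h : R -> C) (c : C) (s : R) : rcont h s -> rcont (fun u => c * h u) s.
Proof.
intros H; apply (rcont_comp (fun w => c * w)); [exact H|].
apply (wirtinger_cont _ _ c 0), wirtinger_ext with (fun w => c * w + 0 * Cconj w + 0);
  [intros; ring | apply wirtinger_affine].
Qed.

Lemma rcont01_ex_RInt (h : R -> C) (c : C) :
  rcont01 h -> ex_RInt (fun s => Re (c * h s)) 0 1.
Proof.
intros H; apply (ex_RInt_continuous (V := R_CompleteNormedModule)).
intros s Hs; rewrite Rmin_left, Rmax_right in Hs by lra; apply rcont_Re, H, Hs.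
Qed.

Lemma RInt01_ext (f g : R -> R) :
  (forall s, (0 <= s <= 1)%R -> f s = g s) -> RInt f 0 1 = RInt g 0 1.
Proof.
intros H; apply RInt_ext; intros s Hs; rewrite Rmin_left, Rmax_right in Hs by lra; apply H; lra.
Qed.

Lemma Re_1_mult (z : C) : Re (1 * z) = Re z.
Proof. now rewrite Cmult_1_l. Qed.

Lemma Re_mCi_mult (z : C) : Re (- Ci * z) = Im z.
Proof. destruct z; simpl; ring. Qed.

Lemma rcont01_ex_RInt_Re (h : R -> C) : rcont01 h -> ex_RInt (fun s => Re (h s)) 0 1.
Proof.
intros H; apply (ex_RInt_ext (fun s => Re (1 * h s))); [intros; apply Re_1_mult|].
now apply rcont01_ex_RInt.
Qed.

Lemma rcont01_ex_RInt_Im (h : R -> C) : rcont01 h -> ex_RInt (fun s => Im (h s)) 0 1.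
Proof.
intros H; apply (ex_RInt_ext (fun s => Re (- Ci * h s))); [intros; apply Re_mCi_mult|].
now apply rcont01_ex_RInt.
Qed.

Lemma cint01_ext (h k : R -> C) :
  (forall s, (0 <= s <= 1)%R -> h s = k s) -> cint01 h = cint01 k.
Proof.
intros H; apply C_ext; simpl; apply RInt01_ext; intros s Hs; now rewrite H.
Qed.

Lemma Re_cint01_scal (h : R -> C) (c : C) :
  rcont01 h -> Re (c * cint01 h) = RInt (fun s => Re (c * h s)) 0 1.
Proof.
intros H.
pose proof (rcont01_ex_RInt_Re h H) as HR; pose proof (rcont01_ex_RInt_Im h H) as HI.
symmetry; apply is_RInt_unique; rewrite re_mult.
apply (is_RInt_ext (V := R_NormedModule)
  (fun s => minus (scal (Re c) (Re (h s))) (scal (Im c) (Im (h s))))).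
{ intros s _; rewrite re_mult; reflexivity. }
apply (is_RInt_minus (V := R_NormedModule)); apply (is_RInt_scal (V := R_NormedModule));
  now apply (RInt_correct (V := R_CompleteNormedModule)).
Qed.

Lemma cint01_scal (h : R -> C) (c : C) :
  rcont01 h -> cint01 (fun s => c * h s) = c * cint01 h.
Proof.
intros H; apply C_ext.
- rewrite Re_cint01_scal by exact H; reflexivity.
- rewrite <- (Re_mCi_mult (c * cint01 h)), Cmult_assoc, Re_cint01_scal by exact H.
  apply RInt01_ext; intros s _; simpl; ring.
Qed.

Lemma cint01_plus (h k : R -> C) :
  rcont01 h -> rcont01 k -> cint01 (fun s => h s + k s) = cint01 h + cint01 k.
Proof.
intros H K; apply C_ext.
- apply (RInt_plus (V := R_CompleteNormedModule)); now apply rcont01_ex_RInt_Re.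
- apply (RInt_plus (V := R_CompleteNormedModule)); now apply rcont01_ex_RInt_Im.
Qed.

Lemma cint01_bound (h : R -> C) (M : R) :
  rcont01 h -> (forall s, (0 <= s <= 1)%R -> (Cmod (h s) <= M)%R) -> (Cmod (cint01 h) <= M)%R.
Proof.
intros H HM; apply Cmod_le_of_Re.
{ eapply Rle_trans; [apply Cmod_ge_0 | apply (HM 0%R); lra]. }
set (c := cint01 h) at 1 3; rewrite Re_cint01_scal by exact H.
replace (Cmod c * M)%R with (RInt (fun _ => (Cmod c * M)%R) 0 1)
  by (rewrite RInt_const; unfold scal; simpl; unfold mult; simpl; ring).
apply RInt_le; [lra | now apply rcont01_ex_RInt | apply ex_RInt_const|].
intros s Hs; eapply Rle_trans; [apply Re_le_Cmod|]; rewrite Cmod_mult, Cmod_conj.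
apply Rmult_le_compat_l; [apply Cmod_ge_0 | apply HM; lra].
Qed.

Lemma cint01_derive (P h : R -> C) :
  (forall c s, (0 <= s <= 1)%R -> is_derive (fun u => Re (c * P u)) s (Re (c * h s))) ->
  rcont01 h -> cint01 h = P 1%R - P 0%R.
Proof.
intros HP H.
assert (E : forall c, RInt (fun s => Re (c * h s)) 0 1 = (Re (c * P 1%R) - Re (c * P 0%R))%R).
{ intros c; apply is_RInt_unique, (is_RInt_derive (V := R_CompleteNormedModule) (fun u => Re (c * P u))).
  - intros s Hs; rewrite Rmin_left, Rmax_right in Hs by lra; now apply HP.
  - intros s Hs; rewrite Rmin_left, Rmax_right in Hs by lra; now apply rcont_Re, H. }
apply C_ext.
- rewrite <- Re_1_mult, Re_cint01_scal, E, !Re_1_mult by exact H; reflexivity.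
- rewrite <- Re_mCi_mult, Re_cint01_scal, E, !Re_mCi_mult by exact H; reflexivity.
Qed.

(** * Joint continuity and differentiation under the integral sign *)

Definition jcont (k : R -> C -> C) (s : R) (t : C) : Prop :=
  forall eps, (0 < eps)%R -> exists delta, (0 < delta)%R /\
    forall s' t', (Rabs (s' - s) < delta)%R -> (Cmod (t' - t) < delta)%R ->
      (Cmod (k s' t' - k s t) < eps)%R.

Lemma jcont_rcont (k : R -> C -> C) (s : R) (t : C) : jcont k s t -> rcont (fun s => k s t) s.
Proof.
intros H eps Heps; destruct (H eps Heps) as [d [Hd Hw]]; exists d; split; [exact Hd|].
intros u Hu; apply Hw; [exact Hu | now rewrite Cmod_minus_diag].
Qed.

(** A tube lemma. Compactness gives one radius [d] such that every [s] lies in the window of some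
    [x] whose own radius is at least [d]; comparing both [k s t'] and [k s t] with [k x t] costs
    [eps / 2] each. *)
Lemma jcont_uniform (k : R -> C -> C) (t : C) (eps : R) :
  (0 < eps)%R -> (forall s, (0 <= s <= 1)%R -> jcont k s t) ->
  exists delta, (0 < delta)%R /\
    forall s t', (0 <= s <= 1)%R -> (Cmod (t' - t) < delta)%R ->
      (Cmod (k s t' - k s t) < eps)%R.
Proof.
intros Heps H.
assert (Hd : forall s, exists d : posreal, (0 <= s <= 1)%R ->
  forall s' t', (Rabs (s' - s) < d)%R -> (Cmod (t' - t) < d)%R ->
      (Cmod (k s' t' - k s t) < eps / 2)%R).
{ intros s; destruct (classic (0 <= s <= 1)%R) as [Hs|Hs].
  - destruct (H s Hs (eps / 2)%R) as [d [Hd Hw]]; [lra|]; now exists (mkposreal d Hd).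
  (* The gauge has to be total; outside the unit interval any radius will do. *)
  - exists (mkposreal 1 Rlt_0_1); intros; contradiction. }
set (delta := fun s => proj1_sig (constructive_indefinite_description _ (Hd s))).
destruct (compactness_value_1d 0 1 delta) as [d HD].
exists d; split; [apply cond_pos|]; intros s t' Hs Ht'.
(* The compactness statement provides its point under a double negation. *)
destruct (NNPP _ (HD s Hs)) as [x [Hx [Hsx Hdx]]].
unfold delta in Hsx, Hdx; destruct (constructive_indefinite_description _ (Hd x)) as [dx Hdx']; simpl in *.
specialize (Hdx' Hx).
assert (H1 := Hdx' s t' Hsx (Rlt_le_trans _ _ _ Ht' Hdx)).
assert (H2 := Hdx' s t Hsx); rewrite Cmod_minus_diag in H2; specialize (H2 (cond_pos dx)).
replace (k s t' - k s t) with ((k s t' - k x t) + (k x t - k s t)) by ring.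
eapply Rle_lt_trans; [apply Cmod_triangle|]; rewrite (Cmod_minus_sym (k x t)); lra.
Qed.

(** For each [s] the mean value inequality bounds the remainder of [k s] at [t] by the oscillation
    of [k' s] near [t]. This oscillation is small uniformly in [s] by [jcont_uniform], so the bound
    survives integration. *)
Lemma cint01_param_deriv (k k' : R -> C -> C) (t : C) (d : R) :
  (0 < d)%R ->
  (forall s t', (0 <= s <= 1)%R -> (Cmod (t' - t) < d)%R -> cderiv (k s) t' (k' s t')) ->
  (forall t', (Cmod (t' - t) < d)%R -> rcont01 (fun s => k s t')) ->
  (forall s, (0 <= s <= 1)%R -> jcont k' s t) ->
  cderiv (fun t => cint01 (fun s => k s t)) t (cint01 (fun s => k' s t)).
Proof.
intros Hd Hk Hc Hk' eps Heps.
destruct (jcont_uniform k' t eps Heps Hk') as [d' [Hd' Hu]].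
exists (Rmin d d'); split; [now apply Rmin_pos|]; intros w Hw.
assert (Hw1 := Rlt_le_trans _ _ _ Hw (Rmin_l _ _)).
assert (Hw2 := Rlt_le_trans _ _ _ Hw (Rmin_r _ _)).
assert (Hct := Hc t); rewrite Cmod_minus_diag in Hct; specialize (Hct Hd).
specialize (Hc w Hw1).
assert (Hc' : rcont01 (fun s => k' s t)) by (intros s Hs; now apply jcont_rcont, Hk').
assert (H2 : rcont01 (fun s => - (1) * k s t)) by (intros s Hs; now apply rcont_scal, Hct).
assert (H3 : rcont01 (fun s => - (w - t) * k' s t)) by (intros s Hs; now apply rcont_scal, Hc').
assert (H12 : rcont01 (fun s => k s w + - (1) * k s t))
  by (intros s Hs; apply rcont_plus; [now apply Hc | now apply H2]).
replace (cint01 (fun s => k s w) - cint01 (fun s => k s t) - cint01 (fun s => k' s t) * (w - t) - 0 * Cconj (w - t))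
  with (cint01 (fun s => (k s w + - (1) * k s t) + - (w - t) * k' s t)).
2: { rewrite cint01_plus, cint01_plus, !cint01_scal by assumption; ring. }
apply cint01_bound.
{ intros s Hs; apply rcont_plus; [now apply H12 | now apply H3]. }
intros s Hs.
replace (k s w + - (1) * k s t + - (w - t) * k' s t)
  with (k s (t + (w - t)) - k s t - k' s t * (w - t))
  by (replace (t + (w - t)) with w by ring; ring).
assert (Hin : forall u, (0 <= u <= 1)%R -> (Cmod (t + RtoC u * (w - t) - t) <= Cmod (w - t))%R).
{ intros u Hu'; replace (t + RtoC u * (w - t) - t) with (RtoC u * (w - t)) by ring.
  rewrite Cmod_mult, Cmod_R, Rabs_pos_eq by lra.
  pose proof (Cmod_ge_0 (w - t)); rewrite <- (Rmult_1_l (Cmod (w - t))) at 2.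
  apply Rmult_le_compat_r; lra. }
apply cderiv_mean_value with (k' s).
- intros u Hu'; apply Hk; [exact Hs|]; eapply Rle_lt_trans; [now apply Hin | exact Hw1].
- intros u Hu'; left; apply Hu; [exact Hs|]; eapply Rle_lt_trans; [now apply Hin | exact Hw2].
Qed.

(** * Goursat's lemma and primitives *)

Definition seg (f : C -> C) (a b : C) : C :=
  cint01 (fun s => f (a + RtoC s * (b - a)) * (b - a)).

Lemma Im_segment_ge (a b : C) (m s : R) :
  (m <= Im a)%R -> (m <= Im b)%R -> (0 <= s <= 1)%R -> (m <= Im (a + RtoC s * (b - a)))%R.
Proof.
intros Ha Hb Hs.
replace (Im (a + RtoC s * (b - a))) with ((1 - s) * Im a + s * Im b)%R
  by (destruct a, b; simpl; ring).
replace m with ((1 - s) * m + s * m)%R by ring.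
apply Rplus_le_compat; apply Rmult_le_compat_l; lra.
Qed.

Lemma upper_seg (a b : C) (s : R) :
  upper a -> upper b -> (0 <= s <= 1)%R -> upper (a + RtoC s * (b - a)).
Proof.
unfold upper; intros Ha Hb Hs; apply Rlt_le_trans with (Rmin (Im a) (Im b)).
- now apply Rmin_pos.
- apply Im_segment_ge; [apply Rmin_l | apply Rmin_r | exact Hs].
Qed.

Lemma upper_near (z w : C) : (Cmod (w - z) < Im z)%R -> upper w.
Proof.
intros H; unfold upper.
assert (H1 := Rle_lt_trans _ _ _ (Im_le_Cmod (w - z)) H).
unfold Cminus in H1; rewrite im_plus, im_opp in H1.
destruct (Rabs_def2 _ _ H1); lra.
Qed.

Definition cont_upper (f : C -> C) : Prop := forall z, upper z -> cont_at f z.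

Lemma seg_rcont01 (f : C -> C) (a b : C) :
  cont_upper f -> upper a -> upper b ->
  rcont01 (fun s => f (a + RtoC s * (b - a)) * (b - a)).
Proof.
intros Hf Ha Hb s Hs.
apply rcont_ext with (fun s => (b - a) * f (a + RtoC s * (b - a))); [intros; ring|].
apply rcont_scal, (rcont_comp f); [apply rcont_line | now apply Hf, upper_seg].
Qed.

Lemma seg_derive (P f : C -> C) (a b : C) :
  (forall z, upper z -> cderiv P z (f z)) -> cont_upper f -> upper a -> upper b ->
  seg f a b = P b - P a.
Proof.
intros HP Hf Ha Hb; unfold seg.
rewrite (cint01_derive (fun s => P (a + RtoC s * (b - a)))).
- f_equal; [f_equal; ring | f_equal; f_equal; ring].
- intros c s Hs; apply cderiv_line, HP, upper_seg; auto.
- now apply seg_rcont01.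
Qed.

Lemma seg_bound (f : C -> C) (a b : C) (M : R) :
  cont_upper f -> upper a -> upper b ->
  (forall s, (0 <= s <= 1)%R -> (Cmod (f (a + RtoC s * (b - a))%C) <= M)%R) ->
  (Cmod (seg f a b) <= M * Cmod (b - a))%R.
Proof.
intros Hf Ha Hb HM; apply cint01_bound; [now apply seg_rcont01|].
intros s Hs; rewrite Cmod_mult; apply Rmult_le_compat_r; [apply Cmod_ge_0 | now apply HM].
Qed.

Lemma cont_at_plus (f g : C -> C) (z : C) :
  cont_at f z -> cont_at g z -> cont_at (fun w => f w + g w) z.
Proof.
intros H K eps Heps.
destruct (H (eps / 2)%R) as [d [Hd Hu]]; [lra|].
destruct (K (eps / 2)%R) as [d' [Hd' Ku]]; [lra|].
exists (Rmin d d'); split; [now apply Rmin_pos|].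
intros u Hus.
specialize (Hu u (Rlt_le_trans _ _ _ Hus (Rmin_l _ _))).
specialize (Ku u (Rlt_le_trans _ _ _ Hus (Rmin_r _ _))).
replace (f u + g u - (f z + g z)) with ((f u - f z) + (g u - g z)) by ring.
eapply Rle_lt_trans; [apply Cmod_triangle|]; lra.
Qed.

Lemma seg_plus (f g : C -> C) (a b : C) :
  cont_upper f -> cont_upper g -> upper a -> upper b ->
  seg (fun z => f z + g z) a b = seg f a b + seg g a b.
Proof.
intros Hf Hg Ha Hb; unfold seg; rewrite <- cint01_plus by now apply seg_rcont01.
apply cint01_ext; intros; ring.
Qed.

Lemma cint01_rev (h : R -> C) : rcont01 h -> cint01 (fun s => h (1 - s)%R) = cint01 h.
Proof.
intros H.
assert (E : forall g : R -> R, ex_RInt g 0 1 -> RInt (fun s => g (1 - s)%R) 0 1 = RInt g 0 1).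
{ intros g Hg; apply is_RInt_unique.
  apply (is_RInt_ext (V := R_NormedModule) (fun s => opp (scal (-1)%R (g (-1 * s + 1)%R)))).
  { intros s _; unfold opp, scal; simpl; unfold mult; simpl.
    replace (-1 * s + 1)%R with (1 - s)%R by ring; ring. }
  rewrite <- (Ropp_involutive (RInt g 0 1)).
  apply (is_RInt_opp (V := R_NormedModule)), (is_RInt_comp_lin (V := R_NormedModule)).
  replace (-1 * 0 + 1)%R with 1%R by ring; replace (-1 * 1 + 1)%R with 0%R by ring.
  apply (is_RInt_swap (V := R_NormedModule)), (RInt_correct (V := R_CompleteNormedModule)), Hg. }
apply C_ext; simpl.
- apply (E (fun s => Re (h s))); now apply rcont01_ex_RInt_Re.
- apply (E (fun s => Im (h s))); now apply rcont01_ex_RInt_Im.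
Qed.

Lemma seg_rev (f : C -> C) (a b : C) :
  cont_upper f -> upper a -> upper b -> seg f b a = - seg f a b.
Proof.
intros Hf Ha Hb; unfold seg.
replace (- cint01 (fun s => f (a + RtoC s * (b - a)) * (b - a)))
  with (- (1) * cint01 (fun s => f (a + RtoC s * (b - a)) * (b - a))) by ring.
rewrite <- cint01_rev by now apply seg_rcont01.
rewrite <- cint01_scal by now apply seg_rcont01.
apply cint01_ext; intros s _; rewrite RtoC_minus.
replace (b + (1 - RtoC s) * (a - b)) with (a + RtoC s * (b - a)) by ring; ring.
Qed.

Lemma cint01_halves (h : R -> C) : rcont01 h ->
  cint01 h = cint01 (fun s => RtoC (/ 2) * h (/ 2 * s + 0)%R) + cint01 (fun s => RtoC (/ 2) * h (/ 2 * s + / 2)%R).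
Proof.
intros H.
assert (E : forall g : R -> R, ex_RInt g 0 1 -> RInt g 0 1 =
  (RInt (fun s => (/ 2 * g (/ 2 * s + 0))%R) 0 1 + RInt (fun s => (/ 2 * g (/ 2 * s + / 2))%R) 0 1)%R).
{ intros g Hg.
  assert (H1 : ex_RInt g 0 (/ 2)) by (apply (ex_RInt_Chasles_1 (V := R_CompleteNormedModule)) with 1%R; [lra | exact Hg]).
  assert (H2 : ex_RInt g (/ 2) 1) by (apply (ex_RInt_Chasles_2 (V := R_CompleteNormedModule)) with 0%R; [lra | exact Hg]).
  rewrite <- (RInt_Chasles (V := R_CompleteNormedModule) g 0 (/ 2) 1 H1 H2).
  unfold plus; simpl; f_equal; symmetry; apply is_RInt_unique, (is_RInt_comp_lin (V := R_NormedModule) g).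
  - replace (/ 2 * 0 + 0)%R with 0%R by ring; replace (/ 2 * 1 + 0)%R with (/ 2)%R by ring.
    now apply (RInt_correct (V := R_CompleteNormedModule)).
  - replace (/ 2 * 0 + / 2)%R with (/ 2)%R by ring; replace (/ 2 * 1 + / 2)%R with 1%R by field.
    now apply (RInt_correct (V := R_CompleteNormedModule)). }
apply C_ext.
- change (RInt (fun s => Re (h s)) 0 1 =
    (RInt (fun s => Re (RtoC (/ 2) * h (/ 2 * s + 0)%R)) 0 1 +
     RInt (fun s => Re (RtoC (/ 2) * h (/ 2 * s + / 2)%R)) 0 1)%R).
  rewrite (E (fun s => Re (h s))) by now apply rcont01_ex_RInt_Re.
  f_equal; apply RInt01_ext; intros; now rewrite re_scal_l.
- change (RInt (fun s => Im (h s)) 0 1 =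
    (RInt (fun s => Im (RtoC (/ 2) * h (/ 2 * s + 0)%R)) 0 1 +
     RInt (fun s => Im (RtoC (/ 2) * h (/ 2 * s + / 2)%R)) 0 1)%R).
  rewrite (E (fun s => Im (h s))) by now apply rcont01_ex_RInt_Im.
  f_equal; apply RInt01_ext; intros; now rewrite im_scal_l.
Qed.

(** * Quadrisection of triangles *)

Definition mid (a b : C) : C := RtoC (/ 2) * (a + b).

Lemma RtoC_half : RtoC (/ 2) + RtoC (/ 2) = 1.
Proof. rewrite <- RtoC_plus; f_equal; field. Qed.

Lemma Im_mid (a b : C) : Im (mid a b) = ((Im a + Im b) / 2)%R.
Proof. destruct a, b; simpl; field. Qed.

Lemma mid_upper (a b : C) : upper a -> upper b -> upper (mid a b).
Proof. unfold upper; rewrite Im_mid; lra. Qed.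

Lemma mid_minus_l (a b : C) : mid a b - a = RtoC (/ 2) * (b - a).
Proof.
transitivity (RtoC (/ 2) * (a + b) - (RtoC (/ 2) + RtoC (/ 2)) * a); [rewrite RtoC_half; unfold mid; ring | ring].
Qed.

Lemma mid_minus_r (a b : C) : b - mid a b = RtoC (/ 2) * (b - a).
Proof.
transitivity ((RtoC (/ 2) + RtoC (/ 2)) * b - RtoC (/ 2) * (a + b)); [rewrite RtoC_half; unfold mid; ring | ring].
Qed.

Lemma seg_mid (f : C -> C) (a b : C) :
  cont_upper f -> upper a -> upper b -> seg f a b = seg f a (mid a b) + seg f (mid a b) b.
Proof.
intros Hf Ha Hb; unfold seg at 1; rewrite cint01_halves by now apply seg_rcont01.
unfold seg; rewrite mid_minus_l, mid_minus_r.
f_equal; apply cint01_ext; intros s _; rewrite RtoC_plus, RtoC_mult.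
- replace (a + (RtoC (/ 2) * RtoC s + 0) * (b - a)) with (a + RtoC s * (RtoC (/ 2) * (b - a))) by ring; ring.
- replace (a + (RtoC (/ 2) * RtoC s + RtoC (/ 2)) * (b - a))
    with (mid a b + RtoC s * (RtoC (/ 2) * (b - a)))
    by (rewrite <- (Cplus_0_r (mid a b)), <- (Cplus_opp_r a);
        transitivity (a + (mid a b - a) + RtoC s * (RtoC (/ 2) * (b - a)));
        [ring | rewrite mid_minus_l; ring]); ring.
Qed.

Definition tri (f : C -> C) (T : C * C * C) : C :=
  let '(a, b, c) := T in seg f a b + seg f b c + seg f c a.

Definition perimeter (T : C * C * C) : R :=
  let '(a, b, c) := T in (Cmod (b - a) + Cmod (c - b) + Cmod (a - c))%R.

Definition above (m : R) (T : C * C * C) : Prop :=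
  let '(a, b, c) := T in (m <= Im a)%R /\ (m <= Im b)%R /\ (m <= Im c)%R.

Definition sub1 (T : C * C * C) := let '(a, b, c) := T in (a, mid a b, mid c a).
Definition sub2 (T : C * C * C) := let '(a, b, c) := T in (mid a b, b, mid b c).
Definition sub3 (T : C * C * C) := let '(a, b, c) := T in (mid c a, mid b c, c).
Definition sub4 (T : C * C * C) := let '(a, b, c) := T in (mid a b, mid b c, mid c a).

Lemma tri_split (f : C -> C) (m : R) (T : C * C * C) :
  cont_upper f -> (0 < m)%R -> above m T ->
  tri f T = tri f (sub1 T) + tri f (sub2 T) + tri f (sub3 T) + tri f (sub4 T).
Proof.
destruct T as [[a b] c]; intros Hf Hm [Ha [Hb Hc]].
assert (Ua : upper a) by (unfold upper; lra).
assert (Ub : upper b) by (unfold upper; lra).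
assert (Uc : upper c) by (unfold upper; lra).
pose proof (mid_upper a b Ua Ub) as Uab.
pose proof (mid_upper b c Ub Uc) as Ubc.
pose proof (mid_upper c a Uc Ua) as Uca.
unfold tri, sub1, sub2, sub3, sub4.
rewrite (seg_mid f a b), (seg_mid f b c), (seg_mid f c a) by assumption.
rewrite (seg_rev f (mid a b) (mid c a)), (seg_rev f (mid a b) (mid b c)), (seg_rev f (mid b c) (mid c a)) by assumption.
ring.
Qed.

Lemma Cmod_half (z : C) : Cmod (RtoC (/ 2) * z) = (/ 2 * Cmod z)%R.
Proof. rewrite Cmod_mult, Cmod_R, Rabs_pos_eq; lra. Qed.

Lemma perimeter_sub (T : C * C * C) :
  perimeter (sub1 T) = (/ 2 * perimeter T)%R /\ perimeter (sub2 T) = (/ 2 * perimeter T)%R /\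
  perimeter (sub3 T) = (/ 2 * perimeter T)%R /\ perimeter (sub4 T) = (/ 2 * perimeter T)%R.
Proof.
destruct T as [[a b] c]; unfold perimeter, sub1, sub2, sub3, sub4.
assert (E1 : mid c a - mid a b = RtoC (/ 2) * (c - b)) by (unfold mid; ring).
assert (E2 : mid a b - mid b c = RtoC (/ 2) * (a - c)) by (unfold mid; ring).
assert (E3 : mid b c - mid c a = RtoC (/ 2) * (b - a)) by (unfold mid; ring).
rewrite !mid_minus_l, !mid_minus_r, E1, E2, E3, !Cmod_half.
rewrite (Cmod_minus_sym (mid b c)), (Cmod_minus_sym (mid c a) (mid b c)), E2, E3, !Cmod_half.
rewrite (Cmod_minus_sym (mid a b)), E1, Cmod_half.
repeat split; ring.
Qed.

(** If the first three quarters all fall below a fourth of the total modulus, the triangle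
    inequality forces the last one above it; hence [sub4] as the default. *)
Definition next (f : C -> C) (T : C * C * C) : C * C * C :=
  if Rle_dec (Cmod (tri f T) / 4) (Cmod (tri f (sub1 T))) then sub1 T else
  if Rle_dec (Cmod (tri f T) / 4) (Cmod (tri f (sub2 T))) then sub2 T else
  if Rle_dec (Cmod (tri f T) / 4) (Cmod (tri f (sub3 T))) then sub3 T else sub4 T.

Definition fst_vertex (T : C * C * C) : C := fst (fst T).

Lemma next_spec (f : C -> C) (m : R) (T : C * C * C) :
  cont_upper f -> (0 < m)%R -> above m T ->
  above m (next f T) /\ perimeter (next f T) = (/ 2 * perimeter T)%R /\
  (Cmod (tri f T) / 4 <= Cmod (tri f (next f T)))%R /\
  (Cmod (fst_vertex (next f T) - fst_vertex T) <= perimeter T)%R.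
Proof.
intros Hf Hm HT.
assert (HA : above m (sub1 T) /\ above m (sub2 T) /\ above m (sub3 T) /\ above m (sub4 T)).
{ destruct T as [[a b] c]; simpl in HT; unfold above, sub1, sub2, sub3, sub4; rewrite !Im_mid; lra. }
assert (HF : (Cmod (fst_vertex (sub1 T) - fst_vertex T) <= perimeter T /\
  Cmod (fst_vertex (sub2 T) - fst_vertex T) <= perimeter T /\
  Cmod (fst_vertex (sub3 T) - fst_vertex T) <= perimeter T /\
  Cmod (fst_vertex (sub4 T) - fst_vertex T) <= perimeter T)%R).
{ destruct T as [[a b] c]; unfold fst_vertex, perimeter, sub1, sub2, sub3, sub4; simpl fst.
  rewrite (Cmod_minus_sym (mid c a)), mid_minus_l, mid_minus_r, Cmod_minus_diag, !Cmod_half.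
  pose proof (Cmod_ge_0 (b - a)); pose proof (Cmod_ge_0 (c - b)); pose proof (Cmod_ge_0 (a - c)); lra. }
destruct (perimeter_sub T) as [P1 [P2 [P3 P4]]].
destruct HA as [A1 [A2 [A3 A4]]]; destruct HF as [F1 [F2 [F3 F4]]].
unfold next.
destruct Rle_dec as [H1|H1]; [tauto|].
destruct Rle_dec as [H2|H2]; [tauto|].
destruct Rle_dec as [H3|H3]; [tauto|].
repeat split; try assumption.
rewrite (tri_split f m T Hf Hm HT) in *.
set (x := tri f (sub1 T)) in *; set (y := tri f (sub2 T)) in *; set (z := tri f (sub3 T)) in *.
set (w := tri f (sub4 T)) in *.
pose proof (Cmod_triangle (x + y + z) w); pose proof (Cmod_triangle (x + y) z); pose proof (Cmod_triangle x y).
lra.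
Qed.

(** The intervals of radius [2 K / 2^n] around [x n] are nested, and the limit is the supremum of
    their left end points. This yields the explicit rate of convergence that [goursat] needs. *)
Lemma geometric_cauchy (x : nat -> R) (K : R) :
  (forall n, (Rabs (x (S n) - x n) <= K * (/ 2) ^ n)%R) ->
  exists l, forall n, (Rabs (x n - l) <= 2 * K * (/ 2) ^ n)%R.
Proof.
intros H.
set (lo := fun n => (x n - 2 * K * (/ 2) ^ n)%R).
set (hi := fun n => (x n + 2 * K * (/ 2) ^ n)%R).
assert (Hlo : forall n k, (lo n <= lo (n + k)%nat)%R).
{ intros n k; induction k as [|k IH]; [rewrite Nat.add_0_r; lra|].
  rewrite Nat.add_succ_r; apply Rle_trans with (1 := IH); unfold lo; simpl.
  specialize (H (n + k)%nat); apply Rabs_le_between in H; lra. }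
assert (Hhi : forall n k, (hi (n + k)%nat <= hi n)%R).
{ intros n k; induction k as [|k IH]; [rewrite Nat.add_0_r; lra|].
  rewrite Nat.add_succ_r; apply Rle_trans with (2 := IH); unfold hi; simpl.
  specialize (H (n + k)%nat); apply Rabs_le_between in H; lra. }
assert (HK : (0 <= K)%R).
{ specialize (H 0%nat); simpl in H; pose proof (Rabs_pos (x 1%nat - x 0%nat)); lra. }
assert (Hlh : forall n, (lo n <= hi n)%R).
{ intros n; unfold lo, hi; assert (0 <= K * (/ 2) ^ n)%R by (apply Rmult_le_pos; [exact HK | apply pow_le; lra]); lra. }
assert (Hall : forall n k, (lo n <= hi k)%R).
{ intros n k; apply Rle_trans with (1 := Hlo n k), Rle_trans with (1 := Hlh _).
  rewrite Nat.add_comm; apply Hhi. }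
destruct (completeness (fun y => exists n, y = lo n)) as [l [Hl1 Hl2]].
{ exists (hi 0%nat); intros y [n ->]; apply Hall. }
{ exists (lo 0%nat), 0%nat; reflexivity. }
exists l; intros n.
assert (H1 : (lo n <= l)%R) by (apply Hl1; now exists n).
assert (H2 : (l <= hi n)%R) by (apply Hl2; intros y [k ->]; apply Hall).
unfold lo, hi in H1, H2; apply Rabs_le_between; lra.
Qed.

Lemma Cmod_le_Re_Im (z : C) : (Cmod z <= Rabs (Re z) + Rabs (Im z))%R.
Proof.
pose proof (Cmod_triangle (RtoC (Re z)) (Ci * RtoC (Im z))) as H.
rewrite Cmod_mult, Cmod_Ci, !Cmod_R, Rmult_1_l in H.
replace (RtoC (Re z) + Ci * RtoC (Im z)) with z in H; [exact H|].
destruct z; apply C_ext; simpl; ring.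
Qed.

Lemma geometric_cauchy_C (x : nat -> C) (K : R) :
  (forall n, (Cmod (x (S n) - x n) <= K * (/ 2) ^ n)%R) ->
  exists l, forall n, (Cmod (x n - l) <= 4 * K * (/ 2) ^ n)%R.
Proof.
intros H.
destruct (geometric_cauchy (fun n => Re (x n)) K) as [l1 H1].
{ intros n; apply Rle_trans with (2 := H n), Rle_trans with (2 := re_le_Cmod _); right; reflexivity. }
destruct (geometric_cauchy (fun n => Im (x n)) K) as [l2 H2].
{ intros n; apply Rle_trans with (2 := H n), Rle_trans with (2 := Im_le_Cmod _); right; reflexivity. }
exists (l1, l2); intros n; specialize (H1 n); specialize (H2 n).
eapply Rle_trans; [apply Cmod_le_Re_Im|].
replace (Re (x n - (l1, l2))) with (Re (x n) - l1)%R by (destruct (x n); reflexivity).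
replace (Im (x n - (l1, l2))) with (Im (x n) - l2)%R by (destruct (x n); reflexivity).
lra.
Qed.

Definition holo_upper (f : C -> C) : Prop := forall z, upper z -> exists l, cderiv f z l.

Lemma holo_upper_cont (f : C -> C) : holo_upper f -> cont_upper f.
Proof. intros H z Hz; destruct (H z Hz) as [l Hl]; exact (wirtinger_cont _ _ _ _ Hl). Qed.

Lemma cderiv_cont (f : C -> C) (z l : C) : cderiv f z l -> cont_at f z.
Proof. apply wirtinger_cont. Qed.

Lemma cderiv_affine_at (p a l z : C) : cderiv (fun w => a + l * (w - p)) z l.
Proof.
apply wirtinger_ext with (fun w => l * w + 0 * Cconj w + (a - l * p)); [intros; ring | apply wirtinger_affine].
Qed.

(** An affine function has the quadratic primitive [P], and the increments of a primitive along a
    closed polygon cancel. *)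
Lemma tri_affine (p a l : C) (m : R) (T : C * C * C) :
  (0 < m)%R -> above m T -> tri (fun w => a + l * (w - p)) T = 0.
Proof.
destruct T as [[u v] w]; intros Hm [Hu [Hv Hw]].
set (P := fun w => a * (w - p) + l * (/ 2 * ((w - p) * (w - p)))).
assert (HP : forall z, upper z -> cderiv P z (a + l * (z - p))).
{ intros z _.
  assert (H1 : cderiv (fun w => w - p) z 1).
  { apply wirtinger_ext with (fun w => 0 + 1 * (w - p)); [intros; ring | apply cderiv_affine_at]. }
  assert (H := cderiv_plus _ _ _ _ _ (cderiv_scal _ a _ _ H1)
    (cderiv_scal _ l _ _ (cderiv_scal _ (/ 2) _ _ (cderiv_mult _ _ _ _ _ H1 H1)))).
  replace (a + l * (z - p)) with (a * 1 + l * (/ 2 * (1 * (z - p) + (z - p) * 1))); [exact H|].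
  field. }
assert (Hc : cont_upper (fun w => a + l * (w - p))) by (intros z _; apply (cderiv_cont _ _ l), cderiv_affine_at).
unfold tri; rewrite !(seg_derive P) by (try assumption; unfold upper; lra); ring.
Qed.

Lemma tri_plus (f g : C -> C) (m : R) (T : C * C * C) :
  cont_upper f -> cont_upper g -> (0 < m)%R -> above m T ->
  tri (fun z => f z + g z) T = tri f T + tri g T.
Proof.
destruct T as [[u v] w]; intros Hf Hg Hm [Hu [Hv Hw]].
unfold tri; rewrite !seg_plus by (try assumption; unfold upper; lra); ring.
Qed.

Lemma segment_dist (a u v : C) (s L : R) :
  (Cmod (u - a) <= L)%R -> (Cmod (v - a) <= L)%R -> (0 <= s <= 1)%R ->
  (Cmod (u + RtoC s * (v - u) - a) <= L)%R.
Proof.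
intros Hu Hv Hs.
replace (u + RtoC s * (v - u) - a) with (RtoC (1 - s) * (u - a) + RtoC s * (v - a))
  by (rewrite RtoC_minus; ring).
eapply Rle_trans; [apply Cmod_triangle|]; rewrite !Cmod_mult, !Cmod_R, !Rabs_pos_eq by lra.
replace L with ((1 - s) * L + s * L)%R by ring.
apply Rplus_le_compat; apply Rmult_le_compat_l; lra.
Qed.

(** Every vertex is within the perimeter of the first one, and by convexity so is every point of the
    boundary. *)
Lemma tri_bound (f : C -> C) (p : C) (m r M : R) (T : C * C * C) :
  cont_upper f -> (0 < m)%R -> above m T ->
  (Cmod (fst_vertex T - p) <= r)%R ->
  (forall z, (Cmod (z - p) <= r + perimeter T)%R -> (Cmod (f z) <= M)%R) ->
  (Cmod (tri f T) <= M * perimeter T)%R.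
Proof.
destruct T as [[a b] c]; intros Hf Hm [Ha [Hb Hc]] Hr HM.
unfold fst_vertex, fst in Hr.
pose proof (Cmod_ge_0 (b - a)); pose proof (Cmod_ge_0 (c - b)); pose proof (Cmod_ge_0 (a - c)).
assert (HL : forall u v, u = a \/ u = b \/ u = c -> v = a \/ v = b \/ v = c ->
  (Cmod (seg f u v) <= M * Cmod (v - u))%R).
{ assert (Hd : forall u, u = a \/ u = b \/ u = c -> upper u /\ (Cmod (u - a) <= perimeter (a, b, c))%R).
  { unfold perimeter, upper.
    intros u [->|[->| ->]]; (split; [lra|]); rewrite ?Cmod_minus_diag, ?(Cmod_minus_sym c a); lra. }
  intros u v Hu Hv; destruct (Hd u Hu), (Hd v Hv).
  apply seg_bound; auto; intros s Hs; apply HM.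
  replace (u + RtoC s * (v - u) - p) with ((a - p) + (u + RtoC s * (v - u) - a)) by ring.
  eapply Rle_trans; [apply Cmod_triangle|]; apply Rplus_le_compat; [exact Hr|].
  now apply segment_dist. }
unfold tri, perimeter.
pose proof (Cmod_triangle (seg f a b + seg f b c) (seg f c a)).
pose proof (Cmod_triangle (seg f a b) (seg f b c)).
pose proof (HL a b); pose proof (HL b c); pose proof (HL c a).
replace (M * (Cmod (b - a) + Cmod (c - b) + Cmod (a - c)))%R with
  (M * Cmod (b - a) + M * Cmod (c - b) + M * Cmod (a - c))%R by ring.
assert (Ca : a = a \/ a = b \/ a = c) by auto.
assert (Cb : b = a \/ b = b \/ b = c) by auto.
assert (Cc : c = a \/ c = b \/ c = c) by auto.
specialize (HL a b Ca Cb) as L1; specialize (HL b c Cb Cc) as L2; specialize (HL c a Cc Ca) as L3.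
lra.
Qed.

(* Goursat's lemma: repeated quadrisection concentrates a nonzero integral at a point
   where the differentiability estimate forces it to vanish. *)
Lemma goursat (f : C -> C) (a b c : C) :
  holo_upper f -> upper a -> upper b -> upper c -> tri f (a, b, c) = 0.
Proof.
intros Hf Ha Hb Hc.
pose proof (holo_upper_cont f Hf) as Hcont.
set (m := Rmin (Im a) (Rmin (Im b) (Im c))).
assert (Hm : (0 < m)%R) by (repeat apply Rmin_pos; assumption).
set (T := fun n => Nat.iter n (next f) (a, b, c)).
set (L := perimeter (a, b, c)); set (eta := Cmod (tri f (a, b, c))).
assert (HL : (0 <= L)%R).
{ unfold L, perimeter; pose proof (Cmod_ge_0 (b - a)); pose proof (Cmod_ge_0 (c - b)); pose proof (Cmod_ge_0 (a - c)); lra. }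
assert (HT : forall n, above m (T n) /\ perimeter (T n) = (L * (/ 2) ^ n)%R /\
  (eta * ((/ 2) ^ n * (/ 2) ^ n) <= Cmod (tri f (T n)))%R).
{ intros n; induction n as [|n [IH1 [IH2 IH3]]].
  - change (T 0%nat) with (a, b, c); fold L eta; rewrite pow_O; split; [|split; lra].
    repeat split.
    + apply Rmin_l.
    + eapply Rle_trans; [apply Rmin_r | apply Rmin_l].
    + eapply Rle_trans; [apply Rmin_r | apply Rmin_r].
  - destruct (next_spec f m (T n) Hcont Hm IH1) as [N1 [N2 [N3 _]]].
    change (T (S n)) with (next f (T n)); split; [exact N1 | split; [rewrite N2, IH2; simpl; ring|]].
    simpl; lra. }
destruct (geometric_cauchy_C (fun n => fst_vertex (T n)) L) as [p Hp].
{ intros n; destruct (HT n) as [H1 [H2 _]]; rewrite <- H2.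
  apply (next_spec f m (T n) Hcont Hm H1). }
assert (Hq : forall d, (0 < d)%R -> exists n, ((/ 2) ^ n < d)%R).
{ intros d Hd; destruct (pow_lt_1_zero (/ 2)) with (y := d) as [N HN]; [rewrite Rabs_pos_eq; lra | exact Hd|].
  exists N; specialize (HN N (le_n N)); rewrite Rabs_pos_eq in HN; [exact HN | apply pow_le; lra]. }
assert (Hpos : forall n, (0 < (/ 2) ^ n)%R) by (intros; apply pow_lt; lra).
assert (Up : upper p).
(* All vertices keep imaginary part at least [m]. If [Im p <= 0], a first vertex at distance at most
   [4 L / 2^n < m] from [p] would be a contradiction. *)
{ unfold upper; destruct (Rlt_le_dec 0 (Im p)) as [H|H]; [exact H | exfalso].
  destruct (Hq (m / (4 * L + 1))%R) as [n Hn]; [apply Rdiv_lt_0_compat; lra|].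
  specialize (Hp n); destruct (HT n) as [H1 _].
  destruct (T n) as [[u v] w]; destruct H1 as [H1 _]; unfold fst_vertex, fst in Hp.
  pose proof (Im_le_Cmod (u - p)) as H2; unfold Cminus at 1 in H2; rewrite im_plus, im_opp in H2.
  pose proof (Rle_abs (Im u + - Im p)).
  apply Rmult_lt_compat_l with (r := (4 * L + 1)%R) in Hn; [|lra].
  replace ((4 * L + 1) * (m / (4 * L + 1)))%R with m in Hn by (field; lra).
  specialize (Hpos n); lra. }
destruct (Hf p Up) as [l Hl].
(* [g] is minus the Taylor polynomial of degree one of [f] at [p]: adding it leaves the triangle
   integrals unchanged and reduces the integrand to the remainder. *)
set (g := fun z => - f p + - l * (z - p)).
assert (Hg : cont_upper g) by (intros z _; apply (cderiv_cont _ _ (- l)), cderiv_affine_at).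
(* With [q = 1 / 2^n], points of the n-th triangle are at distance at most [4 L q + L q] from [p],
   which gives the factor [5 L]; the second [L] comes from the perimeter [L q]. The remaining
   [q * q] is exactly the loss of a fourth per subdivision. *)
assert (Heta : forall eps, (0 < eps)%R -> (eta <= eps * (5 * L * L))%R).
{ intros eps Heps; destruct (Hl eps Heps) as [d [Hd Hw]].
  destruct (Hq (d / (5 * L + 1))%R) as [n Hn]; [apply Rdiv_lt_0_compat; lra|].
  specialize (Hp n); destruct (HT n) as [H1 [H2 H3]]; specialize (Hpos n).
  set (q := ((/ 2) ^ n)%R) in *.
  apply Rmult_lt_compat_l with (r := (5 * L + 1)%R) in Hn; [|lra].
  replace ((5 * L + 1) * (d / (5 * L + 1)))%R with d in Hn by (field; lra).
  assert (H0 : (0 <= L * q)%R) by (apply Rmult_le_pos; lra).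
  assert (E : tri f (T n) = tri (fun z => f z + g z) (T n)).
  { rewrite (tri_plus f g m) by assumption; unfold g; rewrite (tri_affine p _ _ m) by assumption; ring. }
  assert (B := tri_bound (fun z => f z + g z) p m (4 * L * q) (eps * (5 * L * q)) (T n)).
  rewrite <- E in B.
  apply Rmult_le_reg_r with (q * q)%R; [now apply Rmult_lt_0_compat|].
  apply Rle_trans with (1 := H3).
  replace (eps * (5 * L * L) * (q * q))%R with (eps * (5 * L * q) * perimeter (T n))%R by (rewrite H2; ring).
  apply B; try assumption.
  - intros z Hz; now apply cont_at_plus; [apply Hcont | apply Hg].
  - intros z Hz; rewrite H2 in Hz.
    apply Rle_trans with (eps * Cmod (z - p))%R; [|apply Rmult_le_compat_l; lra].
    replace (f z + g z) with (f z - f p - l * (z - p) - 0 * Cconj (z - p)) by (unfold g; ring).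
    apply Hw; lra. }
apply Cmod_eq_0; fold eta.
apply Rle_antisym; [|apply Cmod_ge_0].
apply le_epsilon; intros e He; rewrite Rplus_0_l.
assert (H5 : (0 <= 5 * L * L)%R) by (apply Rmult_le_pos; lra).
apply Rle_trans with (e / (5 * L * L + 1) * (5 * L * L))%R.
- apply Heta, Rdiv_lt_0_compat; lra.
- apply Rle_trans with (e / (5 * L * L + 1) * (5 * L * L + 1))%R; [|right; field; lra].
  apply Rmult_le_compat_l; [left; apply Rdiv_lt_0_compat; lra | lra].
Qed.

Lemma seg_chasles (f : C -> C) (a b c : C) :
  holo_upper f -> upper a -> upper b -> upper c -> seg f a b + seg f b c = seg f a c.
Proof.
intros Hf Ha Hb Hc; pose proof (goursat f a b c Hf Ha Hb Hc) as H; unfold tri in H.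
rewrite (seg_rev f a c) in H; [|now apply holo_upper_cont | exact Ha | exact Hc].
apply Ceq_minus; exact H.
Qed.

Lemma seg_near (f : C -> C) (c z w : C) (eps : R) :
  holo_upper f -> upper z -> upper w ->
  (forall s, (0 <= s <= 1)%R -> (Cmod (f (z + RtoC s * (w - z))%C - c) <= eps)%R) ->
  (Cmod (seg f z w - c * (w - z)) <= eps * Cmod (w - z))%R.
Proof.
intros Hf Hz Hw H.
assert (Hc : cont_upper (fun _ : C => - c)).
{ intros u _; apply (wirtinger_cont _ _ 0 0), wirtinger_const. }
replace (seg f z w - c * (w - z)) with (seg (fun u => f u + - c) z w).
- apply seg_bound; auto.
  intros u Hu; apply cont_at_plus; [now apply holo_upper_cont | now apply Hc].
- rewrite seg_plus by (auto using holo_upper_cont).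
  rewrite (seg_derive (fun u => 0 + - c * (u - z)) (fun _ => - c)); auto; [ring|].
  intros u _; apply cderiv_affine_at.
Qed.

(** By path independence the increment is the integral over the short segment from [z] to [w], which
    differs from [f z * (w - z)] by the oscillation of [f] times the length. *)
Lemma seg_primitive (f : C -> C) (a z : C) :
  holo_upper f -> upper a -> upper z -> cderiv (fun w => seg f a w) z (f z).
Proof.
intros Hf Ha Hz eps Heps.
destruct (holo_upper_cont f Hf z Hz eps Heps) as [d [Hd Hw]].
exists (Rmin d (Im z)); split; [now apply Rmin_pos|].
intros w Hwz.
assert (Hw1 := Rlt_le_trans _ _ _ Hwz (Rmin_l _ _)).
assert (Hw2 := upper_near z w (Rlt_le_trans _ _ _ Hwz (Rmin_r _ _))).
rewrite <- (seg_chasles f a z w) by assumption.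
replace (seg f a z + seg f z w - seg f a z - f z * (w - z) - 0 * Cconj (w - z))
  with (seg f z w - f z * (w - z)) by ring.
apply seg_near; auto.
intros s Hs; left; apply Hw.
apply Rle_lt_trans with (2 := Hw1), segment_dist; [|lra | exact Hs].
rewrite Cmod_minus_diag; apply Cmod_ge_0.
Qed.

(** * The exponential and complex powers *)

(** The directional derivatives along 1 and [Ci] are [A + B] and [Ci * (A - B)], and they determine
    both coefficients. *)
Lemma wirtinger_unique (f : C -> C) (z A B A' B' : C) :
  wirtinger f z A B -> wirtinger f z A' B' -> A = A' /\ B = B'.
Proof.
intros H H'.
assert (E : forall e, A * e + B * Cconj e = A' * e + B' * Cconj e).
{ intros e.
  assert (L : forall P Q, wirtinger f z P Q -> wirtinger f (z + RtoC 0 * e) P Q).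
  { intros P Q K; replace (z + RtoC 0 * e) with z by ring; exact K. }
  assert (K : forall c, Re (c * (A * e + B * Cconj e)) = Re (c * (A' * e + B' * Cconj e))).
  { intros c.
    rewrite <- (is_derive_unique _ _ _ (wirtinger_line f z e c A B 0 (L _ _ H))).
    now rewrite <- (is_derive_unique _ _ _ (wirtinger_line f z e c A' B' 0 (L _ _ H'))). }
  pose proof (K 1) as K1; pose proof (K (- Ci)) as K2.
  rewrite !Re_1_mult in K1; rewrite !Re_mCi_mult in K2; now apply C_ext. }
assert (E1 := E 1); assert (E2 := E Ci).
replace (Cconj 1) with (RtoC 1) in E1 by (apply C_ext; simpl; ring).
replace (Cconj Ci) with (- Ci) in E2 by (apply C_ext; simpl; ring).
assert (E3 : A + B = A' + B') by (rewrite !Cmult_1_r in E1; exact E1).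
assert (E4 : A - B = A' - B').
{ replace (A - B) with (- Ci * (A * Ci + B * - Ci)).
  - rewrite E2; transitivity (- (Ci * Ci) * (A' - B')); [ring|].
    replace (- (Ci * Ci)) with (RtoC 1) by (apply C_ext; simpl; ring); ring.
  - transitivity (- (Ci * Ci) * (A - B)); [ring|].
    replace (- (Ci * Ci)) with (RtoC 1) by (apply C_ext; simpl; ring); ring. }
assert (H2 : RtoC 2 <> 0) by (apply RtoC_neq_0; lra).
split.
- replace A with (((A + B) + (A - B)) / 2) by (field; exact H2); rewrite E3, E4; field; exact H2.
- replace B with (((A + B) - (A - B)) / 2) by (field; exact H2); rewrite E3, E4; field; exact H2.
Qed.

Lemma cderiv_unique (f : C -> C) (z l l' : C) : cderiv f z l -> cderiv f z l' -> l = l'.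
Proof. intros H H'; exact (proj1 (wirtinger_unique _ _ _ _ _ _ H H')). Qed.

Lemma is_derive_eps_inv (f : R -> R) (x l : R) :
  is_derive f x l -> forall eps, (0 < eps)%R -> exists delta, (0 < delta)%R /\
     forall y, (Rabs (y - x) < delta)%R ->
       (Rabs (f y - f x - l * (y - x)) <= eps * Rabs (y - x))%R.
Proof.
intros [_ H] eps Heps.
specialize (H x (fun P HP => HP) (mkposreal eps Heps)).
destruct H as [d Hd]; exists d; split; [apply cond_pos|].
intros w Hw; specialize (Hd w Hw).
unfold norm, minus, plus, opp, scal in Hd; simpl in Hd.
unfold mult in Hd; simpl in Hd; unfold abs in Hd; simpl in Hd.
replace (f w - f x - l * (w - x))%R with (f w + - f x + - ((w + - x) * l))%R by ring.
exact Hd.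
Qed.

Lemma Re_half (z : C) : RtoC (Re z) = RtoC (/ 2) * z + RtoC (/ 2) * Cconj z.
Proof. destruct z; apply C_ext; simpl; field. Qed.

Lemma wirtinger_Re (g : R -> R) (l : R) (z : C) :
  is_derive g (Re z) l ->
  wirtinger (fun w => RtoC (g (Re w))) z (RtoC l * RtoC (/ 2)) (RtoC l * RtoC (/ 2)).
Proof.
intros H eps Heps; destruct (is_derive_eps_inv _ _ _ H eps Heps) as [d [Hd Hw]].
exists d; split; [exact Hd|]; intros w Hwz.
assert (E : (Re w - Re z)%R = Re (w - z)) by (destruct w, z; simpl; ring).
specialize (Hw (Re w)); rewrite E in Hw.
replace (RtoC (g (Re w)) - RtoC (g (Re z)) - RtoC l * RtoC (/ 2) * (w - z) - RtoC l * RtoC (/ 2) * Cconj (w - z))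
  with (RtoC (g (Re w) - g (Re z) - l * Re (w - z))).
2: { rewrite !RtoC_minus, RtoC_mult, Re_half; ring. }
rewrite Cmod_R.
eapply Rle_trans; [apply Hw; eapply Rle_lt_trans; [apply re_le_Cmod | exact Hwz]|].
apply Rmult_le_compat_l; [lra | apply re_le_Cmod].
Qed.

(** Differentiability with unnamed coefficients, for functions whose coefficients are determined
    afterwards by [wirtinger_unique], or of which only continuity is wanted. *)
Definition rdiff (f : C -> C) (z : C) : Prop := exists A B, wirtinger f z A B.

Lemma rdiff_const (c z : C) : rdiff (fun _ => c) z.
Proof. exists 0, 0; apply wirtinger_const. Qed.

Lemma rdiff_real (g : R -> R) (f : C -> C) (z : C) :
  rdiff f z -> ex_derive g (Re (f z)) -> rdiff (fun w => RtoC (g (Re (f w)))) z.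
Proof.
intros [A [B H]] [l Hl]; do 2 eexists.
exact (wirtinger_comp f (fun w => RtoC (g (Re w))) _ _ _ _ _ H (wirtinger_Re g l _ Hl)).
Qed.

Lemma rdiff_plus (f g : C -> C) (z : C) : rdiff f z -> rdiff g z -> rdiff (fun w => f w + g w) z.
Proof. intros [A [B H]] [A' [B' H']]; do 2 eexists; exact (wirtinger_plus _ _ _ _ _ _ _ H H'). Qed.

Lemma rdiff_mult (f g : C -> C) (z : C) : rdiff f z -> rdiff g z -> rdiff (fun w => f w * g w) z.
Proof. intros [A [B H]] [A' [B' H']]; do 2 eexists; exact (wirtinger_mult _ _ _ _ _ _ _ H H'). Qed.

Lemma cexp_plus (a b : C) : cexp (a + b) = cexp a * cexp b.
Proof.
destruct a as [a1 a2], b as [b1 b2]; unfold cexp; apply C_ext; simpl;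
  rewrite exp_plus, ?cos_plus, ?sin_plus; ring.
Qed.

Lemma cexp_0 : cexp 0 = 1.
Proof. unfold cexp; apply C_ext; simpl; rewrite exp_0, ?cos_0, ?sin_0; ring. Qed.

Lemma Cmod_cexp (z : C) : Cmod (cexp z) = exp (Re z).
Proof.
unfold cexp, Cmod; simpl.
replace (exp (Re z) * cos (Im z) * (exp (Re z) * cos (Im z) * 1) +
   exp (Re z) * sin (Im z) * (exp (Re z) * sin (Im z) * 1))%R
  with (exp (Re z) * exp (Re z))%R.
- apply sqrt_square; left; apply exp_pos.
- pose proof (sin2_cos2 (Im z)) as H; unfold Rsqr in H.
  transitivity (exp (Re z) * exp (Re z) * (sin (Im z) * sin (Im z) + cos (Im z) * cos (Im z)))%R;
    [rewrite H; ring | ring].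
Qed.

Lemma cexp_neq_0 (z : C) : cexp z <> 0.
Proof. apply Cmod_gt_0; rewrite Cmod_cexp; apply exp_pos. Qed.

Lemma cexp_opp (z : C) : cexp (- z) = / cexp z.
Proof.
pose proof (cexp_neq_0 z) as Hz.
replace (cexp (- z)) with (cexp (- z + z) * / cexp z) by (rewrite cexp_plus; field; exact Hz).
replace (- z + z) with (RtoC 0) by ring; rewrite cexp_0; ring.
Qed.

Lemma cderiv_cexp (z : C) : cderiv cexp z (cexp z).
Proof.
assert (Him : wirtinger (fun w => - Ci * w) z (- Ci) 0).
{ apply wirtinger_ext with (fun w => - Ci * w + 0 * Cconj w + 0); [intros; ring | apply wirtinger_affine]. }
assert (EI : forall w, Re (- Ci * w) = Im w) by apply Re_mCi_mult.
assert (HC := wirtinger_comp _ (fun w => RtoC (cos (Re w))) _ _ _ _ _ Him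
  (wirtinger_Re cos _ _ (is_derive_cos _))).
assert (HS := wirtinger_comp _ (fun w => RtoC (sin (Re w))) _ _ _ _ _ Him
  (wirtinger_Re sin _ _ (is_derive_sin _))).
assert (H := wirtinger_mult _ _ _ _ _ _ _ (wirtinger_Re exp _ z (is_derive_exp (Re z)))
  (wirtinger_plus _ _ _ _ _ _ _ HC (wirtinger_scal _ Ci _ _ _ HS))).
cbv beta in H.
assert (E : forall w, RtoC (exp (Re w)) * (RtoC (cos (Re (- Ci * w))) + Ci * RtoC (sin (Re (- Ci * w)))) = cexp w).
{ intros w; rewrite EI; unfold cexp; apply C_ext; simpl; ring. }
refine (wirtinger_eq _ _ _ _ _ _ _ _ (wirtinger_ext _ _ _ _ _ E H)).
- rewrite EI; unfold cexp; apply C_ext; simpl; field.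
- rewrite EI; unfold cexp; apply C_ext; simpl; field.
Qed.

(** * The two branches of the logarithm and the complex powers *)

Definition Log_up (z : C) : C := (ln (Cmod z), Arg_up z).
Definition Log_lo (z : C) : C := (ln (Cmod z), Arg_lo z).

Lemma Re_div_Cmod (z : C) : z <> 0 -> (-1 <= Re z / Cmod z <= 1)%R.
Proof.
intros Hz; apply Cmod_gt_0 in Hz; pose proof (re_le_Cmod z) as H; apply Rabs_le_between in H.
split; [apply Rle_div_r | apply Rle_div_l]; lra.
Qed.

Lemma sin_acos_Arg (z : C) : z <> 0 -> sin (acos (Re z / Cmod z)) = (Rabs (Im z) / Cmod z)%R.
Proof.
intros Hz; rewrite sin_acos by now apply Re_div_Cmod.
apply Cmod_gt_0 in Hz.
replace (1 - (Re z / Cmod z)²)%R with ((Im z / Cmod z)²)%R.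
- rewrite sqrt_Rsqr_abs, Rabs_div, (Rabs_pos_eq (Cmod z)); lra.
- pose proof (Cmod2_alt z) as H; unfold Rsqr.
  transitivity ((Cmod z ^ 2 - Re z ^ 2) / Cmod z ^ 2)%R; [rewrite H at 1|]; field; lra.
Qed.

Lemma cexp_Log_polar (z : C) (t : R) : z <> 0 ->
  (t = acos (Re z / Cmod z) /\ (0 <= Im z)%R) \/ (t = (- acos (Re z / Cmod z))%R /\ (Im z <= 0)%R) ->
  cexp (ln (Cmod z), t) = z.
Proof.
intros Hz Ht.
assert (Hp := proj1 (Cmod_gt_0 z) Hz).
unfold cexp; apply C_ext; simpl; rewrite exp_ln by exact Hp.
- assert (Ec : cos t = (Re z / Cmod z)%R).
  { destruct Ht as [[-> _]|[-> _]]; rewrite ?cos_neg; apply cos_acos, Re_div_Cmod, Hz. }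
  rewrite Ec; unfold Re; field; lra.
- assert (Es : sin t = (Im z / Cmod z)%R).
  { destruct Ht as [[-> Hi]|[-> Hi]]; rewrite ?sin_neg, sin_acos_Arg by exact Hz.
    - rewrite Rabs_pos_eq; lra.
    - rewrite Rabs_left1; [field|]; lra. }
  rewrite Es; unfold Im; field; lra.
Qed.

Lemma cexp_Log_up (z : C) : z <> 0 -> cexp (Log_up z) = z.
Proof.
intros Hz; apply cexp_Log_polar; [exact Hz|]; unfold Arg_up; destruct Rle_dec; [left | right]; split; lra.
Qed.

Lemma cexp_Log_lo (z : C) : z <> 0 -> cexp (Log_lo z) = z.
Proof.
intros Hz; apply cexp_Log_polar; [exact Hz|]; unfold Arg_lo; destruct Rlt_dec; [left | right]; split; lra.
Qed.

Lemma cpow_up_exp (z s : C) : z <> 0 -> cpow_up z s = cexp (s * Log_up z).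
Proof.
intros Hz; unfold cpow_up; destruct Req_EM_T as [H|H]; [|reflexivity].
elim Hz; now apply Cmod_eq_0.
Qed.

Lemma cpow_lo_exp (z s : C) : z <> 0 -> cpow_lo z s = cexp (s * Log_lo z).
Proof.
intros Hz; unfold cpow_lo; destruct Req_EM_T as [H|H]; [|reflexivity].
elim Hz; now apply Cmod_eq_0.
Qed.

Lemma upper_neq_0 (z : C) : upper z -> z <> 0.
Proof. intros Hz E; subst z; unfold upper in Hz; simpl in Hz; lra. Qed.

Lemma upper_Re_div_Cmod (z : C) : upper z -> (-1 < Re z / Cmod z < 1)%R.
Proof.
intros Hz; pose proof (Re_div_Cmod z (upper_neq_0 z Hz)) as H.
pose proof (sin_acos_Arg z (upper_neq_0 z Hz)) as E.
assert (Hp := proj1 (Cmod_gt_0 z) (upper_neq_0 z Hz)).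
assert (0 < Rabs (Im z) / Cmod z)%R.
{ apply Rdiv_lt_0_compat; [apply Rabs_pos_lt; unfold upper in Hz; lra | exact Hp]. }
rewrite sin_acos in E by exact H.
split; apply Rnot_le_lt; intros Hn.
- assert (E1 : (Re z / Cmod z = -1)%R) by lra; rewrite E1 in E; unfold Rsqr in E.
  replace (1 - -1 * -1)%R with 0%R in E by ring; rewrite sqrt_0 in E; lra.
- assert (E1 : (Re z / Cmod z = 1)%R) by lra; rewrite E1 in E; unfold Rsqr in E.
  replace (1 - 1 * 1)%R with 0%R in E by ring; rewrite sqrt_0 in E; lra.
Qed.

(** The formula by [ln], [sqrt] and [acos] only has to give real differentiability. Differentiating
    [cexp (Log_up w) = w] then yields [z * A = 1] and [z * B = 0], so the partial derivatives of the
    argument are never computed. *)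
Lemma cderiv_Log_up (z : C) : upper z -> cderiv Log_up z (/ z).
Proof.
intros Hz; assert (Hz0 := upper_neq_0 z Hz); assert (Hp := proj1 (Cmod_gt_0 z) Hz0).
assert (Hid : rdiff (fun w => w) z) by (do 2 eexists; apply wirtinger_id).
assert (Hmod : rdiff (fun w => RtoC (Cmod w)) z).
{ assert (H : rdiff (fun w => RtoC (sqrt (Re (w * Cconj w)))) z).
  { apply (rdiff_real sqrt); [apply rdiff_mult; [exact Hid | do 2 eexists; apply wirtinger_conj]|].
    eexists; apply is_derive_sqrt; [apply is_derive_id|].
    rewrite Cmult_comm, Re_Cconj_mult_self; now apply Rmult_lt_0_compat. }
  destruct H as [A [B H]]; exists A, B; refine (wirtinger_ext _ _ _ _ _ _ H).
  intros w; cbv beta; f_equal; rewrite Cmult_comm, Re_Cconj_mult_self; apply sqrt_square, Cmod_ge_0. }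
assert (Hinv : rdiff (fun w => / RtoC (Cmod w)) z).
{ destruct Hmod as [A [B H]]; do 2 eexists.
  refine (wirtinger_comp _ Cinv _ _ _ _ _ H (cderiv_inv _ _)); apply RtoC_neq_0; lra. }
assert (EQ : forall w : C, w <> 0 -> Re (w * / RtoC (Cmod w)) = (Re w / Cmod w)%R).
{ intros w Hw; rewrite <- RtoC_inv by (apply Rgt_not_eq, Cmod_gt_0, Hw); apply re_scal_r. }
assert (Harg : rdiff (fun w => RtoC (acos (Re (w * / RtoC (Cmod w))))) z).
{ apply (rdiff_real acos); [now apply rdiff_mult|].
  (* On the open half-plane the quotient stays strictly between -1 and 1, where [acos] is
     differentiable. *)
  rewrite EQ by exact Hz0; apply ex_derive_Reals_1, derivable_pt_acos, upper_Re_div_Cmod, Hz. }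
assert (Hln : rdiff (fun w => RtoC (ln (Re (RtoC (Cmod w))))) z).
{ apply (rdiff_real ln); [exact Hmod|]; eexists; now apply is_derive_ln. }
assert (HL : rdiff Log_up z).
{ destruct (rdiff_plus _ _ _ Hln (rdiff_mult (fun _ => Ci) _ _ (rdiff_const Ci z) Harg)) as [A [B H]].
  exists A, B; refine (wirtinger_ext_loc _ _ _ _ _ (Im z) Hz _ H).
  intros w Hw; apply upper_near in Hw; rewrite EQ by now apply upper_neq_0.
  unfold Log_up, Arg_up; unfold upper in Hw; destruct Rle_dec; [|lra].
  apply C_ext; simpl; ring. }
destruct HL as [A [B HL]].
assert (HE := wirtinger_comp Log_up cexp _ _ _ _ _ HL (cderiv_cexp _)).
assert (HI : wirtinger (fun w => cexp (Log_up w)) z 1 0).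
{ refine (wirtinger_ext_loc _ _ _ _ _ (Im z) Hz _ (wirtinger_id z)).
  intros w Hw; symmetry; apply cexp_Log_up, upper_neq_0, upper_near with z, Hw. }
destruct (wirtinger_unique _ _ _ _ _ _ HE HI) as [E1 E2].
rewrite cexp_Log_up in E1, E2 by exact Hz0.
refine (wirtinger_eq _ _ _ _ _ _ _ _ HL).
- replace A with (/ z * (z * A + 0 * Cconj B)) by (field; exact Hz0); rewrite E1; ring.
- replace B with (/ z * (z * B + 0 * Cconj A)) by (field; exact Hz0); rewrite E2; ring.
Qed.

Lemma cpow_up_minus_1 (z s : C) : z <> 0 -> cpow_up z (s - 1) = cpow_up z s / z.
Proof.
intros Hz; rewrite !cpow_up_exp by exact Hz.
replace ((s - 1) * Log_up z) with (s * Log_up z + - Log_up z) by ring.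
now rewrite cexp_plus, cexp_opp, cexp_Log_up.
Qed.

Lemma cderiv_cpow_up (z s : C) : upper z -> cderiv (fun w => cpow_up w s) z (s * cpow_up z (s - 1)).
Proof.
intros Hz.
assert (H := cderiv_comp _ cexp _ _ _ (cderiv_scal _ s _ _ (cderiv_Log_up z Hz)) (cderiv_cexp _)).
cbv beta in H.
rewrite cpow_up_minus_1, cpow_up_exp by now apply upper_neq_0.
replace (s * (cexp (s * Log_up z) / z)) with (cexp (s * Log_up z) * (s * / z)) by (unfold Cdiv; ring).
refine (wirtinger_ext_loc _ _ _ _ _ (Im z) Hz _ H).
intros w Hw; symmetry; apply cpow_up_exp, upper_neq_0, upper_near with z, Hw.
Qed.

(** * Derivatives of holomorphic functions *)

Lemma jcont_comp (f : C -> C) (k : R -> C -> C) (s : R) (t : C) :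
  jcont k s t -> cont_at f (k s t) -> jcont (fun s t => f (k s t)) s t.
Proof.
intros H Hf eps Heps; destruct (Hf eps Heps) as [d [Hd Hw]].
destruct (H d Hd) as [d' [Hd' Hu]]; exists d'; split; auto.
Qed.

Lemma jcont_l (h : R -> C) (s : R) (t : C) : rcont h s -> jcont (fun s _ => h s) s t.
Proof. intros H eps Heps; destruct (H eps Heps) as [d [Hd Hu]]; exists d; auto. Qed.

Lemma jcont_r (f : C -> C) (s : R) (t : C) : cont_at f t -> jcont (fun _ t => f t) s t.
Proof. intros H eps Heps; destruct (H eps Heps) as [d [Hd Hu]]; exists d; auto. Qed.

Lemma cont_at_id (z : C) : cont_at (fun w => w) z.
Proof. exact (wirtinger_cont _ _ _ _ (wirtinger_id z)). Qed.

Lemma cont_at_const (c z : C) : cont_at (fun _ => c) z.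
Proof. exact (wirtinger_cont _ _ _ _ (wirtinger_const c z)). Qed.

Lemma jcont_plus (k h : R -> C -> C) (s : R) (t : C) :
  jcont k s t -> jcont h s t -> jcont (fun s t => k s t + h s t) s t.
Proof.
intros H K eps Heps.
destruct (H (eps / 2)%R) as [d [Hd Hu]]; [lra|].
destruct (K (eps / 2)%R) as [d' [Hd' Ku]]; [lra|].
exists (Rmin d d'); split; [now apply Rmin_pos|].
intros s' t' Hs Ht.
specialize (Hu s' t' (Rlt_le_trans _ _ _ Hs (Rmin_l _ _)) (Rlt_le_trans _ _ _ Ht (Rmin_l _ _))).
specialize (Ku s' t' (Rlt_le_trans _ _ _ Hs (Rmin_r _ _)) (Rlt_le_trans _ _ _ Ht (Rmin_r _ _))).
replace (k s' t' + h s' t' - (k s t + h s t)) with ((k s' t' - k s t) + (h s' t' - h s t)) by ring.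
eapply Rle_lt_trans; [apply Cmod_triangle|]; lra.
Qed.

Lemma jcont_mult (k h : R -> C -> C) (s : R) (t : C) :
  jcont k s t -> jcont h s t -> jcont (fun s t => k s t * h s t) s t.
Proof.
intros H K eps Heps.
set (a := Cmod (k s t)); set (b := Cmod (h s t)).
assert (Ha : (0 <= a)%R) by apply Cmod_ge_0; assert (Hb : (0 <= b)%R) by apply Cmod_ge_0.
set (e := Rmin 1 (eps / (a + b + 1))).
assert (He : (0 < e)%R) by (apply Rmin_pos; [lra | apply Rdiv_lt_0_compat; lra]).
assert (He1 : (e <= 1)%R) by apply Rmin_l.
assert (He2 : (e * (a + b + 1) <= eps)%R).
{ apply Rle_div_r; [lra | apply Rmin_r]. }
destruct (H e He) as [d [Hd Hu]]; destruct (K e He) as [d' [Hd' Ku]].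
exists (Rmin d d'); split; [now apply Rmin_pos|].
intros s' t' Hs Ht.
specialize (Hu s' t' (Rlt_le_trans _ _ _ Hs (Rmin_l _ _)) (Rlt_le_trans _ _ _ Ht (Rmin_l _ _))).
specialize (Ku s' t' (Rlt_le_trans _ _ _ Hs (Rmin_r _ _)) (Rlt_le_trans _ _ _ Ht (Rmin_r _ _))).
set (X := k s' t' - k s t) in *; set (Y := h s' t' - h s t) in *.
replace (k s' t' * h s' t' - k s t * h s t) with (X * Y + (k s t * Y + X * h s t)) by (unfold X, Y; ring).
eapply Rle_lt_trans; [apply Cmod_triangle|].
eapply Rle_lt_trans; [apply Rplus_le_compat_l, Cmod_triangle|].
rewrite !Cmod_mult; fold a b.
apply Rlt_le_trans with (2 := He2).
pose proof (Cmod_ge_0 X); pose proof (Cmod_ge_0 Y).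
assert (Cmod X * Cmod Y < e * 1)%R by (apply Rmult_le_0_lt_compat; lra).
assert (a * Cmod Y <= a * e)%R by (apply Rmult_le_compat_l; lra).
assert (Cmod X * b <= e * b)%R by (apply Rmult_le_compat_r; lra).
lra.
Qed.

Lemma cint01_param_cont (k : R -> C -> C) (t : C) (d : R) :
  (0 < d)%R ->
  (forall t', (Cmod (t' - t) < d)%R -> rcont01 (fun s => k s t')) ->
  (forall s, (0 <= s <= 1)%R -> jcont k s t) ->
  cont_at (fun t => cint01 (fun s => k s t)) t.
Proof.
intros Hd Hc Hk eps Heps.
destruct (jcont_uniform k t (eps / 2)%R) as [d' [Hd' Hu]]; [lra | exact Hk|].
exists (Rmin d d'); split; [now apply Rmin_pos|]; intros w Hw.
assert (Hw1 := Rlt_le_trans _ _ _ Hw (Rmin_l _ _)).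
assert (Hw2 := Rlt_le_trans _ _ _ Hw (Rmin_r _ _)).
assert (Hct := Hc t); rewrite Cmod_minus_diag in Hct; specialize (Hct Hd).
specialize (Hc w Hw1).
assert (H2 : rcont01 (fun s => - (1) * k s t)) by (intros s Hs; now apply rcont_scal, Hct).
replace (cint01 (fun s => k s w) - cint01 (fun s => k s t)) with (cint01 (fun s => k s w + - (1) * k s t)).
2: { rewrite cint01_plus, cint01_scal by assumption; ring. }
apply Rle_lt_trans with (eps / 2)%R; [|lra].
apply cint01_bound.
{ intros s Hs; apply rcont_plus; [now apply Hc | now apply H2]. }
intros s Hs; left.
replace (k s w + - (1) * k s t) with (k s w - k s t) by ring; now apply Hu.
Qed.

(** * Circle means and Cauchy's formula for the derivative *)

Definition circ (s : R) : C := cexp (RtoC s * (RtoC (2 * PI) * Ci)).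

Lemma circ_opp (s : R) : circ (- s) * circ s = 1.
Proof.
unfold circ; rewrite <- cexp_plus, RtoC_opp.
match goal with |- cexp ?x = _ => replace x with (RtoC 0) by ring end; apply cexp_0.
Qed.

Lemma Cmod_circ (s : R) : Cmod (circ s) = 1%R.
Proof.
unfold circ; rewrite Cmod_cexp; replace (Re _) with 0%R; [apply exp_0|]; simpl; ring.
Qed.

Lemma circ_0 : circ 0 = 1.
Proof. unfold circ; rewrite Cmult_0_l; apply cexp_0. Qed.

Lemma circ_1 : circ 1 = 1.
Proof.
unfold circ, cexp; apply C_ext; simpl.
- replace (1 * (2 * PI * 0 - 0 * 1) - 0 * (2 * PI * 1 + 0 * 0))%R with 0%R by ring.
  replace (1 * (2 * PI * 1 + 0 * 0) + 0 * (2 * PI * 0 - 0 * 1))%R with (2 * PI)%R by ring.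
  rewrite exp_0, cos_2PI; ring.
- replace (1 * (2 * PI * 1 + 0 * 0) + 0 * (2 * PI * 0 - 0 * 1))%R with (2 * PI)%R by ring.
  rewrite sin_2PI; ring.
Qed.

Lemma circ_m1 : circ (- (1)) = 1.
Proof. rewrite <- (Cmult_1_r (circ _)), <- circ_1 at 1; apply circ_opp. Qed.

Lemma rcont_circ (s : R) : rcont circ s.
Proof.
apply (rcont_comp cexp (fun s => RtoC s * (RtoC (2 * PI) * Ci))).
- apply rcont_ext with (fun u => 0 + RtoC u * (RtoC (2 * PI) * Ci)); [intros; ring | apply rcont_line].
- exact (cderiv_cont _ _ _ (cderiv_cexp _)).
Qed.

Lemma rcont_circ_opp (s : R) : rcont (fun s => circ (- s)) s.
Proof.
apply (rcont_comp cexp (fun s => RtoC (- s) * (RtoC (2 * PI) * Ci))).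
- apply rcont_ext with (fun u => 0 + RtoC u * (- (RtoC (2 * PI) * Ci)));
    [intros; rewrite RtoC_opp; ring | apply rcont_line].
- exact (cderiv_cont _ _ _ (cderiv_cexp _)).
Qed.

Lemma circle_upper (z rho : C) (s : R) : (Cmod rho < Im z)%R -> upper (z + rho * circ s).
Proof.
intros H; apply upper_near with z.
replace (z + rho * circ s - z) with (rho * circ s) by ring.
now rewrite Cmod_mult, Cmod_circ, Rmult_1_r.
Qed.

Lemma jcont_circle (f : C -> C) (z rho : C) (s : R) :
  cont_upper f -> (Cmod rho < Im z)%R ->
  jcont (fun s z => f (z + rho * circ s)) s z /\ jcont (fun s rho => f (z + rho * circ s)) s rho.
Proof.
intros Hf H; split; apply jcont_comp; try (apply Hf, circle_upper, H).
- apply jcont_plus; [apply (jcont_r (fun t => t)), cont_at_id|].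
  apply jcont_mult; [apply (jcont_r (fun _ => rho)), cont_at_const | apply jcont_l, rcont_circ].
- apply jcont_plus; [apply (jcont_r (fun _ => z)), cont_at_const|].
  apply jcont_mult; [apply (jcont_r (fun t => t)), cont_at_id | apply jcont_l, rcont_circ].
Qed.

Lemma jcont_circ_opp (s : R) (t : C) : jcont (fun s _ => circ (- s)) s t.
Proof. apply (jcont_l (fun s => circ (- s))), rcont_circ_opp. Qed.

Lemma circle_room (z rho w : C) : (Cmod rho < Im z)%R ->
  (Cmod (w - z) < Im z - Cmod rho)%R -> (Cmod rho < Im w)%R.
Proof.
intros H Hw; pose proof (Im_le_Cmod (w - z)) as H1.
unfold Cminus at 1 in H1; rewrite im_plus, im_opp in H1; apply Rabs_le_between in H1; lra.
Qed.

Lemma circle_room_rho (z rho w : C) : (Cmod rho < Im z)%R ->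
  (Cmod (w - rho) < Im z - Cmod rho)%R -> (Cmod w < Im z)%R.
Proof.
intros H Hw; pose proof (Cmod_triangle rho (w - rho)) as H1.
replace (rho + (w - rho)) with w in H1 by ring; lra.
Qed.

(** Divided by [rho], this is [1 / (2 i pi)] times the integral of [f w / (w - z)^2] over the
    circle, that is, Cauchy's expression for the derivative at [z]. The radius is a complex
    variable, so that the dependence on it falls under the same calculus. *)
Definition circle_moment (f : C -> C) (z rho : C) : C :=
  cint01 (fun s => f (z + rho * circ s) * circ (- s)).
Definition circle_mean (f : C -> C) (z rho : C) : C :=
  cint01 (fun s => f (z + rho * circ s)).

Lemma circle_moment_deriv (g f : C -> C) (z rho : C) :
  (forall z, upper z -> cderiv g z (f z)) -> cont_upper f -> (Cmod rho < Im z)%R ->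
  cderiv (fun z => circle_moment g z rho) z (circle_moment f z rho).
Proof.
intros Hg Hf H.
assert (Hgc : cont_upper g) by (intros w Hw; exact (cderiv_cont _ _ _ (Hg w Hw))).
apply (cint01_param_deriv (fun s z => g (z + rho * circ s) * circ (- s))
  (fun s z => f (z + rho * circ s) * circ (- s)) z (Im z - Cmod rho)); [lra| | |].
- intros s w Hs Hw.
  pose proof (circle_room z rho w H Hw) as Hw'.
  assert (H1 : cderiv (fun z => z + rho * circ s) w 1).
  { refine (wirtinger_eq _ _ _ _ _ _ _ _ (wirtinger_plus _ _ _ _ _ _ _ (wirtinger_id w) (wirtinger_const (rho * circ s) w))); ring. }
  assert (H2 := cderiv_scal _ (circ (- s)) _ _ (cderiv_comp _ g _ _ _ H1 (Hg _ (circle_upper w rho s Hw')))).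
  refine (wirtinger_eq _ _ _ _ _ _ _ _ (wirtinger_ext _ _ _ _ _ _ H2)); intros; ring.
- intros w Hw s Hs; apply (jcont_rcont (fun s z => g (z + rho * circ s) * circ (- s))).
  apply jcont_mult; [apply jcont_circle; [exact Hgc | now apply circle_room with z] | apply jcont_circ_opp].
- intros s Hs; apply jcont_mult; [now apply jcont_circle | apply jcont_circ_opp].
Qed.

Lemma circle_moment_cont (f : C -> C) (z rho : C) :
  cont_upper f -> (Cmod rho < Im z)%R -> cont_at (fun z => circle_moment f z rho) z.
Proof.
intros Hf H.
apply (cint01_param_cont (fun s z => f (z + rho * circ s) * circ (- s)) z (Im z - Cmod rho)); [lra| |].
- intros w Hw s Hs; apply (jcont_rcont (fun s z => f (z + rho * circ s) * circ (- s))).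
  apply jcont_mult; [apply jcont_circle; [exact Hf | now apply circle_room with z] | apply jcont_circ_opp].
- intros s Hs; apply jcont_mult; [now apply jcont_circle | apply jcont_circ_opp].
Qed.

(** The chain rule produces a factor [circ s], which cancels [circ (- s)] and leaves a plain
    mean. *)
Lemma circle_moment_deriv_rho (g f : C -> C) (z rho : C) :
  (forall z, upper z -> cderiv g z (f z)) -> cont_upper f -> (Cmod rho < Im z)%R ->
  cderiv (fun rho => circle_moment g z rho) rho (circle_mean f z rho).
Proof.
intros Hg Hf H.
assert (Hgc : cont_upper g) by (intros w Hw; exact (cderiv_cont _ _ _ (Hg w Hw))).
apply (cint01_param_deriv (fun s rho => g (z + rho * circ s) * circ (- s))
  (fun s rho => f (z + rho * circ s)) rho (Im z - Cmod rho)); [lra| | |].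
- intros s w Hs Hw.
  pose proof (circle_room_rho z rho w H Hw) as Hw'.
  assert (H2 := cderiv_scal _ (circ (- s)) _ _
    (cderiv_comp _ g _ _ _ (cderiv_affine z (circ s) w) (Hg _ (circle_upper z w s Hw')))).
  refine (wirtinger_eq _ _ _ _ _ _ _ _ (wirtinger_ext _ _ _ _ _ _ H2)); try (intros; ring).
  transitivity (f (z + w * circ s) * (circ (- s) * circ s)); [ring | rewrite circ_opp; ring].
- intros w Hw s Hs; apply (jcont_rcont (fun s rho => g (z + rho * circ s) * circ (- s))).
  apply jcont_mult; [apply (jcont_circle g z w s Hgc), (circle_room_rho z rho w H Hw) | apply jcont_circ_opp].
- intros s Hs; now apply jcont_circle.
Qed.

Lemma circle_mean_cont_rho (f : C -> C) (z rho : C) :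
  cont_upper f -> (Cmod rho < Im z)%R -> cont_at (fun rho => circle_mean f z rho) rho.
Proof.
intros Hf H.
apply (cint01_param_cont (fun s rho => f (z + rho * circ s)) rho (Im z - Cmod rho)); [lra| |].
- intros w Hw s Hs; apply (jcont_rcont (fun s rho => f (z + rho * circ s))).
  apply (jcont_circle f z w s Hf), (circle_room_rho z rho w H Hw).
- intros s Hs; now apply jcont_circle.
Qed.

(* The difference of the two sides is, up to [2 i pi], the integral of the derivative
   of the periodic function [s |-> g (z + rho circ s) circ (- s)]. *)
Lemma circle_moment_mean (g f : C -> C) (z rho : C) :
  (forall z, upper z -> cderiv g z (f z)) -> cont_upper f -> (Cmod rho < Im z)%R ->
  circle_moment g z rho = rho * circle_mean f z rho.
Proof.
intros Hg Hf H.
assert (Hgc : cont_upper g) by (intros w Hw; exact (cderiv_cont _ _ _ (Hg w Hw))).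
set (w0 := RtoC (2 * PI) * Ci).
assert (Hw0 : w0 <> 0).
{ apply Cmult_neq_0; [|apply Ci_nz]; apply RtoC_neq_0; pose proof PI_RGT_0; lra. }
assert (H1 : rcont01 (fun s => f (z + rho * circ s))).
{ intros s _; now apply (jcont_rcont (fun s rho => f (z + rho * circ s))), jcont_circle. }
assert (H2 : rcont01 (fun s => g (z + rho * circ s) * circ (- s))).
{ intros s _; apply (jcont_rcont (fun s rho => g (z + rho * circ s) * circ (- s))).
  apply jcont_mult; [now apply (jcont_circle g z rho s) | apply jcont_circ_opp]. }
assert (H3 : rcont01 (fun s => (w0 * rho) * f (z + rho * circ s))) by (intros s Hs; now apply rcont_scal, H1).
assert (H4 : rcont01 (fun s => - w0 * (g (z + rho * circ s) * circ (- s))))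
  by (intros s Hs; apply (rcont_scal (fun s => g (z + rho * circ s) * circ (- s))), H2, Hs).
assert (E : cint01 (fun s => (w0 * rho) * f (z + rho * circ s) + - w0 * (g (z + rho * circ s) * circ (- s))) = 0).
{ rewrite (cint01_derive (fun s => g (z + rho * circ s) * circ (- s))).
  - rewrite circ_1, circ_0, circ_m1; replace (- 0)%R with 0%R by ring; rewrite circ_0; ring.
  - intros c s Hs.
    set (G := fun x => g (z + rho * cexp (x * w0)) * cexp (- x * w0)).
    assert (HE : forall a x, cderiv (fun x => cexp (x * a)) x (a * cexp (x * a))).
    { intros a x; assert (H5 := cderiv_comp _ cexp _ _ _ (cderiv_affine 0 a x) (cderiv_cexp _)).
      refine (wirtinger_eq _ _ _ _ _ _ _ _ (wirtinger_ext _ _ _ _ _ _ H5)).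
      - replace (0 + x * a) with (x * a) by ring; ring.
      - ring.
      - intros w; cbv beta; f_equal; ring. }
    assert (HE' : cderiv (fun x => cexp (- x * w0)) (RtoC s) (- w0 * cexp (- RtoC s * w0))).
    { replace (- RtoC s * w0) with (RtoC s * - w0) by ring.
      refine (wirtinger_ext _ _ _ _ _ _ (HE (- w0) _)); intros w; cbv beta; f_equal; ring. }
    assert (HI : cderiv (fun x => z + rho * cexp (x * w0)) (RtoC s) (rho * (w0 * cexp (RtoC s * w0)))).
    { assert (H5 := cderiv_plus _ _ _ _ _ (wirtinger_const z (RtoC s)) (cderiv_scal _ rho _ _ (HE w0 (RtoC s)))).
      refine (wirtinger_eq _ _ _ _ _ _ _ _ H5); ring. }
    assert (HG := cderiv_mult _ _ _ _ _ (cderiv_comp _ g _ _ _ HI (Hg _ (circle_upper z rho s H))) HE').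
    cbv beta in HG.
    match type of HG with cderiv _ _ ?D => assert (HL := cderiv_line G 0 1 c D s) end.
    replace (0 + RtoC s * 1) with (RtoC s) in HL by ring.
    specialize (HL HG).
    replace (w0 * rho * f (z + rho * circ s) + - w0 * (g (z + rho * circ s) * circ (- s)))
      with ((f (z + rho * circ s) * (rho * (w0 * cexp (RtoC s * w0))) * cexp (- RtoC s * w0) +
         g (z + rho * cexp (RtoC s * w0)) * (- w0 * cexp (- RtoC s * w0))) * 1).
    + apply is_derive_ext with (2 := HL).
      intros u; unfold G, circ; rewrite RtoC_opp; fold w0; repeat f_equal; ring.
    + pose proof (circ_opp s) as EO; unfold circ in *; rewrite RtoC_opp in *; fold w0 in EO |- *.
      transitivity (f (z + rho * cexp (RtoC s * w0)) * rho * w0 * (cexp (- RtoC s * w0) * cexp (RtoC s * w0)) +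
         g (z + rho * cexp (RtoC s * w0)) * (- w0 * cexp (- RtoC s * w0))); [ring | rewrite EO; ring].
  - intros s Hs; apply rcont_plus; [now apply H3 | now apply H4]. }
rewrite cint01_plus, (cint01_scal _ _ H1), (cint01_scal _ _ H2) in E by assumption.
fold (circle_mean f z rho) (circle_moment g z rho) in E.
apply Ceq_minus.
replace (circle_moment g z rho - rho * circle_mean f z rho)
  with (- / w0 * (w0 * rho * circle_mean f z rho + - w0 * circle_moment g z rho)) by (field; exact Hw0).
rewrite E; ring.
Qed.

Lemma circle_mean_0 (f : C -> C) (z : C) : circle_mean f z 0 = f z.
Proof.
unfold circle_mean; rewrite (cint01_ext _ (fun _ => f z)).
- apply C_ext; simpl; rewrite RInt_const; unfold scal; simpl; unfold mult; simpl; ring.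
- intros s _; f_equal; ring.
Qed.

(** Let [M] be the moment of [g] as a function of the radius. Its derivative is the mean of [f], and
    [M] is the radius times that mean, so [M / rho] has derivative zero. The mean is therefore
    independent of the radius, and it tends to [f z] as the radius tends to 0. *)
Lemma mean_value (g f : C -> C) (z : C) (rho : R) :
  (forall z, upper z -> cderiv g z (f z)) -> cont_upper f -> (0 < rho < Im z)%R ->
  circle_mean f z rho = f z.
Proof.
intros Hg Hf Hrho.
set (Q := fun x : C => circle_moment g z x * / x).
assert (HQ : forall x : C, x <> 0 -> (Cmod x < Im z)%R -> cderiv Q x 0).
{ intros x Hx Hxz.
  assert (H := cderiv_mult _ _ _ _ _ (circle_moment_deriv_rho g f z x Hg Hf Hxz) (cderiv_inv x Hx)).
  refine (wirtinger_eq _ _ _ _ _ _ _ _ H); [|reflexivity].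
  rewrite (circle_moment_mean g f z x) by assumption; field; exact Hx. }
assert (HM : forall x : C, x <> 0 -> (Cmod x < Im z)%R -> Q x = circle_mean f z x).
{ intros x Hx Hxz; unfold Q; rewrite (circle_moment_mean g f z x) by assumption; field; exact Hx. }
(* [Q] has derivative zero along the real segment from [r] to [rho], which avoids the origin. *)
assert (Hconst : forall r : R, (0 < r <= rho)%R -> circle_mean f z rho = circle_mean f z r).
{ intros r Hr.
  rewrite <- !HM by (try apply RtoC_neq_0; rewrite ?Cmod_R, ?Rabs_pos_eq; lra).
  assert (K := cderiv_mean_value Q (fun _ => 0) (RtoC r) (RtoC rho - RtoC r) 0 0).
  apply Ceq_minus, Cmod_eq_0, Rle_antisym; [|apply Cmod_ge_0].
  replace (Q (RtoC rho) - Q (RtoC r))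
    with (Q (RtoC r + (RtoC rho - RtoC r)) - Q (RtoC r) - 0 * (RtoC rho - RtoC r))
    by (replace (RtoC r + (RtoC rho - RtoC r)) with (RtoC rho) by ring; ring).
  apply Rle_trans with (0 * Cmod (RtoC rho - RtoC r))%R; [apply K | rewrite Rmult_0_l; lra].
  - intros u Hu.
    replace (RtoC r + RtoC u * (RtoC rho - RtoC r)) with (RtoC (r + u * (rho - r)))
      by (rewrite RtoC_plus, RtoC_mult, RtoC_minus; ring).
    assert (0 <= u * (rho - r) <= 1 * (rho - r))%R
      by (split; [apply Rmult_le_pos | apply Rmult_le_compat_r]; lra).
    apply HQ; [apply RtoC_neq_0; lra | rewrite Cmod_R, Rabs_pos_eq; lra].
  - intros u _; rewrite Cmod_minus_diag; lra. }
apply Ceq_minus, Cmod_eq_0, Rle_antisym; [|apply Cmod_ge_0].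
apply le_epsilon; intros e He; rewrite Rplus_0_l.
destruct (circle_mean_cont_rho f z 0 Hf) with (eps := e) as [d [Hd Hw]]; [rewrite Cmod_0; lra | exact He|].
set (r := Rmin rho (d / 2)).
assert (Hr : (0 < r <= rho)%R) by (split; [apply Rmin_pos; lra | apply Rmin_l]).
assert (Hr2 : (r <= d / 2)%R) by apply Rmin_r.
rewrite (Hconst r Hr); left; rewrite <- (circle_mean_0 f z); apply Hw.
replace (RtoC r - 0) with (RtoC r) by ring; rewrite Cmod_R, Rabs_pos_eq; lra.
Qed.

(** [f] has a primitive [g] and is its own circle mean, hence equals the moment of [g] divided by
    the radius. Differentiating in the centre gives the same formula for [f'] with [f] in place of
    [g]. Its right-hand side is continuous in the centre, and continuity of [f'] is what allows it
    to be differentiated once more. *)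
Lemma holo_upper_derivative (f f' : C -> C) :
  (forall z, upper z -> cderiv f z (f' z)) -> holo_upper f'.
Proof.
intros Hf'.
assert (Hf : holo_upper f) by (intros z Hz; exists (f' z); auto).
assert (Hc := holo_upper_cont f Hf).
set (g := fun w => seg f Ci w).
assert (Ui : upper Ci) by (unfold upper; simpl; lra).
assert (Hg : forall z, upper z -> cderiv g z (f z)) by (intros; now apply seg_primitive).
assert (Hform : forall z (rho : R), upper z -> (0 < rho < Im z)%R -> f' z = / RtoC rho * circle_moment f z rho).
{ intros z rho Hz Hrho.
  assert (Hmod : (Cmod (RtoC rho) < Im z)%R) by (rewrite Cmod_R, Rabs_pos_eq; lra).
  apply (cderiv_unique f z); [now apply Hf'|].
  assert (H := cderiv_scal _ (/ RtoC rho) _ _ (circle_moment_deriv g f z rho Hg Hc Hmod)).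
  refine (wirtinger_ext_loc _ _ _ _ _ (Im z - rho) _ _ H); [lra|].
  intros w Hw; cbv beta.
  assert (Hroom : (Cmod (RtoC rho) < Im w)%R).
  { apply circle_room with z; [exact Hmod|]; rewrite Cmod_R, Rabs_pos_eq; lra. }
  rewrite (circle_moment_mean g f) by assumption.
  rewrite Cmod_R, Rabs_pos_eq in Hroom by lra.
  rewrite (mean_value g f w rho) by (assumption || lra); field; apply RtoC_neq_0; lra. }
(* The radius is frozen at [Im z / 2], so that one formula serves for all [w] near [z]. *)
assert (Hloc : forall z, upper z -> forall w, (Cmod (w - z) < Im z / 2)%R ->
  upper w /\ f' w = / RtoC (Im z / 2) * circle_moment f w (RtoC (Im z / 2))).
{ intros z Hz w Hw; unfold upper in Hz.
  assert (Hroom : (Cmod (RtoC (Im z / 2)) < Im w)%R)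
    by (apply circle_room with z; rewrite Cmod_R, Rabs_pos_eq; lra).
  rewrite Cmod_R, Rabs_pos_eq in Hroom by lra.
  assert (Uw : upper w) by (unfold upper; lra).
  split; [exact Uw | apply Hform; [exact Uw | lra]]. }
assert (Hmod : forall z, upper z -> (Cmod (RtoC (Im z / 2)) < Im z)%R)
  by (intros z Hz; unfold upper in Hz; rewrite Cmod_R, Rabs_pos_eq; lra).
assert (Hc' : cont_upper f').
{ intros z Hz eps Heps.
  destruct (cont_at_scal _ (/ RtoC (Im z / 2)) z (circle_moment_cont f z (RtoC (Im z / 2)) Hc (Hmod z Hz)) eps Heps) as [d [Hd Hw]].
  exists (Rmin d (Im z / 2)); split; [apply Rmin_pos; unfold upper in Hz; lra|].
  intros w Hwz.
  rewrite (proj2 (Hloc z Hz w (Rlt_le_trans _ _ _ Hwz (Rmin_r _ _)))).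
  rewrite (proj2 (Hloc z Hz z ltac:(rewrite Cmod_minus_diag; unfold upper in Hz; lra))).
  apply Hw, (Rlt_le_trans _ _ _ Hwz (Rmin_l _ _)). }
intros z Hz; eexists.
refine (wirtinger_ext_loc _ _ _ _ _ (Im z / 2)%R _ _
  (cderiv_scal _ (/ RtoC (Im z / 2)) _ _ (circle_moment_deriv f f' z (RtoC (Im z / 2)) Hf' Hc' (Hmod z Hz)))).
- unfold upper in Hz; lra.
- intros w Hw; symmetry; now apply Hloc.
Qed.

(** * Wirtinger derivatives and partial derivatives *)

(** Balls for [continuous] are products of intervals in the two coordinates, those for [cont_at] are
    discs. *)
Lemma continuous_cont_at (f : C -> C) (z : C) : continuous f z <-> cont_at f z.
Proof.
split.
- intros H eps Heps.
  assert (He : (0 < eps / 2)%R) by lra.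
  destruct (H (ball (f z) (mkposreal _ He))) as [d Hd]; [now exists (mkposreal _ He)|].
  exists d; split; [apply cond_pos|]; intros w Hw.
  assert (Hb : ball z d w).
  { split; [eapply Rle_lt_trans; [apply (re_le_Cmod (w - z)) | exact Hw]
           | eapply Rle_lt_trans; [apply (Im_le_Cmod (w - z)) | exact Hw]]. }
  destruct (Hd w Hb) as [H1 H2].
  eapply Rle_lt_trans; [apply Cmod_le_Re_Im|].
  change (Rabs (Re (f w - f z)) < eps / 2)%R in H1.
  change (Rabs (Im (f w - f z)) < eps / 2)%R in H2; lra.
- intros H P [eps HP].
  destruct (H eps (cond_pos eps)) as [d [Hd Hw]].
  assert (Hd2 : (0 < d / 2)%R) by lra.
  exists (mkposreal _ Hd2); intros w [H1 H2]; apply HP.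
  change (Rabs (Re (w - z)) < d / 2)%R in H1; change (Rabs (Im (w - z)) < d / 2)%R in H2.
  assert (Hwz : (Cmod (w - z) < d)%R) by (pose proof (Cmod_le_Re_Im (w - z)); lra).
  specialize (Hw w Hwz).
  split; [eapply Rle_lt_trans; [apply (re_le_Cmod (f w - f z)) | exact Hw]
         | eapply Rle_lt_trans; [apply (Im_le_Cmod (f w - f z)) | exact Hw]].
Qed.

Lemma cont_at_ext_loc (f g : C -> C) (z : C) (d : R) :
  (0 < d)%R -> (forall w, (Cmod (w - z) < d)%R -> f w = g w) -> cont_at f z -> cont_at g z.
Proof.
intros Hd E H eps Heps; destruct (H eps Heps) as [d' [Hd' Hw]].
exists (Rmin d d'); split; [now apply Rmin_pos|]; intros w Hwz.
rewrite <- !E; [apply Hw, (Rlt_le_trans _ _ _ Hwz (Rmin_r _ _)) | now rewrite Cmod_minus_diag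
  | apply (Rlt_le_trans _ _ _ Hwz (Rmin_l _ _))].
Qed.

Lemma wirtinger_dX (f : C -> C) (c z A B : C) : wirtinger f z A B ->
  is_derive (fun x => Re (c * f (x, Im z))) (Re z) (Re (c * (A + B))).
Proof.
intros H.
assert (E : forall x : R, (0%R, Im z) + RtoC x * 1 = (x, Im z)) by (intros; apply C_ext; simpl; ring).
assert (K := wirtinger_line f (0%R, Im z) 1 c A B (Re z)).
rewrite E, <- surjective_pairing in K; specialize (K H).
replace (A + B) with (A * 1 + B * Cconj 1)
  by (replace (Cconj 1) with (RtoC 1) by (apply C_ext; simpl; ring); ring).
apply is_derive_ext with (2 := K); intros x; now rewrite E.
Qed.

Lemma wirtinger_dY (f : C -> C) (c z A B : C) : wirtinger f z A B ->
  is_derive (fun y => Re (c * f (Re z, y))) (Im z) (Re (c * (Ci * (A - B)))).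
Proof.
intros H.
assert (E : forall y : R, (Re z, 0%R) + RtoC y * Ci = (Re z, y)) by (intros; apply C_ext; simpl; ring).
assert (K := wirtinger_line f (Re z, 0%R) Ci c A B (Im z)).
rewrite E, <- surjective_pairing in K; specialize (K H).
replace (Ci * (A - B)) with (A * Ci + B * Cconj Ci)
  by (replace (Cconj Ci) with (- Ci) by (apply C_ext; simpl; ring); ring).
apply is_derive_ext with (2 := K); intros y; now rewrite E.
Qed.

Lemma is_derive_Re_Im (f : R -> C) (x : R) (D : C) :
  (forall c, is_derive (fun x => Re (c * f x)) x (Re (c * D))) ->
  is_derive (fun x => Re (f x)) x (Re D) /\ is_derive (fun x => Im (f x)) x (Im D).
Proof.
intros H; split.
- rewrite <- (Re_1_mult D); apply is_derive_ext with (2 := H 1); intros; apply Re_1_mult.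
- rewrite <- (Re_mCi_mult D); apply is_derive_ext with (2 := H (- Ci)); intros; apply Re_mCi_mult.
Qed.

Lemma wirtinger_partials (f : C -> C) (z A B : C) : wirtinger f z A B ->
  ex_derive (fun x => Re (f (x, Im z))) (Re z) /\ ex_derive (fun x => Im (f (x, Im z))) (Re z) /\
  ex_derive (fun y => Re (f (Re z, y))) (Im z) /\ ex_derive (fun y => Im (f (Re z, y))) (Im z) /\
  dX f z = A + B /\ dY f z = Ci * (A - B).
Proof.
intros H.
destruct (is_derive_Re_Im (fun x => f (x, Im z)) (Re z) _ (fun c => wirtinger_dX f c z A B H)) as [X1 X2].
destruct (is_derive_Re_Im (fun y => f (Re z, y)) (Im z) _ (fun c => wirtinger_dY f c z A B H)) as [Y1 Y2].
repeat split; try (eexists; eassumption).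
- apply C_ext; apply is_derive_unique; assumption.
- apply C_ext; apply is_derive_unique; assumption.
Qed.

Lemma two_neq_0 : RtoC 2 <> 0.
Proof. apply RtoC_neq_0; lra. Qed.

Lemma Ci_square : Ci * Ci = - (1).
Proof. apply C_ext; simpl; ring. Qed.

Lemma wirtinger_d_z (f : C -> C) (z A B : C) : wirtinger f z A B -> d_z f z = A /\ d_zbar f z = B.
Proof.
intros H; destruct (wirtinger_partials f z A B H) as [_ [_ [_ [_ [EX EY]]]]].
unfold d_z, d_zbar; rewrite EX, EY; split.
- transitivity ((A + B - Ci * Ci * (A - B)) / 2); [unfold Cdiv; ring|]; rewrite Ci_square; field; apply two_neq_0.
- transitivity ((A + B + Ci * Ci * (A - B)) / 2); [unfold Cdiv; ring|]; rewrite Ci_square; field; apply two_neq_0.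
Qed.

Lemma wirtinger_C1_on (f A B : C -> C) :
  (forall z, upper z -> wirtinger f z (A z) (B z)) -> cont_upper A -> cont_upper B -> C1_on upper f.
Proof.
intros H HA HB z Hz.
destruct (wirtinger_partials f z _ _ (H z Hz)) as [X1 [X2 [Y1 [Y2 _]]]].
assert (Hloc : forall w, (Cmod (w - z) < Im z)%R -> dX f w = A w + B w /\ dY f w = Ci * (A w - B w)).
{ intros w Hw; apply upper_near in Hw; apply (wirtinger_partials f w _ _ (H w Hw)). }
repeat split; try assumption.
- apply continuous_cont_at; exact (wirtinger_cont _ _ _ _ (H z Hz)).
- apply continuous_cont_at, cont_at_ext_loc with (fun w => A w + B w) (Im z); [exact Hz | |].
  + intros w Hw; symmetry; now apply Hloc.
  + apply cont_at_plus; auto.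
- apply continuous_cont_at, cont_at_ext_loc with (fun w => Ci * (A w + - (1) * B w)) (Im z); [exact Hz | |].
  + intros w Hw; rewrite (proj2 (Hloc w Hw)); ring.
  + apply cont_at_scal, cont_at_plus; [auto | apply cont_at_scal; auto].
Qed.

(** The increment is taken along two legs, vertical from [(x, y)] to [(x, v)] and horizontal from
    there to [(u, v)], and the mean value theorem is applied on each. *)
Lemma partials_increment (phi phix phiy : R -> R -> R) (x y d e : R) :
  (forall u v, (Rabs (u - x) < d)%R -> (Rabs (v - y) < d)%R ->
    is_derive (fun u => phi u v) u (phix u v) /\ is_derive (fun v => phi u v) v (phiy u v)) ->
  (forall u v, (Rabs (u - x) < d)%R -> (Rabs (v - y) < d)%R ->
    (Rabs (phix u v - phix x y) <= e)%R /\ (Rabs (phiy u v - phiy x y) <= e)%R) ->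
  forall u v, (Rabs (u - x) < d)%R -> (Rabs (v - y) < d)%R ->
    (Rabs (phi u v - phi x y - (phix x y * (u - x) + phiy x y * (v - y))) <=
       e * (Rabs (u - x) + Rabs (v - y)))%R.
Proof.
intros H He u v Hu Hv.
assert (Hbet : forall a b t, (Rmin a b <= t <= Rmax a b)%R -> (Rabs (t - a) <= Rabs (b - a))%R).
{ intros a b t [H1 H2]; unfold Rmin, Rmax in *; destruct Rle_dec.
  - rewrite !Rabs_pos_eq; lra.
  - rewrite !Rabs_left1; lra. }
assert (H0 : (Rabs (x - x) < d)%R).
{ rewrite Rminus_diag, Rabs_R0; eapply Rle_lt_trans; [apply (Rabs_pos (u - x)) | exact Hu]. }
assert (HX : forall t, (Rmin x u <= t <= Rmax x u)%R -> is_derive (fun u => phi u v) t (phix t v)).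
{ intros t Ht; apply H; [eapply Rle_lt_trans; [apply Hbet, Ht | exact Hu] | exact Hv]. }
assert (HY : forall t, (Rmin y v <= t <= Rmax y v)%R -> is_derive (fun v => phi x v) t (phiy x t)).
{ intros t Ht; apply H; [exact H0 | eapply Rle_lt_trans; [apply Hbet, Ht | exact Hv]]. }
destruct (MVT_gen (fun u => phi u v) x u (fun u => phix u v)) as [t [Ht Et]].
{ intros t Ht; apply HX; lra. }
{ intros t Ht; apply continuity_pt_filterlim, (ex_derive_continuous (V := R_NormedModule) (fun u => phi u v)); exists (phix t v); now apply HX. }
destruct (MVT_gen (fun v => phi x v) y v (fun v => phiy x v)) as [s [Hs Es]].
{ intros s Hs; apply HY; lra. }
{ intros s Hs; apply continuity_pt_filterlim, (ex_derive_continuous (V := R_NormedModule) (fun v => phi x v)); exists (phiy x s); now apply HY. }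
replace (phi u v - phi x y - (phix x y * (u - x) + phiy x y * (v - y)))%R
  with ((phix t v - phix x y) * (u - x) + (phiy x s - phiy x y) * (v - y))%R by lra.
eapply Rle_trans; [apply Rabs_triang|]; rewrite !Rabs_mult, Rmult_plus_distr_l.
apply Rplus_le_compat; apply Rmult_le_compat_r; try apply Rabs_pos.
- apply (He t v); [eapply Rle_lt_trans; [apply Hbet, Ht | exact Hu] | exact Hv].
- apply (He x s); [exact H0 | eapply Rle_lt_trans; [apply Hbet, Hs | exact Hv]].
Qed.

(** This turns the regularity demanded of [H] in (b) into a first-order expansion. *)
Lemma C1_on_wirtinger (f : C -> C) (z : C) :
  C1_on upper f -> upper z -> wirtinger f z (d_z f z) (d_zbar f z).
Proof.
intros Hf Hz eps Heps.
(* Real and imaginary part of the remainder each contribute [eps / 4] times the sum of two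
   coordinate increments, both at most [Cmod (w - z)]. *)
assert (He : (0 < eps / 4)%R) by lra.
destruct (Hf z Hz) as [_ [_ [_ [_ [_ [HX HY]]]]]].
destruct (proj1 (continuous_cont_at _ _) HX _ He) as [d1 [Hd1 H1]].
destruct (proj1 (continuous_cont_at _ _) HY _ He) as [d2 [Hd2 H2]].
(* The halving is needed because the modulus is estimated by the sum of the two coordinate
   distances. *)
set (d := (Rmin (Im z) (Rmin d1 d2) / 2)%R).
assert (Hd : (0 < Rmin (Im z) (Rmin d1 d2))%R) by (repeat apply Rmin_pos; assumption).
assert (Hclose : forall u v, (Rabs (u - Re z) < d)%R -> (Rabs (v - Im z) < d)%R ->
  upper (u, v) /\ (Cmod (dX f (u, v) - dX f z) < eps / 4)%R /\ (Cmod (dY f (u, v) - dY f z) < eps / 4)%R).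
{ intros u v Hu Hv.
  assert (Hm : (Cmod ((u, v) - z) < Rmin (Im z) (Rmin d1 d2))%R).
  { eapply Rle_lt_trans; [apply Cmod_le_Re_Im|].
    replace (Re ((u, v) - z)) with (u - Re z)%R by reflexivity.
    replace (Im ((u, v) - z)) with (v - Im z)%R by reflexivity.
    unfold d in Hu, Hv; lra. }
  assert (Hm1 := Rlt_le_trans _ _ _ Hm (Rmin_l _ _)).
  assert (Hm2 := Rlt_le_trans _ _ _ Hm (Rmin_r _ _)).
  split; [exact (upper_near z _ Hm1) | split].
  - apply H1, (Rlt_le_trans _ _ _ Hm2 (Rmin_l _ _)).
  - apply H2, (Rlt_le_trans _ _ _ Hm2 (Rmin_r _ _)). }
exists d; split; [unfold d; lra|]; intros w Hw.
assert (Hu : (Rabs (Re w - Re z) < d)%R) by (eapply Rle_lt_trans; [apply (re_le_Cmod (w - z)) | exact Hw]).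
assert (Hv : (Rabs (Im w - Im z) < d)%R) by (eapply Rle_lt_trans; [apply (Im_le_Cmod (w - z)) | exact Hw]).
assert (KR := partials_increment (fun u v => Re (f (u, v))) (fun u v => Re (dX f (u, v)))
  (fun u v => Re (dY f (u, v))) (Re z) (Im z) d (eps / 4)).
assert (KI := partials_increment (fun u v => Im (f (u, v))) (fun u v => Im (dX f (u, v)))
  (fun u v => Im (dY f (u, v))) (Re z) (Im z) d (eps / 4)).
cbv beta in KR, KI.
specialize (fun A B => KR A B (Re w) (Im w) Hu Hv); specialize (fun A B => KI A B (Re w) (Im w) Hu Hv).
rewrite <- !surjective_pairing in KR, KI.
assert (KR' : (Rabs (Re (f w) - Re (f z) - (Re (dX f z) * (Re w - Re z) + Re (dY f z) * (Im w - Im z))) <=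
  eps / 4 * (Rabs (Re w - Re z) + Rabs (Im w - Im z)))%R).
{ apply KR.
  - intros u v Hu' Hv'; destruct (Hclose u v Hu' Hv') as [U _].
    destruct (Hf _ U) as [_ [P1 [_ [P2 _]]]]; split; now apply Derive_correct.
  - intros u v Hu' Hv'; destruct (Hclose u v Hu' Hv') as [_ [C1' C2']].
    split; [eapply Rle_trans; [apply (re_le_Cmod (dX f (u, v) - dX f z)) | lra]
           | eapply Rle_trans; [apply (re_le_Cmod (dY f (u, v) - dY f z)) | lra]]. }
assert (KI' : (Rabs (Im (f w) - Im (f z) - (Im (dX f z) * (Re w - Re z) + Im (dY f z) * (Im w - Im z))) <=
  eps / 4 * (Rabs (Re w - Re z) + Rabs (Im w - Im z)))%R).
{ apply KI.
  - intros u v Hu' Hv'; destruct (Hclose u v Hu' Hv') as [U _].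
    destruct (Hf _ U) as [_ [_ [P1 [_ [P2 _]]]]]; split; now apply Derive_correct.
  - intros u v Hu' Hv'; destruct (Hclose u v Hu' Hv') as [_ [C1' C2']].
    split; [eapply Rle_trans; [apply (Im_le_Cmod (dX f (u, v) - dX f z)) | lra]
           | eapply Rle_trans; [apply (Im_le_Cmod (dY f (u, v) - dY f z)) | lra]]. }
clear KR KI.
set (R1 := f w - f z - d_z f z * (w - z) - d_zbar f z * Cconj (w - z)).
assert (ER : R1 = f w - f z - (dX f z * RtoC (Re w - Re z) + dY f z * RtoC (Im w - Im z))).
{ unfold R1, d_z, d_zbar.
  replace (w - z) with (RtoC (Re w - Re z) + Ci * RtoC (Im w - Im z))
    by (destruct w, z; apply C_ext; simpl; ring).
  replace (Cconj (RtoC (Re w - Re z) + Ci * RtoC (Im w - Im z)))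
    with (RtoC (Re w - Re z) - Ci * RtoC (Im w - Im z)) by (apply C_ext; simpl; ring).
  transitivity (f w - f z - (dX f z * RtoC (Re w - Re z) - (Ci * Ci) * (dY f z * RtoC (Im w - Im z))));
    [field; apply two_neq_0 | rewrite Ci_square; ring]. }
eapply Rle_trans; [apply Cmod_le_Re_Im|].
assert (E1 : Re R1 = (Re (f w) - Re (f z) - (Re (dX f z) * (Re w - Re z) + Re (dY f z) * (Im w - Im z)))%R).
{ rewrite ER; unfold Cminus; rewrite !re_plus, !re_opp, re_plus, !re_scal_r; reflexivity. }
assert (E2 : Im R1 = (Im (f w) - Im (f z) - (Im (dX f z) * (Re w - Re z) + Im (dY f z) * (Im w - Im z)))%R).
{ rewrite ER; unfold Cminus; rewrite !im_plus, !im_opp, im_plus, !im_scal_r; reflexivity. }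
rewrite E1, E2.
pose proof (re_le_Cmod (w - z)) as L1; pose proof (Im_le_Cmod (w - z)) as L2.
change (Re (w - z)) with (Re w - Re z)%R in L1; change (Im (w - z)) with (Im w - Im z)%R in L2.
assert (eps / 4 * (Rabs (Re w - Re z) + Rabs (Im w - Im z)) <= eps / 4 * (2 * Cmod (w - z)))%R
  by (apply Rmult_le_compat_l; lra).
lra.
Qed.

(** * The Eichler integral *)

Lemma upper_Cconj (t : C) : lower t -> upper (Cconj t).
Proof. unfold upper, lower; rewrite im_conj; lra. Qed.

Lemma lower_Cconj (z : C) : upper z -> lower (Cconj z).
Proof. unfold upper, lower; rewrite im_conj; lra. Qed.

Lemma upper_minus_lower (z t : C) : upper z -> lower t -> upper (z - t).
Proof. unfold upper, lower, Cminus; rewrite im_plus, im_opp; lra. Qed.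

Lemma lower_near (t w : C) : (Cmod (w - t) < - Im t)%R -> lower w.
Proof.
intros H; unfold lower.
assert (H1 := Rle_lt_trans _ _ _ (Im_le_Cmod (w - t)) H).
unfold Cminus in H1; rewrite im_plus, im_opp in H1.
destruct (Rabs_def2 _ _ H1); lra.
Qed.

Definition eichler_kernel (F : C -> C) (s t z : C) : C := cpow_up (z - t) s * F z.

Definition eichler (F : C -> C) (s z0 t : C) : C := seg (eichler_kernel F s t) z0 (Cconj t).

Lemma eichler_kernel_holo (F : C -> C) (s t : C) :
  holo_upper F -> lower t -> holo_upper (eichler_kernel F s t).
Proof.
intros HF Ht z Hz; destruct (HF z Hz) as [l Hl].
assert (H1 := cderiv_minus _ _ _ _ _ (wirtinger_id z) (wirtinger_const t z)).
assert (H2 := cderiv_comp _ (fun w => cpow_up w s) _ _ _ H1 (cderiv_cpow_up _ s (upper_minus_lower z t Hz Ht))).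
eexists; exact (cderiv_mult _ _ _ _ _ H2 Hl).
Qed.

Lemma eichler_kernel_deriv_t (F : C -> C) (s t z : C) : upper z -> lower t ->
  cderiv (fun t => eichler_kernel F s t z) t (- s * eichler_kernel F (s - 1) t z).
Proof.
intros Hz Ht.
assert (H1 := cderiv_minus _ _ _ _ _ (wirtinger_const z t) (wirtinger_id t)).
assert (H2 := cderiv_comp _ (fun w => cpow_up w s) _ _ _ H1 (cderiv_cpow_up _ s (upper_minus_lower z t Hz Ht))).
refine (wirtinger_eq _ _ _ _ _ _ _ _ (cderiv_mult _ _ _ _ _ H2 (wirtinger_const (F z) t))); [|ring].
unfold eichler_kernel; ring.
Qed.

Lemma eichler_kernel_jcont (F : C -> C) (s : C) (a : R -> C -> C) (u : R) (t : C) :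
  holo_upper F -> lower t -> jcont a u t -> upper (a u t) ->
  jcont (fun u t => eichler_kernel F s t (a u t)) u t.
Proof.
intros HF Ht Ha Hu; apply jcont_mult.
- apply (jcont_comp (fun w => cpow_up w s) (fun u t => a u t - t)).
  + intros eps Heps.
    destruct (jcont_plus _ _ u t Ha (jcont_r (fun t => - (1) * t) u t (cont_at_scal _ _ _ (cont_at_id t))) eps Heps)
      as [d [Hd Hw]].
    exists d; split; [exact Hd|]; intros s' t' Hs Ht'.
    replace (a s' t' - t' - (a u t - t)) with (a s' t' + - (1) * t' - (a u t + - (1) * t)) by ring; auto.
  + exact (cderiv_cont _ _ _ (cderiv_cpow_up _ s (upper_minus_lower _ t Hu Ht))).
- apply (jcont_comp F a u t Ha), holo_upper_cont; assumption.
Qed.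

Lemma eichler_segment_deriv (F : C -> C) (s a b t : C) :
  holo_upper F -> lower t -> upper a -> upper b ->
  cderiv (fun t => seg (eichler_kernel F s t) a b) t (- s * seg (eichler_kernel F (s - 1) t) a b).
Proof.
intros HF Ht Ha Hb; unfold seg.
assert (HK : forall s' u t', (0 <= u <= 1)%R -> lower t' ->
  jcont (fun u t => eichler_kernel F s' t (a + RtoC u * (b - a)) * (b - a)) u t').
{ intros s' u t' Hu Ht'; apply jcont_mult; [|apply (jcont_r (fun _ => b - a)), cont_at_const].
  apply (eichler_kernel_jcont F s' (fun u _ => a + RtoC u * (b - a))); auto.
  - apply (jcont_l (fun u => a + RtoC u * (b - a))), rcont_line.
  - now apply upper_seg. }
rewrite <- cint01_scal.
2: { intros u Hu; apply (jcont_rcont _ _ t (HK (s - 1) u t Hu Ht)). }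
apply (cint01_param_deriv (fun u t => eichler_kernel F s t (a + RtoC u * (b - a)) * (b - a))
  (fun u t => - s * (eichler_kernel F (s - 1) t (a + RtoC u * (b - a)) * (b - a))) t (- Im t)).
- unfold lower in Ht; lra.
- intros u w Hu Hw; apply lower_near in Hw.
  assert (H := eichler_kernel_deriv_t F s w _ (upper_seg a b u Ha Hb Hu) Hw).
  refine (wirtinger_eq _ _ _ _ _ _ _ _ (cderiv_mult _ _ _ _ _ H (wirtinger_const (b - a) w))); ring.
- intros w Hw u Hu; apply lower_near in Hw; apply (jcont_rcont _ _ w (HK s u w Hu Hw)).
- intros u Hu; apply jcont_mult; [apply (jcont_r (fun _ => - s)), cont_at_const | now apply HK].
Qed.

(** The path to [Cconj w] is broken at [Cconj t]. The part with fixed end points is holomorphic in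
    [w]. The short segment that remains contributes the kernel at [Cconj t] times
    [Cconj w - Cconj t], up to an error controlled by joint continuity of the kernel. *)
Lemma eichler_wirtinger (F : C -> C) (s z0 t : C) :
  holo_upper F -> upper z0 -> lower t ->
  wirtinger (eichler F s z0) t (- s * eichler F (s - 1) z0 t)
    (cpow_up (Cconj t - t) s * F (Cconj t)).
Proof.
intros HF H0 Ht.
pose proof (upper_Cconj t Ht) as Utc.
assert (S1 := eichler_segment_deriv F s z0 (Cconj t) t HF Ht H0 Utc).
set (c := cpow_up (Cconj t - t) s * F (Cconj t)).
assert (S2 : is_small t (fun w => seg (eichler_kernel F s w) (Cconj t) (Cconj w) - c * (Cconj w - Cconj t))).
{ intros eps Heps.
  destruct (jcont_uniform (fun u w => eichler_kernel F s w (Cconj t + RtoC u * (Cconj w - Cconj t))) t eps Heps)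
    as [d [Hd Hu]].
  { intros u Hu; apply (eichler_kernel_jcont F s (fun u w => Cconj t + RtoC u * (Cconj w - Cconj t))); auto.
    - apply jcont_plus; [apply (jcont_r (fun _ => Cconj t)), cont_at_const|].
      apply jcont_mult.
      + apply (jcont_l (fun u => RtoC u)), rcont_ext with (fun u => 0 + RtoC u * 1);
          [intros; ring | apply rcont_line].
      + apply (jcont_r (fun w => Cconj w - Cconj t)).
        exact (wirtinger_cont _ _ _ _ (wirtinger_minus _ _ _ _ _ _ _ (wirtinger_conj t) (wirtinger_const (Cconj t) t))).
    - now apply upper_seg. }
  exists (Rmin d (- Im t)); split; [apply Rmin_pos; [exact Hd | unfold lower in Ht; lra]|].
  intros w Hw.
  assert (Hw1 := Rlt_le_trans _ _ _ Hw (Rmin_l _ _)).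
  assert (Hw2 := lower_near t w (Rlt_le_trans _ _ _ Hw (Rmin_r _ _))).
  rewrite <- (Cmod_conj (w - t)), Cminus_conj.
  apply seg_near; [now apply eichler_kernel_holo | exact Utc | now apply upper_Cconj|].
  intros u Hu'; left; specialize (Hu u w Hu' Hw1); cbv beta in Hu.
  replace (Cconj t + RtoC u * (Cconj t - Cconj t)) with (Cconj t) in Hu by ring; exact Hu. }
refine (is_small_le _ _ _ (- Im t)%R _ _ (is_small_plus _ _ _ S1 S2)).
{ unfold lower in Ht; lra. }
intros w Hw; apply lower_near in Hw; cbv beta; right; f_equal.
unfold eichler.
rewrite <- (seg_chasles (eichler_kernel F s w) z0 (Cconj t) (Cconj w))
  by (auto using eichler_kernel_holo, upper_Cconj).
rewrite Cminus_conj; fold c; ring.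
Qed.

(** * The cocycle relation *)

(** A quotient of exponentials equal to 1 forces real part 0 and [cos y = 1] for the difference;
    then [sin (y / 2) = 0] with [y / 2] of modulus below [pi], so [y = 0]. *)
Lemma cexp_inj (a b : C) : cexp a = cexp b -> (Rabs (Im a - Im b) < 2 * PI)%R -> a = b.
Proof.
intros H Hab.
assert (E : cexp (a - b) = 1).
{ unfold Cminus; rewrite cexp_plus, cexp_opp, H; field; apply cexp_neq_0. }
assert (ER : Re (a - b) = 0%R).
{ apply exp_inv; rewrite exp_0, <- Cmod_cexp, E; apply Cmod_1. }
assert (EC : cos (Im (a - b)) = 1%R).
{ assert (K : Re (cexp (a - b)) = 1%R) by (rewrite E; reflexivity).
  unfold cexp in K; rewrite ER, exp_0 in K; simpl in K; simpl; lra. }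
set (y := Im (a - b)) in *.
assert (Hy : (Rabs y < 2 * PI)%R) by exact Hab.
assert (ES : sin (y / 2) = 0%R).
{ replace y with (2 * (y / 2))%R in EC by field; rewrite cos_2a_sin in EC.
  assert (K : (sin (y / 2) * sin (y / 2) = 0)%R) by lra.
  apply Rmult_integral in K; tauto. }
assert (Ey : y = 0%R).
{ destruct (Rabs_def2 _ _ Hy) as [H1 H2].
  destruct (Rtotal_order y 0) as [L|[L|L]]; [|exact L|].
  - assert (0 < sin (- (y / 2)))%R by (apply sin_gt_0; lra); rewrite sin_neg in *; lra.
  - assert (0 < sin (y / 2))%R by (apply sin_gt_0; lra); lra. }
apply Ceq_minus, C_ext; [exact ER | exact Ey].
Qed.

Lemma acos_Re_bounds (z : C) : Im z <> 0%R -> (0 < acos (Re z / Cmod z) < PI)%R.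
Proof.
intros Hz; apply acos_bound_lt.
destruct (Rlt_le_dec 0 (Im z)) as [H|H]; [now apply upper_Re_div_Cmod|].
rewrite <- (Cmod_conj z), <- (re_conj z); apply upper_Re_div_Cmod.
unfold upper; rewrite im_conj; lra.
Qed.

Lemma Arg_up_upper (z : C) : upper z -> (0 < Arg_up z < PI)%R.
Proof.
unfold upper; intros Hz; unfold Arg_up; destruct Rle_dec; [|lra]; apply acos_Re_bounds; lra.
Qed.

Lemma Arg_up_lower (z : C) : lower z -> (- PI < Arg_up z < 0)%R.
Proof.
unfold lower; intros Hz; unfold Arg_up; destruct Rle_dec; [lra|].
pose proof (acos_Re_bounds z); lra.
Qed.

Lemma Arg_lo_Cconj (z : C) : Arg_lo (Cconj z) = (- Arg_up z)%R.
Proof.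
unfold Arg_lo, Arg_up; rewrite re_conj, im_conj, Cmod_conj.
destruct Rlt_dec, Rle_dec; lra.
Qed.

Lemma Log_lo_Cconj (z : C) : Log_lo (Cconj z) = Cconj (Log_up z).
Proof. unfold Log_lo, Log_up; rewrite Arg_lo_Cconj, Cmod_conj; reflexivity. Qed.

Lemma cexp_Cconj (z : C) : cexp (Cconj z) = Cconj (cexp z).
Proof.
unfold cexp; rewrite re_conj, im_conj, cos_neg, sin_neg; apply C_ext; simpl; ring.
Qed.

Lemma Cconj_neq_0 (z : C) : z <> 0 -> Cconj z <> 0.
Proof.
intros Hz E; apply Hz; rewrite <- (Cconj_conj z), E; apply C_ext; simpl; ring.
Qed.

(** Conjugation exchanges the two half-open ranges of the argument, so the identity holds on the
    negative real axis as well. *)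
Lemma cpow_up_Cconj (z s : C) : z <> 0 -> Cconj (cpow_up z s) = cpow_lo (Cconj z) (Cconj s).
Proof.
intros Hz; rewrite cpow_up_exp, cpow_lo_exp by auto using Cconj_neq_0.
now rewrite Log_lo_Cconj, <- Cmult_conj, cexp_Cconj.
Qed.

(** * Moebius transformations and the automorphy factor *)

Lemma cz_d_Cconj (g : mat) (z : C) : Cconj (cz_d g z) = cz_d g (Cconj z).
Proof. unfold cz_d; apply C_ext; simpl; ring. Qed.

Lemma cz_d_Im (g : mat) (z : C) : Im (cz_d g z) = (mc g * Im z)%R.
Proof. unfold cz_d; rewrite im_plus, im_scal_l, im_RtoC; ring. Qed.

Lemma cz_d_neq_0 (g : mat) (z : C) : mdet g = 1%R -> Im z <> 0%R -> cz_d g z <> 0.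
Proof.
intros Hg Hz E.
assert (EI : (mc g * Im z = 0)%R) by (rewrite <- cz_d_Im, E; reflexivity).
apply Rmult_integral in EI; destruct EI as [Hc|]; [|contradiction].
assert (ER : Re (cz_d g z) = 0%R) by (rewrite E; reflexivity).
unfold cz_d in ER; rewrite Hc in ER; simpl in ER.
unfold mdet in Hg; rewrite Hc in Hg.
assert (Hd : md g = 0%R) by lra; rewrite Hd in Hg; lra.
Qed.

Lemma upper_Im_neq_0 (z : C) : upper z -> Im z <> 0%R.
Proof. unfold upper; lra. Qed.

Lemma lower_Im_neq_0 (z : C) : lower z -> Im z <> 0%R.
Proof. unfold lower; lra. Qed.

Lemma mob_cz_d (g : mat) (z : C) : mob g z = (RtoC (ma g) * z + RtoC (mb g)) / cz_d g z.
Proof. reflexivity. Qed.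

Lemma mob_Cconj (g : mat) (z : C) : mdet g = 1%R -> Im z <> 0%R -> mob g (Cconj z) = Cconj (mob g z).
Proof.
intros Hg Hz; rewrite !mob_cz_d, Cdiv_conj by now apply cz_d_neq_0.
rewrite cz_d_Cconj; f_equal; apply C_ext; simpl; ring.
Qed.

Lemma RtoC_mdet (g : mat) : mdet g = 1%R -> RtoC (ma g) * RtoC (md g) - RtoC (mb g) * RtoC (mc g) = 1.
Proof. intros Hg; rewrite <- !RtoC_mult, <- RtoC_minus; f_equal; exact Hg. Qed.

Lemma mob_minus (g : mat) (w t : C) : mdet g = 1%R -> Im w <> 0%R -> Im t <> 0%R ->
  mob g w - mob g t = (w - t) / (cz_d g w * cz_d g t).
Proof.
intros Hg Hw Ht; pose proof (cz_d_neq_0 g w Hg Hw) as Nw; pose proof (cz_d_neq_0 g t Hg Ht) as Nt.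
rewrite !mob_cz_d.
transitivity (((RtoC (ma g) * w + RtoC (mb g)) * cz_d g t - (RtoC (ma g) * t + RtoC (mb g)) * cz_d g w)
  / (cz_d g w * cz_d g t)); [field; auto|].
f_equal; unfold cz_d.
transitivity ((RtoC (ma g) * RtoC (md g) - RtoC (mb g) * RtoC (mc g)) * (w - t)); [ring|].
rewrite RtoC_mdet by exact Hg; ring.
Qed.

(** [mob_minus] for [z] and its conjugate shows that [k] is the inverse square of the modulus of
    [cz_d g z]. *)
Lemma Im_mob (g : mat) (z : C) : mdet g = 1%R -> Im z <> 0%R ->
  exists k, (0 < k)%R /\ Im (mob g z) = (k * Im z)%R.
Proof.
intros Hg Hz; pose proof (cz_d_neq_0 g z Hg Hz) as N.
set (q := (Cmod (cz_d g z) ^ 2)%R).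
assert (Hq : (0 < q)%R) by (apply pow_lt, Cmod_gt_0, N).
exists (/ q)%R; split; [now apply Rinv_0_lt_compat|].
assert (Hz' : Im (Cconj z) <> 0%R) by (rewrite im_conj; lra).
pose proof (mob_minus g z (Cconj z) Hg Hz Hz') as E.
rewrite mob_Cconj, <- cz_d_Cconj, <- Cmod2_conj in E by assumption; fold q in E.
rewrite !im_alt' in E.
assert (E2 : (2 * Im (mob g z))%R = (/ q * (2 * Im z))%R).
{ replace (2 * Im (mob g z))%R with (Im (2 * Ci * RtoC (Im (mob g z)))) by (simpl; ring).
  rewrite E; unfold Cdiv; rewrite <- RtoC_inv by lra; rewrite im_scal_r; simpl; ring. }
lra.
Qed.

Lemma mob_upper (g : mat) (z : C) : mdet g = 1%R -> upper z -> upper (mob g z).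
Proof.
intros Hg Hz; destruct (Im_mob g z Hg (upper_Im_neq_0 z Hz)) as [k [Hk E]].
unfold upper in *; rewrite E; now apply Rmult_lt_0_compat.
Qed.

Lemma mob_lower (g : mat) (z : C) : mdet g = 1%R -> lower z -> lower (mob g z).
Proof.
intros Hg Hz; destruct (Im_mob g z Hg (lower_Im_neq_0 z Hz)) as [k [Hk E]].
unfold lower in *; rewrite E.
assert (0 < k * - Im z)%R by (apply Rmult_lt_0_compat; lra); lra.
Qed.

Lemma mob_minv (g : mat) (z : C) : mdet g = 1%R -> upper z -> mob g (mob (minv g) z) = z.
Proof.
intros Hg Hz.
assert (Hi : mdet (minv g) = 1%R) by (unfold mdet, minv in *; simpl; lra).
pose proof (cz_d_neq_0 _ z Hi (upper_Im_neq_0 z Hz)) as N.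
pose proof (cz_d_neq_0 g _ Hg (upper_Im_neq_0 _ (mob_upper _ z Hi Hz))) as N'.
rewrite (mob_cz_d g); unfold cz_d in N'.
assert (ED := RtoC_mdet g Hg).
assert (EQ : cz_d g (mob (minv g) z) = / cz_d (minv g) z).
{ unfold cz_d at 1; rewrite mob_cz_d.
  transitivity ((RtoC (mc g) * (RtoC (ma (minv g)) * z + RtoC (mb (minv g))) + RtoC (md g) * cz_d (minv g) z) / cz_d (minv g) z);
    [field; exact N|].
  transitivity ((RtoC (ma g) * RtoC (md g) - RtoC (mb g) * RtoC (mc g)) / cz_d (minv g) z);
    [|rewrite ED; field; exact N].
  unfold Cdiv; f_equal; unfold cz_d, minv; simpl; rewrite !RtoC_opp; ring. }
rewrite EQ, mob_cz_d.
transitivity (RtoC (ma g) * (RtoC (ma (minv g)) * z + RtoC (mb (minv g))) + RtoC (mb g) * cz_d (minv g) z);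
  [field; exact N|].
transitivity ((RtoC (ma g) * RtoC (md g) - RtoC (mb g) * RtoC (mc g)) * z); [|rewrite ED; ring].
unfold cz_d, minv; simpl; rewrite !RtoC_opp; ring.
Qed.

Lemma cderiv_mob (g : mat) (z : C) : mdet g = 1%R -> upper z ->
  cderiv (mob g) z (/ (cz_d g z * cz_d g z)).
Proof.
intros Hg Hz; pose proof (cz_d_neq_0 g z Hg (upper_Im_neq_0 z Hz)) as N.
assert (HA : forall a b, cderiv (fun w => a * w + b) z a).
{ intros a b; apply wirtinger_ext with (fun w => a * w + 0 * Cconj w + b); [intros; ring | apply wirtinger_affine]. }
assert (H := cderiv_mult _ _ _ _ _ (HA (RtoC (ma g)) (RtoC (mb g)))
  (cderiv_comp _ Cinv _ _ _ (HA (RtoC (mc g)) (RtoC (md g))) (cderiv_inv _ N))).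
refine (wirtinger_eq _ _ _ _ _ _ _ _ H); [|reflexivity].
fold (cz_d g z).
transitivity ((RtoC (ma g) * cz_d g z - (RtoC (ma g) * z + RtoC (mb g)) * RtoC (mc g)) / (cz_d g z * cz_d g z));
  [field; exact N|].
transitivity (1 / (cz_d g z * cz_d g z)); [|field; exact N].
f_equal; rewrite <- (RtoC_mdet g Hg); unfold cz_d; ring.
Qed.

(* The two argument conventions are opposite: for [c <> 0] the numbers [c w + d] and [c t + d]
   lie in opposite half-planes, and for [c = 0] the two arguments of [d] cancel. *)
Lemma Arg_cz_d_bound (g : mat) (w t : C) : mdet g = 1%R -> upper w -> lower t ->
  (- PI < Arg_up (cz_d g w) + Arg_lo (cz_d g t) < PI)%R.
Proof.
intros Hg Hw Ht.
pose proof (upper_Cconj t Ht) as Ht'.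
rewrite <- (Cconj_conj (cz_d g t)), Arg_lo_Cconj, cz_d_Cconj.
set (u := Cconj t) in *.
pose proof PI_RGT_0.
destruct (Rtotal_order (mc g) 0) as [Hc|[Hc|Hc]].
- assert (L : forall x, upper x -> lower (cz_d g x)).
  { intros x Hx; unfold upper in Hx; unfold lower; rewrite cz_d_Im.
    assert (0 < - mc g * Im x)%R by (apply Rmult_lt_0_compat; lra); lra. }
  pose proof (Arg_up_lower _ (L w Hw)); pose proof (Arg_up_lower _ (L u Ht')); lra.
- assert (E : cz_d g u = cz_d g w) by (unfold cz_d; rewrite Hc; ring).
  rewrite E; lra.
- assert (L : forall x, upper x -> upper (cz_d g x)).
  { intros x Hx; unfold upper in *; rewrite cz_d_Im; now apply Rmult_lt_0_compat. }
  pose proof (Arg_up_upper _ (L w Hw)); pose proof (Arg_up_upper _ (L u Ht')); lra.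
Qed.

(** Both sides have the same exponential by [mob_minus]. The arguments of [w - t] and of its
    transform lie between 0 and [pi], hence differ by less than [pi], and [Arg_cz_d_bound] adds less
    than [pi], so [cexp_inj] applies. An identity of logarithms is what allows arbitrary complex
    exponents. *)
Lemma Log_mob_minus (g : mat) (w t : C) : mdet g = 1%R -> upper w -> lower t ->
  Log_up (mob g w - mob g t) + Log_up (cz_d g w) + Log_lo (cz_d g t) = Log_up (w - t).
Proof.
intros Hg Hw Ht.
pose proof (upper_minus_lower _ _ (mob_upper g w Hg Hw) (mob_lower g t Hg Ht)) as U1.
pose proof (upper_minus_lower _ _ Hw Ht) as U2.
pose proof (cz_d_neq_0 g w Hg (upper_Im_neq_0 w Hw)) as Nw.
pose proof (cz_d_neq_0 g t Hg (lower_Im_neq_0 t Ht)) as Nt.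
apply cexp_inj.
- rewrite !cexp_plus, !cexp_Log_up, cexp_Log_lo by auto using upper_neq_0.
  rewrite mob_minus by auto using upper_Im_neq_0, lower_Im_neq_0; field; auto.
- rewrite !im_plus; unfold Log_up, Log_lo, Im, snd.
  pose proof (Arg_up_upper _ U1); pose proof (Arg_up_upper _ U2).
  pose proof (Arg_cz_d_bound g w t Hg Hw Ht).
  apply Rabs_def1; lra.
Qed.

Lemma cpow_mob_minus (g : mat) (w t s : C) : mdet g = 1%R -> upper w -> lower t ->
  cpow_up (mob g w - mob g t) s * cpow_up (cz_d g w) s * cpow_lo (cz_d g t) s = cpow_up (w - t) s.
Proof.
intros Hg Hw Ht.
pose proof (upper_minus_lower _ _ (mob_upper g w Hg Hw) (mob_lower g t Hg Ht)) as U1.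
pose proof (upper_minus_lower _ _ Hw Ht) as U2.
rewrite !cpow_up_exp, cpow_lo_exp
  by (auto using upper_neq_0, cz_d_neq_0, upper_Im_neq_0, lower_Im_neq_0).
rewrite <- !cexp_plus; f_equal; rewrite <- (Log_mob_minus g w t Hg Hw Ht); ring.
Qed.

(** The power with exponent [r] is split so that the square cancels the derivative of the Moebius
    map, while the power with exponent [r - 2] combines with the kernel through [cpow_mob_minus]. *)
Lemma in_A_mob (G : mat -> Prop) (v : mat -> C) (r : C) (F : C -> C) (g : mat) (z : C) :
  in_A G v r F -> G g -> mdet g = 1%R -> v g <> 0 -> upper z ->
  F (mob g z) = v g * cpow_up (cz_d g z) (r - 2) * (cz_d g z * cz_d g z) * F z.
Proof.
intros [_ HF] Hg Hd Hv Hz; rewrite <- (HF g z Hg Hz).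
pose proof (cz_d_neq_0 g z Hd (upper_Im_neq_0 z Hz)) as N.
replace (r - 2) with (r - 1 - 1) by ring.
rewrite !cpow_up_minus_1, !cpow_up_exp by exact N.
replace (- r * Log_up (cz_d g z)) with (- (r * Log_up (cz_d g z))) by ring.
rewrite cexp_opp; field; auto using cexp_neq_0.
Qed.

Lemma seg_zero (a b : C) : upper a -> upper b -> seg (fun _ => 0) a b = 0.
Proof.
intros Ha Hb; rewrite (seg_derive (fun _ => 0) (fun _ => 0)); auto; [ring| |].
- intros z _; apply wirtinger_const.
- intros z _; apply cont_at_const.
Qed.

Lemma cderiv_zero_const (D : C -> C) (a b : C) :
  (forall z, upper z -> cderiv D z 0) -> upper a -> upper b -> D a = D b.
Proof.
intros H Ha Hb; pose proof (seg_derive D (fun _ => 0) a b H) as E.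
rewrite seg_zero in E by assumption.
symmetry; apply Ceq_minus; symmetry; apply E; auto; intros z _; apply cont_at_const.
Qed.

Lemma seg_diag (f : C -> C) (a : C) : holo_upper f -> upper a -> seg f a a = 0.
Proof.
intros Hf Ha; pose proof (seg_chasles f a a a Hf Ha Ha Ha) as E.
apply Ceq_minus in E; rewrite <- E; ring.
Qed.

(** A Moebius map bends segments, so instead of a substitution the upper limit [w] is made variable:
    by the transformation law of [F], the function [D] has derivative zero. At [w = Cconj t] it is
    the left-hand side. At [w = a] its first integral runs from [z0] to [z0] and vanishes, and the
    second, reversed, is [psi]. *)
Lemma eichler_slash (G : mat -> Prop) (v : mat -> C) (r : C) (F : C -> C) (z0 : C) (g : mat) (t : C) :
  in_A G v r F -> holo_upper F -> G g -> mdet g = 1%R -> v g <> 0 -> upper z0 -> lower t ->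
  slash_lo v r (eichler F (r - 2) z0) g t - eichler F (r - 2) z0 t = psi F r z0 g t.
Proof.
intros HA HF Gg Hg Hv H0 Ht.
set (s := r - 2).
set (kappa := / v g * cpow_lo (cz_d g t) s).
set (K1 := eichler_kernel F s (mob g t)); set (K0 := eichler_kernel F s t).
assert (HK1 : holo_upper K1) by (apply eichler_kernel_holo; [exact HF | now apply mob_lower]).
assert (HK0 : holo_upper K0) by (apply eichler_kernel_holo; assumption).
assert (Hi : mdet (minv g) = 1%R) by (unfold mdet, minv in *; simpl; lra).
pose proof (mob_upper _ z0 Hi H0) as Ua.
set (a := mob (minv g) z0) in *.
set (D := fun w => kappa * seg K1 z0 (mob g w) - seg K0 z0 w).
assert (HD : forall w, upper w -> cderiv D w 0).
{ intros w Hw; pose proof (mob_upper g w Hg Hw) as Hgw.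
  assert (H := cderiv_minus _ _ _ _ _
    (cderiv_scal _ kappa _ _ (cderiv_comp _ (fun x => seg K1 z0 x) _ _ _ (cderiv_mob g w Hg Hw) (seg_primitive K1 z0 (mob g w) HK1 H0 Hgw)))
    (seg_primitive K0 z0 w HK0 H0 Hw)).
  refine (wirtinger_eq _ _ _ _ _ _ _ _ H); [|reflexivity].
  apply (proj1 (Ceq_minus _ _)).
  unfold K0, K1, eichler_kernel, kappa.
  rewrite (in_A_mob G v r F g w HA Gg Hg Hv Hw); fold s.
  rewrite <- (cpow_mob_minus g w t s Hg Hw Ht).
  pose proof (cz_d_neq_0 g w Hg (upper_Im_neq_0 w Hw)) as N.
  field; auto. }
assert (E := cderiv_zero_const D (Cconj t) a HD (upper_Cconj t Ht) Ua).
unfold D in E.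
unfold a in E at 1; rewrite mob_minv, (seg_diag K1 z0 HK1 H0), mob_Cconj in E
  by (auto using lower_Im_neq_0).
(* [psi] integrates the same kernel over the segment from [a] to [z0], so the two expressions are
   convertible. *)
change (psi F r z0 g t) with (seg K0 a z0).
change (kappa * eichler F s z0 (mob g t) - eichler F s z0 t = seg K0 a z0).
rewrite (seg_rev K0 z0 a) by (auto using holo_upper_cont).
unfold eichler; fold K0 K1; rewrite E; ring.
Qed.

(** * Harmonic lifts *)

(** An involution that carries functions on one half-plane to the other and keeps holomorphy; it
    relates [H] and the function [k] in both directions. *)
Definition refl (f : C -> C) (z : C) : C := Cconj (f (Cconj z)).

Lemma wirtinger_Cconj (f : C -> C) (z A B : C) :
  wirtinger f z A B -> wirtinger (fun w => Cconj (f w)) z (Cconj B) (Cconj A).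
Proof.
intros H; refine (wirtinger_eq _ _ _ _ _ _ _ _ (wirtinger_comp f Cconj _ _ _ _ _ H (wirtinger_conj _))); ring.
Qed.

Lemma wirtinger_refl (f : C -> C) (z A B : C) :
  wirtinger f (Cconj z) A B -> wirtinger (refl f) z (Cconj A) (Cconj B).
Proof.
intros H; apply (wirtinger_Cconj (fun w => f (Cconj w))).
assert (E0 : Cconj 0 = 0) by (apply C_ext; simpl; ring).
assert (E1 : Cconj 1 = 1) by (apply C_ext; simpl; ring).
refine (wirtinger_eq _ _ _ _ _ _ _ _ (wirtinger_comp Cconj f _ _ _ _ _ (wirtinger_conj z) H));
  rewrite ?E0, ?E1; ring.
Qed.

Lemma refl_holo (phi : C -> C) : holo_on lower phi -> holo_upper (refl phi).
Proof.
intros H z Hz; destruct (H (Cconj z) (lower_Cconj z Hz)) as [l Hl].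
apply is_derive_cderiv in Hl; exists (Cconj l).
refine (wirtinger_eq _ _ _ _ _ _ eq_refl _ (wirtinger_refl _ _ _ _ Hl)); apply C_ext; simpl; ring.
Qed.

Lemma holo_upper_choose (f : C -> C) : holo_upper f -> exists f', forall z, upper z -> cderiv f z (f' z).
Proof.
intros H.
assert (K : forall z, exists l, upper z -> cderiv f z l).
{ intros z; destruct (classic (upper z)) as [Hz|Hz].
  - destruct (H z Hz) as [l Hl]; now exists l.
  (* Off the half-plane the requirement is vacuous and any value serves as witness. *)
  - exists 0; contradiction. }
exists (fun z => proj1_sig (constructive_indefinite_description _ (K z))).
intros z; exact (proj2_sig (constructive_indefinite_description _ (K z))).
Qed.

(** Near each point the partial derivatives are [A + B] and [Ci * (A - B)], so their expansions are
    combinations of those of [A] and [B]. *)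
Lemma wirtinger_C2_on (H A B A1 A2 B1 B2 : C -> C) :
  (forall z, upper z -> wirtinger H z (A z) (B z)) ->
  (forall z, upper z -> wirtinger A z (A1 z) (A2 z)) ->
  (forall z, upper z -> wirtinger B z (B1 z) (B2 z)) ->
  cont_upper A1 -> cont_upper A2 -> cont_upper B1 -> cont_upper B2 ->
  C2_on upper H.
Proof.
intros HH HA HB CA1 CA2 CB1 CB2.
assert (Hloc : forall z w, (Cmod (w - z) < Im z)%R -> dX H w = A w + B w /\ dY H w = Ci * (A w - B w)).
{ intros z w Hw; apply upper_near in Hw; apply (wirtinger_partials H w _ _ (HH w Hw)). }
assert (CA : cont_upper A) by (intros z Hz; exact (wirtinger_cont _ _ _ _ (HA z Hz))).
assert (CB : cont_upper B) by (intros z Hz; exact (wirtinger_cont _ _ _ _ (HB z Hz))).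
assert (Cm : forall f g, cont_upper f -> cont_upper g -> cont_upper (fun z => Ci * (f z - g z))).
{ intros f g Hf Hg z Hz; apply cont_at_scal.
  apply cont_at_ext_loc with (fun w => f w + - (1) * g w) 1%R; [lra | intros; ring|].
  apply cont_at_plus; [auto | apply cont_at_scal; auto]. }
split; [|split].
- now apply wirtinger_C1_on with A B.
- apply wirtinger_C1_on with (fun z => A1 z + B1 z) (fun z => A2 z + B2 z).
  + intros z Hz; refine (wirtinger_ext_loc _ _ _ _ _ (Im z) Hz _ (wirtinger_plus _ _ _ _ _ _ _ (HA z Hz) (HB z Hz))).
    intros w Hw; symmetry; exact (proj1 (Hloc z w Hw)).
  + intros z Hz; apply cont_at_plus; auto.
  + intros z Hz; apply cont_at_plus; auto.
- apply wirtinger_C1_on with (fun z => Ci * (A1 z - B1 z)) (fun z => Ci * (A2 z - B2 z)); [|now apply Cm | now apply Cm].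
  intros z Hz; refine (wirtinger_ext_loc _ _ _ _ _ (Im z) Hz _
    (wirtinger_scal _ Ci _ _ _ (wirtinger_minus _ _ _ _ _ _ _ (HA z Hz) (HB z Hz)))).
  intros w Hw; symmetry; exact (proj2 (Hloc z w Hw)).
Qed.

(** Conjugation turns [Cconj (v g)] and [Cconj r] into [v g] and [r], and by [cpow_up_Cconj] it
    replaces the argument convention of the upper half-plane by that of the lower one. *)
Lemma refl_invariant (v : mat -> C) (r : C) (H : C -> C) (g : mat) (z : C) :
  mdet g = 1%R -> v g <> 0 -> upper z ->
  (/ Cconj (v g) * cpow_up (cz_d g z) (Cconj r - 2) * H (mob g z) = H z <->
   slash_lo v r (refl H) g (Cconj z) = refl H (Cconj z)).
Proof.
intros Hg Hv Hz.
pose proof (upper_Im_neq_0 z Hz) as Hz'.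
assert (E2 : Cconj (RtoC 2) = RtoC 2) by (apply C_ext; simpl; ring).
assert (E : slash_lo v r (refl H) g (Cconj z) =
  Cconj (/ Cconj (v g) * cpow_up (cz_d g z) (Cconj r - 2) * H (mob g z))).
{ unfold slash_lo, refl.
  rewrite !Cmult_conj, Cinv_conj, cpow_up_Cconj, !Cconj_conj, mob_Cconj, Cconj_conj, cz_d_Cconj
    by (auto using cz_d_neq_0, Cconj_neq_0).
  now rewrite Cminus_conj, Cconj_conj, E2. }
rewrite E; unfold refl; rewrite Cconj_conj; split.
- now intros ->.
- intros K; rewrite <- (Cconj_conj (H z)), <- K; now rewrite Cconj_conj.
Qed.

Lemma Log_up_pos (y : R) : (0 < y)%R -> Log_up (RtoC y) = RtoC (ln y).
Proof.
intros Hy; unfold Log_up, Arg_up; rewrite Cmod_R, Rabs_pos_eq by lra; simpl.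
destruct Rle_dec; [|lra].
replace (y / y)%R with 1%R by (field; lra); now rewrite acos_1.
Qed.

(** A positive factor adds a real number to the logarithm and leaves the argument unchanged, so no
    branch is crossed. *)
Lemma cpow_up_scal_pos (w s : C) (y : R) : upper w -> (0 < y)%R ->
  cpow_up (w * RtoC y) s = cpow_up w s * cpow_up (RtoC y) s.
Proof.
intros Hw Hy.
assert (U : upper (w * RtoC y)) by (unfold upper in *; rewrite im_scal_r; now apply Rmult_lt_0_compat).
assert (Ny : RtoC y <> 0) by (apply RtoC_neq_0; lra).
rewrite !cpow_up_exp, <- cexp_plus by (auto using upper_neq_0).
f_equal; rewrite <- Cmult_plus_distr_l; f_equal.
apply cexp_inj.
- rewrite cexp_plus, !cexp_Log_up by (auto using upper_neq_0); reflexivity.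
- rewrite im_plus, (Log_up_pos y Hy), im_RtoC; unfold Log_up, Im, snd.
  pose proof (Arg_up_upper _ U); pose proof (Arg_up_upper _ Hw); apply Rabs_def1; lra.
Qed.

Lemma cpow_up_opp (w s : C) : w <> 0 -> cpow_up w (- s) = / cpow_up w s.
Proof.
intros Hw; rewrite !cpow_up_exp by exact Hw; rewrite <- cexp_opp; f_equal; ring.
Qed.

Lemma cpow_up_neq_0 (w s : C) : w <> 0 -> cpow_up w s <> 0.
Proof. intros Hw; rewrite cpow_up_exp by exact Hw; apply cexp_neq_0. Qed.

Lemma upper_2Ci : upper (2 * Ci).
Proof. unfold upper; rewrite im_scal_l; simpl; lra. Qed.

(* [(2i)^(1-r)], written so that the branch of the power at [2i] need not be manipulated *)
Definition eichler_const (r : C) : C := / (2 * Ci * cpow_up (2 * Ci) (r - 2)).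

Lemma eichler_const_neq_0 (r : C) : eichler_const r <> 0.
Proof.
intros E.
assert (N : 2 * Ci * cpow_up (2 * Ci) (r - 2) <> 0).
{ apply Cmult_neq_0; [|apply cpow_up_neq_0]; apply upper_neq_0, upper_2Ci. }
apply C1_nz; rewrite <- (Cinv_r _ N); fold (eichler_const r); rewrite E; ring.
Qed.

(** With [z - Cconj z = 2 i y] the power of [y] splits off and only the constant remains. It is
    applied with [X] the conjugate of [d_zbar H z]; the right-hand side is then the constant times
    the antiholomorphic derivative of [Theta] at [Cconj z]. *)
Lemma eichler_const_spec (r z X f : C) : upper z ->
  (2 * Ci * cpow_up (RtoC (Im z)) (2 - r) * X = f <->
   X = eichler_const r * (cpow_up (z - Cconj z) (r - 2) * f)).
Proof.
intros Hz; unfold upper in Hz.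
assert (Ny : RtoC (Im z) <> 0) by (apply RtoC_neq_0; lra).
assert (N2 : 2 * Ci <> 0) by (apply upper_neq_0, upper_2Ci).
pose proof (cpow_up_neq_0 (RtoC (Im z)) (r - 2) Ny) as N3.
pose proof (cpow_up_neq_0 (2 * Ci) (r - 2) N2) as N4.
pose proof two_neq_0 as N5; pose proof Ci_nz as N6.
rewrite im_alt', cpow_up_scal_pos by (exact upper_2Ci || exact Hz).
replace (2 - r) with (- (r - 2)) by ring; rewrite cpow_up_opp by exact Ny.
unfold eichler_const; split; [intros <- | intros ->]; field; auto.
Qed.

(** * The two implications *)

Lemma coboundary_of_harmonic (G : mat -> Prop) (r : C) (v : mat -> C) (F H : C -> C) (z0 : C) :
  (forall g, G g -> mdet g = 1%R) -> (forall g, G g -> v g <> 0) ->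
  in_A G v r F -> holo_upper F -> upper z0 -> in_harm G v r H ->
  (forall z, upper z -> 2 * Ci * cpow_up (RtoC (Im z)) (2 - r) * Cconj (d_zbar H z) = F z) ->
  psi_coboundary_minus_omega G v r F z0.
Proof.
intros HG Hv HA HF H0 [HC2 [_ Hinv]] HE.
set (c := eichler_const r).
pose proof (eichler_const_neq_0 r) as Nc; fold c in Nc.
exists (fun t => eichler F (r - 2) z0 t - / c * refl H t); split.
- intros t Ht; pose proof (upper_Cconj t Ht) as Ut.
  eexists; apply is_derive_cderiv.
  refine (wirtinger_eq _ _ _ _ _ _ eq_refl _ (wirtinger_minus _ _ _ _ _ _ _ (eichler_wirtinger F (r - 2) z0 t HF H0 Ht)
    (wirtinger_scal _ (/ c) _ _ _ (wirtinger_refl _ _ _ _ (C1_on_wirtinger H (Cconj t) (proj1 HC2) Ut))))).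
  (* The equation of (b) now says that the two antiholomorphic derivatives coincide, so the
     coefficient of the conjugate increment is zero. *)
  rewrite (proj1 (eichler_const_spec r (Cconj t) _ _ Ut) (HE (Cconj t) Ut)), Cconj_conj; fold c.
  field; exact Nc.
- intros g t Gg Ht; pose proof (upper_Cconj t Ht) as Ut.
  rewrite <- (eichler_slash G v r F z0 g t HA HF Gg (HG g Gg) (Hv g Gg) H0 Ht).
  pose proof (proj1 (refl_invariant v r H g (Cconj t) (HG g Gg) (Hv g Gg) Ut) (Hinv g _ Gg Ut)) as E.
  rewrite Cconj_conj in E; rewrite <- E at 1; unfold slash_lo; ring.
Qed.

Lemma harmonic_of_coboundary (G : mat -> Prop) (r : C) (v : mat -> C) (F : C -> C) (z0 : C) :
  (forall g, G g -> mdet g = 1%R) -> (forall g, G g -> v g <> 0) ->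
  in_A G v r F -> holo_upper F -> upper z0 ->
  psi_coboundary_minus_omega G v r F z0 ->
  exists H : C -> C, in_harm G v r H /\
    forall z, upper z -> 2 * Ci * cpow_up (RtoC (Im z)) (2 - r) * Cconj (d_zbar H z) = F z.
Proof.
intros HG Hv HA HF H0 [phi [Hphi Hpsi]].
set (c := eichler_const r); set (s := r - 2).
destruct (holo_upper_choose _ HF) as [F1 HF1].
(* [p1] and [p2] are the first two derivatives of [refl phi], which enter the coefficients of [H] up
   to second order; [p2] is holomorphic in turn, hence continuous. *)
destruct (holo_upper_choose _ (refl_holo phi Hphi)) as [p1 Hp1].
destruct (holo_upper_choose _ (holo_upper_derivative _ _ Hp1)) as [p2 Hp2].
pose proof (holo_upper_derivative _ _ HF1) as HF1'.
pose proof (holo_upper_derivative _ _ Hp2) as Hp2'.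
set (pw := fun s z => cpow_up (z - Cconj z) s).
(* [pw s z] is [(2 i y)^s]; its two coefficients are opposite since it depends on [z - Cconj z]
   only. *)
assert (Hpw : forall s z, upper z -> wirtinger (pw s) z (s * pw (s - 1) z) (- (s * pw (s - 1) z))).
{ intros s' z Hz.
  assert (E0 : Cconj 0 = 0) by (apply C_ext; simpl; ring).
  refine (wirtinger_eq _ _ _ _ _ _ _ _ (wirtinger_comp (fun z => z - Cconj z) (fun w => cpow_up w s') _ _ _ _ _
    (wirtinger_minus _ _ _ _ _ _ _ (wirtinger_id z) (wirtinger_conj z))
    (cderiv_cpow_up _ s' (upper_minus_lower _ _ Hz (lower_Cconj z Hz))))); unfold pw; ring. }
assert (HT : forall s z, upper z -> wirtinger (refl (eichler F s z0)) z
  (Cconj (- s) * refl (eichler F (s - 1) z0) z) (Cconj (pw s z * F z))).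
{ intros s' z Hz.
  refine (wirtinger_eq _ _ _ _ _ _ _ _ (wirtinger_refl _ _ _ _ (eichler_wirtinger F s' z0 _ HF H0 (lower_Cconj z Hz)))).
  - now rewrite Cmult_conj.
  - now rewrite Cconj_conj. }
set (H := fun z => Cconj c * (refl (eichler F s z0) z - refl phi z)).
(* [A] and [B] are the derivatives of [H] in [z] and [Cconj z]; the suffixes 1 and 2 denote the
   derivatives of these in [z] and [Cconj z]. As [refl phi] is holomorphic, it leaves no trace in
   [B]. *)
set (A := fun z => Cconj c * (Cconj (- s) * refl (eichler F (s - 1) z0) z - p1 z)).
set (B := fun z => Cconj c * Cconj (pw s z * F z)).
set (A1 := fun z => Cconj c * (Cconj (- s) * (Cconj (- (s - 1)) * refl (eichler F (s - 1 - 1) z0) z) - p2 z)).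
set (A2 := fun z => Cconj c * (Cconj (- s) * Cconj (pw (s - 1) z * F z))).
set (B1 := fun z => Cconj c * Cconj (- (s * pw (s - 1) z) * F z)).
set (B2 := fun z => Cconj c * Cconj (s * pw (s - 1) z * F z + pw s z * F1 z)).
assert (HHw : forall z, upper z -> wirtinger H z (A z) (B z)).
{ intros z Hz; refine (wirtinger_eq _ _ _ _ _ _ _ _
    (wirtinger_scal _ (Cconj c) _ _ _ (wirtinger_minus _ _ _ _ _ _ _ (HT s z Hz) (Hp1 z Hz)))); unfold A, B; ring. }
assert (HAw : forall z, upper z -> wirtinger A z (A1 z) (A2 z)).
{ intros z Hz; refine (wirtinger_eq _ _ _ _ _ _ _ _
    (wirtinger_scal _ (Cconj c) _ _ _ (wirtinger_minus _ _ _ _ _ _ _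
      (wirtinger_scal _ (Cconj (- s)) _ _ _ (HT (s - 1) z Hz)) (Hp2 z Hz)))); unfold A1, A2; ring. }
assert (HBw : forall z, upper z -> wirtinger B z (B1 z) (B2 z)).
{ intros z Hz; refine (wirtinger_eq _ _ _ _ _ _ _ _
    (wirtinger_scal _ (Cconj c) _ _ _ (wirtinger_Cconj _ _ _ _ (wirtinger_mult _ _ _ _ _ _ _ (Hpw s z Hz) (HF1 z Hz)))));
    unfold B1, B2; do 2 f_equal; ring. }
assert (Rc : forall f z, rdiff f z -> rdiff (fun w => Cconj (f w)) z).
{ intros f z [P [Q K]]; do 2 eexists; exact (wirtinger_Cconj _ _ _ _ K). }
assert (Rh : forall f z, holo_upper f -> upper z -> rdiff f z).
{ intros f z Hf Hz; destruct (Hf z Hz) as [l Hl]; do 2 eexists; exact Hl. }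
assert (Rp : forall s z, upper z -> rdiff (pw s) z) by (intros; do 2 eexists; now apply Hpw).
assert (RT : forall s z, upper z -> rdiff (refl (eichler F s z0)) z) by (intros; do 2 eexists; now apply HT).
(* Continuity of the second-order coefficients is deduced from their differentiability, for which
   expansions with unnamed coefficients suffice. *)
assert (Rcont : forall f, (forall z, upper z -> rdiff f z) -> cont_upper f).
{ intros f K z Hz; destruct (K z Hz) as [P [Q L]]; exact (wirtinger_cont _ _ _ _ L). }
assert (Hzbar : forall z, upper z -> d_zbar H z = B z) by (intros z Hz; apply (wirtinger_d_z _ _ _ _ (HHw z Hz))).
exists H; split; [split; [|split]|].
- apply wirtinger_C2_on with A B A1 A2 B1 B2; auto; apply Rcont; intros z Hz.
  + apply (rdiff_mult (fun _ => Cconj c)); [apply rdiff_const|].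
    unfold Cminus; apply rdiff_plus.
    * apply (rdiff_mult (fun _ => Cconj (- s))); [apply rdiff_const|].
      apply (rdiff_mult (fun _ => Cconj (- (s + - (1))))); [apply rdiff_const | now apply RT].
    * destruct (Rh p2 z) as [P [Q K]]; [intros w Hw; exact (Hp2' w Hw) | exact Hz|].
      exists (- (1) * P), (- (1) * Q); refine (wirtinger_ext _ _ _ _ _ _ (wirtinger_scal _ (- (1)) _ _ _ K)).
      intros; ring.
  + apply (rdiff_mult (fun _ => Cconj c)); [apply rdiff_const|].
    apply (rdiff_mult (fun _ => Cconj (- s))); [apply rdiff_const|].
    apply Rc, rdiff_mult; auto.
  + apply (rdiff_mult (fun _ => Cconj c)); [apply rdiff_const|].
    apply (Rc (fun z => - (s * pw (s - 1) z) * F z)).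
    destruct (rdiff_mult (fun _ => - s) _ z (rdiff_const _ z) (rdiff_mult _ _ z (Rp (s - 1) z Hz) (Rh F z HF Hz))) as [P [Q K]].
    exists P, Q; refine (wirtinger_ext _ _ _ _ _ _ K); intros; ring.
  + apply (rdiff_mult (fun _ => Cconj c)); [apply rdiff_const|].
    apply (Rc (fun z => s * pw (s - 1) z * F z + pw s z * F1 z)).
    apply rdiff_plus; apply rdiff_mult; auto.
    apply (rdiff_mult (fun _ => s)); [apply rdiff_const | auto].
- intros z Hz.
  assert (HD : wirtinger (d_zbar H) z (B1 z) (B2 z)).
  { refine (wirtinger_ext_loc _ _ _ _ _ (Im z) Hz _ (HBw z Hz)).
    intros w Hw; symmetry; apply Hzbar, upper_near with z, Hw. }
  unfold Defs.Delta; rewrite (proj1 (wirtinger_d_z _ _ _ _ HD)), Hzbar by exact Hz.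
  assert (Nz : z - Cconj z <> 0) by (apply upper_neq_0, upper_minus_lower; auto using lower_Cconj).
  (* Lowering the exponent in [B] by one releases a factor [2 i y], so that both terms of [Delta]
     carry [y * y] and the same power; their sum then has the factor [1 + Ci * Ci]. *)
  assert (E : pw s z = pw (s - 1) z * (z - Cconj z)).
  { unfold pw; rewrite cpow_up_minus_1 by exact Nz; field; exact Nz. }
  assert (E2 : Cconj (RtoC 2) = RtoC 2) by (apply C_ext; simpl; ring).
  unfold B1, B; rewrite E, im_alt', !Cmult_conj, Copp_conj, !Cmult_conj.
  assert (E3 : Cconj Ci = - Ci) by (apply C_ext; simpl; ring).
  assert (E4 : Cconj (RtoC (Im z)) = RtoC (Im z)) by (apply C_ext; simpl; ring).
  assert (E5 : Cconj s = Cconj r - 2) by (unfold s; rewrite Cminus_conj, E2; reflexivity).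
  rewrite E2, E3, E4, E5.
  set (y := RtoC (Im z)); set (P := Cconj (pw (s - 1) z)); set (cF := Cconj (F z)); set (cr := Cconj r).
  transitivity (4 * (1 + Ci * Ci) * (y * y) * (cr - 2) * Cconj c * P * cF); [ring | rewrite Ci_square; ring].
- intros g z Gg Hz.
  apply (proj2 (refl_invariant v r H g z (HG g Gg) (Hv g Gg) Hz)).
  pose proof (lower_Cconj z Hz) as Hl; set (t := Cconj z) in *.
  (* The functions [eichler F s z0] and [phi] have the same coboundary [psi], so their difference,
     and with it [refl H], is invariant. *)
  assert (E : forall t, refl H t = c * (eichler F s z0 t - phi t)).
  { intros x; unfold refl, H, refl; rewrite Cmult_conj, Cminus_conj, !Cconj_conj; reflexivity. }
  pose proof (eichler_slash G v r F z0 g t HA HF Gg (HG g Gg) (Hv g Gg) H0 Hl) as E1; fold s in E1.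
  rewrite (Hpsi g t Gg Hl) in E1.
  apply Ceq_minus.
  transitivity (c * ((slash_lo v r (eichler F s z0) g t - eichler F s z0 t) - (slash_lo v r phi g t - phi t))).
  + unfold slash_lo; rewrite !E; ring.
  + rewrite E1; ring.
- intros z Hz; rewrite Hzbar by exact Hz.
  apply eichler_const_spec; [exact Hz|].
  unfold B; rewrite <- Cmult_conj, Cconj_conj; reflexivity.
Qed.

Theorem theoremC (G : mat -> Prop) (r : C) (v : mat -> C) (F : C -> C) (z0 : C) :
  is_SL2_subgroup G -> is_discrete G -> G (mneg mI) ->
  finite_covolume G -> noncompact_quotient G ->
  multiplier_system G v r ->
  in_A G v r F ->
  upper z0 ->
  (psi_coboundary_minus_omega G v r F z0 <->
   exists H : C -> C, in_harm G v r H /\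
     forall z, upper z ->
       2 * Ci * cpow_up (RtoC (Im z)) (2 - r) * Cconj (d_zbar H z) = F z).
Proof.
intros [HG _] _ _ _ _ [Hv _] HA H0.
assert (HF : holo_upper F).
{ intros z Hz; destruct (proj1 HA z Hz) as [l Hl]; exists l; now apply is_derive_cderiv. }
split.
- now apply harmonic_of_coboundary.
- intros [H [Hh HE]]; now apply coboundary_of_harmonic with H.
Qed.
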